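(* Fix $T>0$, let $\mathcal R\in\mathbb R^{m\times n}$, let $a_d\in L^2(0,T;\mathbb R^m)$, and let $x_0=(a(0),\dot a(0),\eta(0),\dot\eta(0))\in\mathbb R^{2n+2N_c}$. Consider the system $$\ddot a+\Lambda a=C_\varepsilon\eta,\qquad \ddot\eta+2\Gamma_\varepsilon\dot\eta+K_\varepsilon\eta=u\qquad\text{on }(0,T)$$ with initial state $x_0$ and control $u\in L^2(0,T;\mathbb R^{N_c})$, and, for $\mu>0$, the functional $$\mathcal J_\mu(u)=\frac12\int_0^T\|\mathcal R a(t;u)-a_d(t)\|^2\,dt+\frac{\mu}{2}\int_0^T\|u(t)\|^2\,dt .$$ (i) For every $\mu>0$ there is a unique minimizer $u_\mu^*\in L^2(0,T;\mathbb R^{N_c})$ of $\mathcal J_\mu$ subject to this system. It is characterized by the adjoint system $$-\dot p_a+\Lambda p_v=\mathcal R^\top(\mathcal R a-a_d),\quad -\dot p_v-p_a=0,\quad -\dot p_\eta-C_\varepsilon^\top p_v+K_\varepsilon p_\zeta=0,\quad -\dot p_\zeta-p_\eta+2\Gamma_\varepsilon p_\zeta=0,$$ $$p_a(T)=p_v(T)=0,\qquad p_\eta(T)=p_\zeta(T)=0,$$ where $a$ is the acoustic component of the state corresponding to $u_\mu^*$, together with the stationarity relation $$\mu u_\mu^*+p_\zeta=0 .$$ (ii) Let $a_r\in H^2(0,T;\mathbb R^n)$ be a compatible finite-band reference, i.e. each of its components is in $\mathcal B_T(I)$, and suppose $\operatorname{rank}C_\varepsilon=n$. Let $$\eta_r=C_\varepsilon^\dagger(\ddot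 a_r+\Lambda a_r),\qquad u_r=(\partial_t^2+2\Gamma_\varepsilon\partial_t+K_\varepsilon)\eta_r ,$$ where $C_\varepsilon^\dagger$ is a fixed right inverse of $C_\varepsilon$, and let $I_\alpha\subset(0,\infty)$, $\alpha=1,\dots,N_c$, be compact bands with $(\eta_r)_\alpha\in\mathcal B_T(I_\alpha)$. Then $$\|u_r\|_{L^2(0,T)}^2\le\sum_{\alpha=1}^{N_c}\Big(\sup_{\nu\in I_\alpha}d_{\alpha,\varepsilon}(\nu)\Big)^2\|(\eta_r)_\alpha\|_{\mathcal B_T(I_\alpha)}^2 .$$ (iii) With $a_r$, $\eta_r$ and $I_\alpha$ as in (ii), if $x_0=0$ and $a_d=\mathcal R a_r$, then the optimal value $V_\mu(a_d;0):=\inf_{u\in L^2(0,T;\mathbb R^{N_c})}\mathcal J_\mu(u)$ satisfies $$V_\mu(a_d;0)\le\frac{\mu}{2}\sum_{\alpha=1}^{N_c}\Big(\sup_{\nu\in I_\alpha}d_{\alpha,\varepsilon}(\nu)\Big)^2\|(\eta_r)_\alpha\|_{\mathcal B_T(I_\alpha)}^2 .$$ (iv) At exact frequency matching, $$d_{\alpha,\varepsilon}(\omega_\alpha^\varepsilon)=2\gamma_\alpha^\varepsilon\omega_\alpha^\varepsilon+O\big((\gamma_\alpha^\varepsilon)^3\big).$$ Thus, when $\gamma_\alpha^\varepsilon=O(\varepsilon)$, the resonator-mediated input energy needed to generate a matched source is $O(\varepsilon^2)$ relative to the squared source output.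
   Context: $n,N_c,m\ge1$ are integers and $\varepsilon>0$ is a small parameter. $\Lambda=\operatorname{diag}(\omega_1^2,\dots,\omega_n^2)$ with $\omega_k>0$. $C_\varepsilon\in\mathbb R^{n\times N_c}$ is a real coupling matrix (in the acoustic model, $(C_\varepsilon)_{k\alpha}=c_0^2\beta_\alpha^\varepsilon\psi_k(y_\alpha)$, where $\psi_k$ are Dirichlet Laplace eigenfunctions, $y_\alpha$ are the centers of clusters of small resonant bubbles, $c_0>0$ is the wave speed and $\beta_\alpha^\varepsilon$ are nonzero real constants). The vector $a(t)\in\mathbb R^n$ collects acoustic modal coefficients and $\eta(t)\in\mathbb R^{N_c}$ the collective outputs of the bubble clusters. For $\alpha=1,\dots,N_c$ there are numbers $\gamma_\alpha^\varepsilon>0$, $\omega_\alpha^\varepsilon>0$ (from the collective resonance poles $s_\alpha^\varepsilon=-\gamma_\alpha^\varepsilon+\mathrm i\omega_\alpha^\varepsilon$ of the clusters), and $$\Gamma_\varepsilon=\operatorname{diag}(\gamma_1^\varepsilon,\dots,\gamma_{N_c}^\varepsilon),\qquad K_\varepsilon=\operatorname{diag}\big((\omega_\alpha^\varepsilon)^2+(\gamma_\alpha^\varepsilon)^2\big)_{\alpha=1}^{N_c}.$$ In asymptotic statements, $\gamma_\alpha^\varepsilon$ is small and the $\omega_\alpha^\varepsilon$ stay in a fixed compact subset of $(0,\infty)$ (they are close to fixed positive Minnaert frequencies). The multiplier is $$d_{\alpha,\varepsilon}(\nu)=\big|(\omega_\alpha^\varepsilon)^2+(\gamma_\alpha^\varepsilon)^2-\nu^2+2\mathrm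 i\gamma_\alpha^\varepsilon\nu\big| .$$ $a(t;u)\in\mathbb R^n$ denotes the $a$-component of the solution with control $u$ and initial state $x_0$. Finite-time band class: for compact $I\subset(0,\infty)$, a function $g\in L^2(0,T)$ belongs to $\mathcal B_T(I)$ if there is $\widetilde g\in L^2(\mathbb R)$ with $\widetilde g|_{(0,T)}=g$ and $\operatorname{supp}\widehat{\widetilde g}\subset I\cup(-I)$; the norm is $\|g\|_{\mathcal B_T(I)}=\inf\|\widetilde g\|_{L^2(\mathbb R)}$ over all such $\widetilde g$. The Fourier transform uses angular frequency, $\widehat{\partial_t g}(\nu)=\mathrm i\nu\widehat g(\nu)$.
   Formalization: In (iii) the reference is also assumed to start from the initial state: a_r, its derivative, η_r and its derivative vanish at t=0; without this the bound fails as μ→0, e.g. for n=N_c=m=1, R=1, a_r(0)≠0. *)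

(* Defs.v *)
From HB Require Import structures.
From mathcomp Require Import all_boot all_order all_algebra.
From mathcomp Require Import all_classical all_reals all_analysis.
From mathcomp Require Import complex.

Set Implicit Arguments.
Unset Strict Implicit.
Unset Printing Implicit Defensive.

Import Order.TTheory GRing.Theory Num.Theory numFieldNormedType.Exports.

Local Open Scope classical_set_scope.
Local Open Scope ring_scope.

Notation leb R := (@lebesgue_measure R).

Definition memL2 (R : realType) (D : set R) (f : R -> R) : Prop :=
  f \_ D \in Lfun (leb R) 2%:E.

Definition vmemL2 (R : realType) (k : nat) (D : set R) (f : R -> 'cV[R]_k) :
    Prop :=
  forall i, memL2 D (fun t => f t i 0).

(* The Euclidean norm; the norm of 'cV[R]_k in the library is the max norm. *)
Definition sqnorm (R : realType) (k : nat) (v : 'cV[R]_k) : R :=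
  \sum_i v i 0 ^+ 2.

Definition sqnormL2 (R : realType) (k : nat) (T : R) (f : R -> 'cV[R]_k) : R :=
  \int[leb R]_(t in `]0, T[) sqnorm (f t).

(* [g] is the absolutely continuous representative, on [0, T], of an element of
   H^1(0, T) whose derivative is the class of [dg]. *)
Definition H1_rep (R : realType) (T : R) (g dg : R -> R) : Prop :=
  memL2 `]0, T[ dg /\
  forall t, t \in `[0, T] -> g t = g 0 + \int[leb R]_(s in `[0, t]) dg s.

Definition vH1_rep (R : realType) (k : nat) (T : R) (g dg : R -> 'cV[R]_k) :
    Prop :=
  forall i, H1_rep T (fun t => g t i 0) (fun t => dg t i 0).

(* The class of [g] lies in H^1(0, T), with derivative [dg] and with value [c]
   at time 0 (the value of its continuous representative). *)
Definition H1_from (R : realType) (T c : R) (g dg : R -> R) : Prop :=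
  exists h, [/\ H1_rep T h dg, h 0 = c &
    {ae leb R, forall t, t \in `]0, T[ -> g t = h t}].

Definition weak_deriv (R : realType) (T : R) (g dg : R -> R) : Prop :=
  exists c, H1_from T c g dg.

Definition vweak_deriv (R : realType) (k : nat) (T : R)
    (g dg : R -> 'cV[R]_k) : Prop :=
  forall i, weak_deriv T (fun t => g t i 0) (fun t => dg t i 0).

Definition vH1_from (R : realType) (k : nat) (T : R) (c : 'cV[R]_k)
    (g dg : R -> 'cV[R]_k) : Prop :=
  forall i, H1_from T (c i 0) (fun t => g t i 0) (fun t => dg t i 0).

Definition fourier_trunc (R : realType) (g : R -> R) (N : nat) (nu : R) :
    R[i] :=
  ((\int[leb R]_(t in `[- N%:R, N%:R]) (g t * cos (nu * t))) -i*
   (\int[leb R]_(t in `[- N%:R, N%:R]) (g t * sin (nu * t))))%C.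

(* [h] is the Fourier--Plancherel transform of [g]: the limit in L^2(R) of the
   truncated integrals of g(t) exp(-i nu t), nu being an angular frequency. *)
Definition is_fourier (R : realType) (g : R -> R) (h : R -> R[i]) : Prop :=
  [/\ memL2 setT (fun nu => complex.Re (h nu)),
      memL2 setT (fun nu => complex.Im (h nu)) &
      (\int[leb R]_nu
         ((Normc.normc (h nu - fourier_trunc g N nu) ^+ 2)%:E))%E
      @[N --> \oo] --> 0%E].

(* The complement of the largest open set on which [h] vanishes a.e. *)
Definition ess_support (R : realType) (h : R -> R[i]) : set R :=
  ~` \bigcup_(U in [set U : set R | open U /\
                     {ae leb R, forall nu, U nu -> h nu = 0}]) U.

Definition band_extension (R : realType) (T : R) (I : set R) (g : R -> R) :
    set (R -> R) :=
  [set gt | [/\ memL2 setT gt,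
      {ae leb R, forall t, t \in `]0, T[ -> gt t = g t} &
      exists2 h, is_fourier gt h & ess_support h `<=` I `|` (-%R @` I)]].

Definition band_class (R : realType) (T : R) (I : set R) (g : R -> R) : Prop :=
  memL2 `]0, T[ g /\ band_extension T I g !=set0.

Definition band_norm (R : realType) (T : R) (I : set R) (g : R -> R) : R :=
  inf [set fine ('N[leb R]_2%:E[EFin \o gt])%E | gt in band_extension T I g].

Definition band (R : realType) (I : set R) : Prop :=
  compact I /\ I `<=` [set nu | 0 < nu].

Record model (R : realType) (n Nc : nat) := Model {
  acfreq : 'I_n -> R;
  coupling : 'M[R]_(n, Nc);
  decay : 'I_Nc -> R;
  resfreq : 'I_Nc -> R
}.

Definition Lambda (R : realType) (n Nc : nat) (P : model R n Nc) : 'M[R]_n :=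
  diag_mx (\row_k acfreq P k ^+ 2).

Definition Gamma (R : realType) (n Nc : nat) (P : model R n Nc) : 'M[R]_Nc :=
  diag_mx (\row_al decay P al).

Definition Kmx (R : realType) (n Nc : nat) (P : model R n Nc) : 'M[R]_Nc :=
  diag_mx (\row_al (resfreq P al ^+ 2 + decay P al ^+ 2)).

(* |om^2 + gam^2 - nu^2 + 2 i gam nu| *)
Definition multiplier (R : realType) (gam om nu : R) : R :=
  Normc.normc
    ((om ^+ 2 + gam ^+ 2 - nu ^+ 2) +i* (2 * gam * nu))%C.

(* States are listed in the order (a, a', eta, eta'). *)
Definition state (R : realType) (n Nc : nat) : Type :=
  ('cV[R]_n * 'cV[R]_n * 'cV[R]_Nc * 'cV[R]_Nc)%type.

Definition is_solution (R : realType) (n Nc : nat) (P : model R n Nc) (T : R)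
    (x0 : state R n Nc) (u : R -> 'cV[R]_Nc) (a da : R -> 'cV[R]_n)
    (eta deta : R -> 'cV[R]_Nc) : Prop :=
  (a 0, da 0, eta 0, deta 0) = x0 /\
  exists dda ddeta,
    [/\ vH1_rep T a da /\ vH1_rep T da dda,
        vH1_rep T eta deta /\ vH1_rep T deta ddeta,
        {ae leb R, forall t, t \in `]0, T[ ->
           dda t + Lambda P *m a t = coupling P *m eta t} &
        {ae leb R, forall t, t \in `]0, T[ ->
           ddeta t + 2 *: Gamma P *m deta t + Kmx P *m eta t = u t}].

(* a(t; u): for u in L^2 the solution exists and is unique on [0, T], so the
   choice below only affects times outside [0, T]. *)
Definition acoustic (R : realType) (n Nc : nat) (P : model R n Nc) (T : R)
    (x0 : state R n Nc) (u : R -> 'cV[R]_Nc) : R -> 'cV[R]_n :=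
  xget (fun=> 0)
    [set a | exists da eta deta, is_solution P T x0 u a da eta deta].

Definition cost (R : realType) (n Nc m : nat) (P : model R n Nc) (T : R)
    (Rm : 'M[R]_(m, n)) (ad : R -> 'cV[R]_m) (x0 : state R n Nc) (mu : R)
    (u : R -> 'cV[R]_Nc) : R :=
  2^-1 * sqnormL2 T (fun t => Rm *m acoustic P T x0 u t - ad t) +
  mu / 2 * sqnormL2 T u.

Definition is_minimizer (R : realType) (n Nc m : nat) (P : model R n Nc)
    (T : R) (Rm : 'M[R]_(m, n)) (ad : R -> 'cV[R]_m) (x0 : state R n Nc)
    (mu : R) (u : R -> 'cV[R]_Nc) : Prop :=
  vmemL2 `]0, T[ u /\
  forall v, vmemL2 `]0, T[ v ->
    cost P T Rm ad x0 mu u <= cost P T Rm ad x0 mu v.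

Definition optimal_value (R : realType) (n Nc m : nat) (P : model R n Nc)
    (T : R) (Rm : 'M[R]_(m, n)) (ad : R -> 'cV[R]_m) (x0 : state R n Nc)
    (mu : R) : R :=
  inf [set cost P T Rm ad x0 mu u | u in [set u | vmemL2 `]0, T[ u]].

Definition is_adjoint (R : realType) (n Nc m : nat) (P : model R n Nc) (T : R)
    (Rm : 'M[R]_(m, n)) (ad : R -> 'cV[R]_m) (a : R -> 'cV[R]_n)
    (pa pv : R -> 'cV[R]_n) (pe pz : R -> 'cV[R]_Nc) : Prop :=
  [/\ pa T = 0, pv T = 0, pe T = 0 & pz T = 0] /\
  exists dpa dpv dpe dpz,
    [/\ vH1_rep T pa dpa, vH1_rep T pv dpv, vH1_rep T pe dpe &
        vH1_rep T pz dpz] /\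
    {ae leb R, forall t, t \in `]0, T[ ->
      [/\ - dpa t + Lambda P *m pv t = Rm^T *m (Rm *m a t - ad t),
          - dpv t - pa t = 0,
          - dpe t - (coupling P)^T *m pv t + Kmx P *m pz t = 0 &
          - dpz t - pe t + 2 *: Gamma P *m pz t = 0]}.

(* [u] is the element (d^2/dt^2 + 2 gam d/dt + om^2 + gam^2) eta of
   L^2(0, T). *)
Definition resonator_input (R : realType) (T gam om : R) (eta u : R -> R) :
    Prop :=
  memL2 `]0, T[ u /\
  exists deta ddeta, [/\ weak_deriv T eta deta, weak_deriv T deta ddeta &
    {ae leb R, forall t, t \in `]0, T[ ->
      u t = ddeta t + 2 * gam * deta t + (om ^+ 2 + gam ^+ 2) * eta t}].

Definition vresonator_input (R : realType) (n Nc : nat) (P : model R n Nc)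
    (T : R) (eta u : R -> 'cV[R]_Nc) : Prop :=
  forall al, resonator_input T (decay P al) (resfreq P al)
    (fun t => eta t al 0) (fun t => u t al 0).

(* [ar] is a reference in H^2(0, T) with components in the band class of [I],
   and [etar] is the source Cd (ar'' + Lambda ar), with components in the band
   classes of the [Ia al]. *)
Definition band_reference (R : realType) (n Nc : nat) (P : model R n Nc)
    (T : R) (Cd : 'M[R]_(Nc, n)) (I : set R) (Ia : 'I_Nc -> set R)
    (ar : R -> 'cV[R]_n) (etar : R -> 'cV[R]_Nc) : Prop :=
  [/\ band I /\ forall k, band_class T I (fun t => ar t k 0),
      exists dar ddar, [/\ vweak_deriv T ar dar, vweak_deriv T dar ddar &
        {ae leb R, forall t, t \in `]0, T[ ->
          etar t = Cd *m (ddar t + Lambda P *m ar t)}] &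
      forall al, band (Ia al) /\
        band_class T (Ia al) (fun t => etar t al 0)].

(* The reference trajectory starts from the state [x0]. *)
Definition compatible (R : realType) (n Nc : nat) (T : R) (x0 : state R n Nc)
    (ar : R -> 'cV[R]_n) (etar : R -> 'cV[R]_Nc) : Prop :=
  let: (a0, da0, eta0, deta0) := x0 in
  exists dar ddar detar ddetar,
    [/\ vH1_from T a0 ar dar, vH1_from T da0 dar ddar,
        vH1_from T eta0 etar detar & vH1_from T deta0 detar ddetar].

Definition energy_bound (R : realType) (n Nc : nat) (P : model R n Nc) (T : R)
    (Ia : 'I_Nc -> set R) (etar : R -> 'cV[R]_Nc) : R :=
  \sum_al sup [set multiplier (decay P al) (resfreq P al) nu | nu in Ia al] ^+ 2
          * band_norm T (Ia al) (fun t => etar t al 0) ^+ 2.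

Definition sinusoid (R : realType) (om A B t : R) : R :=
  A * cos (om * t) + B * sin (om * t).

(* Main.v *)
(* Written as a first-order system x' = A x + B u, the minimization problem has
   the optimality system of a linear-quadratic problem, a two-point boundary value
   problem for a linear differential equation.  The duality identity
   int <B^T p, v> = int <r, H y> shows that it is injective, hence, in finite
   dimension, solvable; it also shows that the cost of v exceeds that of the
   solution u by at least (mu / 2) |v - u|^2, which gives (i).

   For (ii), Parseval's identity on the half line nu > 0 is obtained by damping
   with exp(- e nu), which turns products of cosine and sine transforms into
   Poisson kernels.  It yields the Bessel inequality for functions on a bounded
   interval and shows that an extension gt of eta_r with transform supported in
   I u (-I) agrees a.e. with the superposition
   int_I (p(nu) cos(nu t) + q(nu) sin(nu t)) dnu, with
   int_I (p^2 + q^2) <= |gt|^2 / pi.  The resonator rotates (p, q) and multiplies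
   its length by d(nu), and the energy of a superposition on (0, T) is at most pi
   times that of its amplitudes, by duality with the Bessel inequality.

   In (iii) the input u_r drives the system exactly along the reference, so that
   only its energy contributes to the cost.  In (iv) the squared multiplier at
   nu = om is gam^4 + 4 gam^2 om^2, and a matched source S requires the input
   gam^2 S + 2 gam S'. *)
Require Import Defs.
From HB Require Import structures.
From mathcomp Require Import all_boot all_order all_algebra.
From mathcomp Require Import all_classical all_reals all_analysis.
From mathcomp Require Import measurable_realfun ring lra complex.
Import Order.TTheory GRing.Theory Num.Theory numFieldNormedType.Exports.
Local Open Scope classical_set_scope.
Local Open Scope ring_scope.

Set Implicit Arguments.
Unset Strict Implicit.
Unset Printing Implicit Defensive.

(** * Integration and H^1 on an interval *)

Section integrability.
Variable R : realType.
Notation mu := (@lebesgue_measure R).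
Implicit Types (D E : set R) (f g : R -> R).

(** Derivatives are given by integral identities and transforms only as L2 limits, so pointwise
    calculus is mostly avoided. The product rule for [H1_rep] is Fubini's theorem on a triangle, and
    Lebesgue differentiation recovers a derivative from its primitive. Inversion is not pointwise
    either: a transform is paired with that of the indicator of [0, t], whose Poisson integral is an
    explicit difference of arctangents, and the resulting primitives determine the function. The
    half line nu > 0 suffices because signals are real and bands positive, so that -I never meets
    it. It also explains every pi: the cosine transform of exp(- e nu) has total mass pi. Bessel's
    inequality costs a factor pi, the amplitudes c / pi and s / pi bring pi^-1, and the two cancel
    in the bound of (ii). That bound is proved for each extension separately, since the
    superposition depends on the extension; the infimum comes last. In (iv) the energy of S' has to
    be controlled by that of S on a window that may be shorter than a period. This rests on |sin(w
    T)| < w T and on compactness of the set of frequencies. *)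

Definition L1 D f := mu.-integrable D (EFin \o f).

(** The working form of square integrability: unlike [memL2], it speaks of [f] on [D] itself and not
    of its extension by zero. *)
Definition L2 D f := measurable_fun D f /\ L1 D (fun x => f x ^+ 2).

Lemma L1_measurable D f : L1 D f -> measurable_fun D f.
Proof. by move=> /integrableP[/measurable_EFinP]. Qed.

Lemma L1S D E f : measurable D -> measurable E -> E `<=` D -> L1 D f -> L1 E f.
Proof. by move=> mD mE ED; apply: integrableS. Qed.

Lemma L1D D f g : measurable D -> L1 D f -> L1 D g -> L1 D (fun x => f x + g x).
Proof. by move=> mD; apply: integrableD. Qed.

Lemma L1B D f g : measurable D -> L1 D f -> L1 D g -> L1 D (fun x => f x - g x).
Proof. by move=> mD; apply: integrableB. Qed.

Lemma L1Z D (c : R) f : measurable D -> L1 D f -> L1 D (fun x => c * f x).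
Proof. by move=> mD; apply: integrableZl. Qed.

Lemma L1Zr D (c : R) f : measurable D -> L1 D f -> L1 D (fun x => f x * c).
Proof. by move=> mD; apply: integrableZr. Qed.

Lemma L10 D : L1 D (fun=> 0).
Proof. exact: integrable0. Qed.

Lemma L1_sum D I (r : seq I) (P : pred I) (F : I -> R -> R) : measurable D ->
  (forall i, L1 D (F i)) -> L1 D (fun x => \sum_(i <- r | P i) F i x).
Proof.
move=> mD iF; elim: r => [|i r ih].
  by under eq_fun do rewrite big_nil; exact: L10.
under eq_fun do rewrite big_cons.
by case: (P i) => //; exact: L1D.
Qed.

Lemma L1_le D f g : measurable D -> measurable_fun D f -> L1 D g ->
  (forall x, D x -> `|f x| <= g x) -> L1 D f.
Proof.
move=> mD mf ig fg; apply: (@le_integrable _ _ _ mu D mD _ (EFin \o g)) => //.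
  exact/measurable_EFinP.
move=> x Dx /=; rewrite lee_fin (le_trans (fg _ Dx))//; exact: ler_norm.
Qed.

Lemma L1_norm D f : L1 D f -> L1 D (fun x => `|f x|).
Proof. exact: integrable_norm. Qed.

Lemma L1_cst D (c : R) : measurable D -> (mu D < +oo)%E -> L1 D (fun=> c).
Proof.
move=> mD Dfin; apply/integrableP; split; first exact/measurable_EFinP.
rewrite /= integral_cst//.
by rewrite lte_mul_pinfty// lee_fin.
Qed.

Lemma L1_bounded D f (M : R) : measurable D -> (mu D < +oo)%E ->
  measurable_fun D f -> (forall x, D x -> `|f x| <= M) -> L1 D f.
Proof.
move=> mD Dfin mf fM; apply: (@L1_le _ _ (fun=> M)) => //.
exact: L1_cst.
Qed.

Lemma L1_mul_bounded D f g (M : R) : measurable D -> L1 D f ->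
  measurable_fun D g -> (forall x, D x -> `|g x| <= M) ->
  L1 D (fun x => f x * g x).
Proof.
move=> mD if_ mg gM; apply: (@L1_le _ _ (fun x => M * `|f x|)) => //.
- by apply: measurable_funM => //; exact: L1_measurable.
- by apply: L1Z => //; exact: L1_norm.
- by move=> x Dx; rewrite normrM mulrC ler_wpM2r// gM.
Qed.

Lemma L1_eq D f g : measurable D -> (forall x, D x -> f x = g x) -> L1 D f -> L1 D g.
Proof.
move=> mD fg; rewrite /L1; apply: eq_integrable => // x xD /=.
by rewrite fg//; exact: set_mem.
Qed.

Lemma L1_ae D f g : measurable D -> measurable_fun D g ->
  {ae mu, forall x, D x -> f x = g x} -> L1 D f -> L1 D g.
Proof.
move=> mD mg fg /integrableP[mf foo]; apply/integrableP; split.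
  exact/measurable_EFinP.
rewrite (@ge0_ae_eq_integral _ _ _ mu D _ (fun x => `|(f x)%:E|%E))//.
- by apply: measurableT_comp => //; exact/measurable_EFinP.
- by apply: measurableT_comp.
- exact: (ae_eq_comp (fun y => `|y%:E|%E) (ae_eq_sym fg)).
Qed.

Lemma L2_L1mul D f g : measurable D -> L2 D f -> L2 D g ->
  L1 D (fun x => f x * g x).
Proof.
move=> mD [mf if2] [mg ig2].
apply: (@L1_le _ _ (fun x => f x ^+ 2 + g x ^+ 2)) => //.
- exact: measurable_funM.
- exact: L1D.
- move=> x _; rewrite ler_norml; apply/andP; split; nra.
Qed.

Lemma L2_sqr_sub D f g : measurable D -> L2 D f -> L2 D g ->
  L1 D (fun x => (f x - g x) ^+ 2).
Proof.
move=> mD lf lg.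
apply: (@L1_eq _ (fun x => f x ^+ 2 + (- 2 * (f x * g x)) + g x ^+ 2)) => //.
  by move=> x _; ring.
apply: L1D => //; last exact: lg.2.
apply: L1D => //; first exact: lf.2.
by apply: L1Z => //; exact: L2_L1mul.
Qed.

Lemma L2B D f g : measurable D -> L2 D f -> L2 D g -> L2 D (fun x => f x - g x).
Proof.
move=> mD lf lg; split; last exact: L2_sqr_sub.
by apply: measurable_funB; [exact: lf.1|exact: lg.1].
Qed.

Lemma L2Z D (c : R) f : measurable D -> L2 D f -> L2 D (fun x => c * f x).
Proof.
move=> mD [mf if2]; split; first exact: measurable_funM.
by under eq_fun do rewrite exprMn; exact: L1Z.
Qed.

Lemma L20 D : measurable D -> L2 D (fun=> 0).
Proof.
move=> mD; split => //; apply: (@L1_eq _ (fun=> 0)) => //; last exact: L10.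
by move=> x _; rewrite expr0n.
Qed.

Lemma L2N D f : measurable D -> L2 D f -> L2 D (fun x => - f x).
Proof. by move=> mD /(L2Z (-1) mD); under eq_fun do rewrite mulN1r. Qed.

Lemma L2D D f g : measurable D -> L2 D f -> L2 D g -> L2 D (fun x => f x + g x).
Proof.
move=> mD lf /(L2N mD) lg; have := L2B mD lf lg.
by under eq_fun do rewrite opprK.
Qed.

Lemma L2_sum D I (r : seq I) (P : pred I) (F : I -> R -> R) : measurable D ->
  (forall i, L2 D (F i)) -> L2 D (fun x => \sum_(i <- r | P i) F i x).
Proof.
move=> mD iF; elim: r => [|i r ih].
  by under eq_fun do rewrite big_nil; exact: L20.
under eq_fun do rewrite big_cons.
by case: (P i) => //; exact: L2D.
Qed.

Lemma L2S D E f : measurable D -> measurable E -> E `<=` D -> L2 D f -> L2 E f.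
Proof.
move=> mD mE ED [mf if2]; split; last exact: L1S if2.
exact: measurable_funS mf.
Qed.

Lemma L2_bounded D f (M : R) : measurable D -> (mu D < +oo)%E ->
  measurable_fun D f -> (forall x, D x -> `|f x| <= M) -> L2 D f.
Proof.
move=> mD Dfin mf fM; split => //.
apply: (@L1_bounded _ _ (M ^+ 2)) => //; first exact: measurable_funX.
by move=> x Dx; rewrite normrX lerXn2r// ?nnegrE// ?(le_trans _ (fM _ Dx))// fM.
Qed.

Lemma L2_mul_bounded D f g (M : R) : measurable D -> L2 D f ->
  measurable_fun D g -> (forall x, D x -> `|g x| <= M) ->
  L2 D (fun x => f x * g x).
Proof.
move=> mD [mf if2] mg gM; split; first exact: measurable_funM.
under eq_fun do rewrite exprMn.
apply: (@L1_mul_bounded _ _ _ (M ^+ 2)) => //; first exact: measurable_funX.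
by move=> x Dx; rewrite normrX lerXn2r// ?nnegrE// ?(le_trans _ (gM _ Dx))// gM.
Qed.

Lemma L2_L1 D f : measurable D -> (mu D < +oo)%E -> L2 D f -> L1 D f.
Proof.
move=> mD Dfin [mf if2]; apply: (@L1_le _ _ (fun x => 1 + f x ^+ 2)) => //.
  by apply: L1D => //; exact: L1_cst.
move=> x _; rewrite ler_norml; apply/andP; split; nra.
Qed.

Lemma L2_eq D f g : measurable D -> (forall x, D x -> f x = g x) -> L2 D f -> L2 D g.
Proof.
move=> mD fg [mf if2]; split.
  by apply: eq_measurable_fun mf => x xD; rewrite fg//; exact: set_mem.
by apply: L1_eq if2 => // x Dx; rewrite fg.
Qed.

Lemma L2_ae D f g : measurable D -> measurable_fun D g ->
  {ae mu, forall x, D x -> f x = g x} -> L2 D f -> L2 D g.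
Proof.
move=> mD mg fg [mf if2]; split=> //.
apply: (L1_ae (f := fun x => f x ^+ 2)) => //; first exact: measurable_funX.
exact: (ae_eq_comp (fun y => y ^+ 2) fg).
Qed.

Lemma memL2P D f : measurable D -> memL2 D f <-> L2 D f.
Proof.
move=> mD; rewrite /memL2; split => [lf|[mf if2]].
  split.
    move: (lf); rewrite inE => /andP[/[!inE]/= + _].
    by move/(measurable_restrictT _ mD).
  apply: ((@integrable_mkcond _ _ _ mu _ (EFin \o (fun x => f x ^+ 2)) mD).2).
  have := Lfun2_integrable_sqr lf; apply: eq_integrable => //= x _ /=.
  by rewrite !patchE/=; case: ifPn => //; rewrite expr0n.
rewrite inE; apply/andP; split; rewrite inE/=.
  exact/(measurable_restrictT _ mD).
rewrite /finite_norm unlock/=.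
apply: poweR_lty.
move/integrableP : if2 => [_]; rewrite integral_mkcond; apply: le_lt_trans.
rewrite le_eqVlt; apply/orP; left; apply/eqP; apply: eq_integral => x _.
rewrite /= !patchE/=; case: ifPn => _.
  by rewrite normrX -powR_mulrn.
by congr EFin; rewrite normr0 powR0.
Qed.

(** The theorem uses open time intervals, while primitives live on closed ones; the endpoints are
    negligible, and measurability survives adding them. *)
Lemma L1_itv_oo_cc (a b : R) f : L1 `]a, b[ f -> L1 `[a, b] f.
Proof.
move=> h; have mf : measurable_fun `[a, b] f.
  apply/measurable_fun_itv_obnd_cbndP/measurable_fun_itv_bndo_bndcP.
  exact: L1_measurable.
apply/integrableP; split; first exact/measurable_EFinP.
move/integrableP : h => [_]; apply: le_lt_trans.
by rewrite (@integral_itv_bndoo _ _ _ _ true false)//; apply/measurable_EFinP/measurableT_comp => //;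
  apply: measurable_funS mf => //; exact: subset_itv_oo_cc.
Qed.

Lemma L2_itv_oo_cc (a b : R) f : L2 `]a, b[ f -> L2 `[a, b] f.
Proof.
move=> [mf if2]; split; last exact: L1_itv_oo_cc.
by apply/measurable_fun_itv_obnd_cbndP/measurable_fun_itv_bndo_bndcP.
Qed.

Lemma Rintegral_itv_oo_cc (a b : R) f : L1 `]a, b[ f ->
  \int[mu]_(t in `]a, b[) f t = \int[mu]_(t in `[a, b]) f t.
Proof.
move=> h; rewrite Rintegral_itv_bndo_bndc// Rintegral_itv_obnd_cbnd//.
apply: L1S (L1_itv_oo_cc h) => //; apply: subset_itvr; by rewrite bnd_simp.
Qed.

Lemma ae_eq_Rintegral D f g : measurable D -> measurable_fun D f ->
    measurable_fun D g -> {ae mu, forall x, D x -> f x = g x} ->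
  \int[mu]_(x in D) f x = \int[mu]_(x in D) g x.
Proof.
move=> mD mf mg fg; congr fine; apply: ae_eq_integral => //.
- exact/measurable_EFinP.
- exact/measurable_EFinP.
- exact: (ae_eq_comp EFin fg).
Qed.

Lemma L1_RintegralD D f g : measurable D -> L1 D f -> L1 D g ->
  \int[mu]_(x in D) (f x + g x) = \int[mu]_(x in D) f x + \int[mu]_(x in D) g x.
Proof. by move=> mD lf lg; rewrite RintegralD. Qed.

Lemma L1_RintegralB D f g : measurable D -> L1 D f -> L1 D g ->
  \int[mu]_(x in D) (f x - g x) = \int[mu]_(x in D) f x - \int[mu]_(x in D) g x.
Proof. by move=> mD lf lg; rewrite RintegralB. Qed.

Lemma Rintegral0_ae0 D f : measurable D -> L1 D f -> (forall x, D x -> 0 <= f x) ->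
  \int[mu]_(x in D) f x <= 0 -> {ae mu, forall x, D x -> f x = 0}.
Proof.
move=> mD if_ f0 fle0.
have fE : (\int[mu]_(x in D) (f x)%:E = 0)%E.
  rewrite -[LHS]fineK; last exact: integrable_fin_num.
  by congr EFin; apply/eqP; rewrite eq_le fle0 Rintegral_ge0.
have := ae_eq_integral_abs mu mD (f := EFin \o f).
move=> /(_ (measurable_int _ if_))[+ _].
have -> : (\int[mu]_(x in D) `|(EFin \o f) x| = \int[mu]_(x in D) (f x)%:E)%E.
  apply: eq_integral => x xD /=; rewrite ger0_norm// f0//; exact: set_mem.
by move=> /(_ fE); apply: filterS => x /= h /h[].
Qed.
End integrability.

(** * Fubini's theorem for bounded kernels *)

Section kernel.
Variable R : realType.
Notation mu := (@lebesgue_measure R).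
Implicit Types (A B D : set R) (a b f g : R -> R) (K : R * R -> R).

Lemma L1_section D f K (M : R) (x : R) : measurable D -> L1 D f ->
  measurable_fun setT K -> (forall z, `|K z| <= M) ->
  L1 D (fun y => f y * K (x, y)).
Proof.
move=> mD lf mK KM; apply: (L1_mul_bounded (M := M)) => //.
by apply: measurable_funTS; exact: measurableT_comp.
Qed.

(** Measurability in the parameter comes from Tonelli's theorem, which needs a sign; the positive
    and negative parts of the integrand are treated apart. *)
Lemma measurable_Rintegral_kernel D f K : measurable D -> measurable_fun D f ->
  measurable_fun setT K ->
  measurable_fun setT (fun x => \int[mu]_(y in D) (f y * K (x, y))).
Proof.
move=> mD mf mK.
pose h z := ((f \_ D) z.2 * K z)%:E.
have mh : measurable_fun setT h.
  apply/measurable_EFinP; apply: measurable_funM => //.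
  by apply: measurableT_comp => //; exact/(measurable_restrictT _ mD).
have -> : (fun x => \int[mu]_(y in D) (f y * K (x, y))) =
    (fun x => fine (\int[mu]_y h (x, y))%E).
  apply/funext => x; rewrite Rintegral_mkcond; congr fine.
  by apply: eq_integral => y _; rewrite /h !patchE/=; case: ifPn => //; rewrite mul0r.
apply: measurableT_comp => //.
under eq_fun do rewrite integralE.
apply: emeasurable_funB.
- under eq_fun do under eq_integral do rewrite funepos_comp/=.
  apply: (@measurable_fun_fubini_tonelli_F _ _ _ _ _ mu (h^\+)%E) => //.
  exact: measurable_funepos.
- under eq_fun do under eq_integral do rewrite funeneg_comp/=.
  apply: (@measurable_fun_fubini_tonelli_F _ _ _ _ _ mu (h^\-)%E) => //.
  exact: measurable_funeneg.
Qed.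

Lemma Rintegral_kernel_bound D f K (M : R) (x : R) : measurable D -> L1 D f ->
  measurable_fun setT K -> (forall z, `|K z| <= M) ->
  `|\int[mu]_(y in D) (f y * K (x, y))| <= M * \int[mu]_(y in D) `|f y|.
Proof.
move=> mD lf mK KM; apply: le_trans.
  by apply: le_normr_Rintegral => //; exact: L1_section KM.
rewrite -RintegralZl//; last exact: L1_norm.
apply: le_Rintegral => //.
- by apply: L1_norm; exact: L1_section KM.
- by apply: L1Z => //; exact: L1_norm.
- by move=> y Dy; rewrite normrM mulrC ler_wpM2r.
Qed.

Lemma L1_Rintegral_kernel A B a b K (M : R) : measurable A -> measurable B ->
  L1 A a -> L1 B b -> measurable_fun setT K -> (forall z, `|K z| <= M) ->
  L1 A (fun x => a x * \int[mu]_(y in B) (b y * K (x, y))).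
Proof.
move=> mA mB la lb mK KM.
apply: (L1_mul_bounded (M := M * \int[mu]_(y in B) `|b y|)) => //.
  apply: measurable_funTS; apply: measurable_Rintegral_kernel => //.
  exact: L1_measurable.
by move=> x _; exact: Rintegral_kernel_bound.
Qed.

(** The exchange of integrals used throughout. The weights are integrable and the kernel is bounded,
    so the product, extended by zero to the plane, is dominated by M |a| |b|. This covers the
    triangle indicator, the trigonometric kernels and the Poisson kernel. *)
Lemma Fubini_kernel A B a b K (M : R) : measurable A -> measurable B ->
  L1 A a -> L1 B b -> measurable_fun setT K -> (forall z, `|K z| <= M) ->
  \int[mu]_(x in A) (a x * \int[mu]_(y in B) (b y * K (x, y))) =
  \int[mu]_(y in B) (b y * \int[mu]_(x in A) (a x * K (x, y))).
Proof.
move=> mA mB la lb mK KM.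
have mK' : measurable_fun setT (fun z => K (z.2, z.1)).
  by apply: measurableT_comp => //; exact: measurable_fun_pair.
pose h z := ((a \_ A) z.1 * (b \_ B) z.2 * K z)%:E.
have mh : measurable_fun setT h.
  apply/measurable_EFinP; apply: measurable_funM => //.
  apply: measurable_funM; apply: measurableT_comp => //.
    by apply/(measurable_restrictT _ mA); exact: L1_measurable.
  by apply/(measurable_restrictT _ mB); exact: L1_measurable.
pose F x := a x * \int[mu]_(y in B) (b y * K (x, y)).
pose G y := b y * \int[mu]_(x in A) (a x * K (x, y)).
have innerE x : (\int[mu]_y h (x, y) = ((F \_ A) x)%:E)%E.
  rewrite patchE; case: ifPn => xA; last first.
    under eq_integral do rewrite /h /= patchE (negbTE xA) !mul0r.
    by rewrite integral0.
  have lh : L1 B (fun y => a x * (b y * K (x, y))).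
    by apply: L1Z => //; exact: L1_section KM.
  rewrite /F -RintegralZl//; last exact: L1_section KM.
  rewrite /Rintegral fineK; last exact: integrable_fin_num.
  rewrite [RHS]integral_mkcond; apply: eq_integral => y _.
  rewrite /h/= !patchE xA; case: ifPn => yB; first by rewrite mulrA.
  by rewrite mulr0 mul0r.
have innerE' y : (\int[mu]_x h (x, y) = ((G \_ B) y)%:E)%E.
  rewrite patchE; case: ifPn => yB; last first.
    under eq_integral do rewrite /h /= [X in _ * X * _]patchE (negbTE yB) mulr0 mul0r.
    by rewrite integral0.
  have lh : L1 A (fun x => b y * (a x * K (x, y))).
    by apply: L1Z => //; exact: (L1_section (K := fun z => K (z.2, z.1)) (M := M)).
  rewrite /G -RintegralZl//;
    last exact: (L1_section (K := fun z => K (z.2, z.1)) (M := M)).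
  rewrite /Rintegral fineK; last exact: integrable_fin_num.
  rewrite [RHS]integral_mkcond; apply: eq_integral => x _.
  rewrite /h/= !patchE yB; case: ifPn => xA; first by rewrite mulrCA mulrA.
  by rewrite !mul0r.
(* Integrability on the plane is read off the iterated integral of the modulus, whose inner integral
   is at most M |b|_1 |a x|. *)
have ih : (mu \x mu)%E.-integrable setT h.
  apply/integrable12ltyP => //.
  set c := \int[mu]_(y in B) `|b y|.
  have : L1 A (fun x => M * c * `|a x|) by apply: L1Z => //; exact: L1_norm.
  move=> /integrableP[_]; apply: le_lt_trans.
  rewrite [leRHS]integral_mkcond; apply: ge0_le_integral => //.
  - by move=> x _; exact: integral_ge0.
  - apply: (@measurable_fun_fubini_tonelli_F _ _ _ _ _ mu (abse \o h)).
      exact: measurableT_comp.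
    by move=> z; exact: abse_ge0.
  - apply/(measurable_restrictT _ mA); apply: measurableT_comp => //.
    apply/measurable_EFinP; apply: measurable_funM => //.
    by apply: measurableT_comp => //; exact: L1_measurable.
  - move=> x _; rewrite patchE; case: ifPn => xA; last first.
      under eq_integral do rewrite /h /= patchE (negbTE xA) !mul0r normr0.
      by rewrite integral0.
    have lb' := L1_norm lb.
    apply: (@le_trans _ _ (\int[mu]_(y in B) (M * `|a x| * `|b y|)%:E)%E).
      rewrite [leRHS]integral_mkcond; apply: ge0_le_integral => //.
      + by apply: measurableT_comp => //; exact: measurableT_comp.
      + apply/(measurable_restrictT _ mB); apply/measurable_EFinP.
        by apply: measurable_funM => //; exact: L1_measurable lb'.
      + move=> y _; rewrite /h /= !patchE xA; case: ifPn => yB.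
          by rewrite lee_fin !normrM mulrC mulrA ler_wpM2r// ler_wpM2r.
        by rewrite mulr0 mul0r normr0.
    rewrite -[leLHS]fineK; last first.
      by apply: integrable_fin_num => //; exact: L1Z.
    rewrite lee_fin [leLHS]RintegralZl//.
    rewrite -/c mulrAC; exact: ler_norm.
have fub : (\int[mu]_x ((F \_ A) x)%:E = \int[mu]_y ((G \_ B) y)%:E)%E.
  transitivity (\int[mu]_x \int[mu]_y h (x, y))%E.
    by apply: eq_integral => x _; rewrite innerE.
  by rewrite (Fubini ih); apply: eq_integral => y _; rewrite innerE'.
rewrite Rintegral_mkcond [RHS]Rintegral_mkcond.
exact: (congr1 fine fub).
Qed.

End kernel.

(** * Almost everywhere statements *)

Section ae.
Variable R : realType.
Notation mu := (@lebesgue_measure R).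
Implicit Types P Q S : R -> Prop.

Lemma ae_imp P Q : (forall x, P x -> Q x) ->
  {ae mu, forall x, P x} -> {ae mu, forall x, Q x}.
Proof. by move=> PQ; exact: (@filterS _ _ (ae_filter_ringOfSetsType mu)). Qed.

Lemma ae_imp2 P Q S : (forall x, P x -> Q x -> S x) ->
  {ae mu, forall x, P x} -> {ae mu, forall x, Q x} -> {ae mu, forall x, S x}.
Proof. by move=> PQS; exact: (@filterS2 _ _ (ae_filter_ringOfSetsType mu)). Qed.

Lemma ae_imp3 P Q S (U : R -> Prop) : (forall x, P x -> Q x -> S x -> U x) ->
  {ae mu, forall x, P x} -> {ae mu, forall x, Q x} -> {ae mu, forall x, S x} ->
  {ae mu, forall x, U x}.
Proof. by move=> PQS; exact: (@filterS3 _ _ (ae_filter_ringOfSetsType mu)). Qed.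

Lemma ae_forall (I : finType) (P : I -> R -> Prop) :
  (forall i, {ae mu, forall x, P i x}) -> {ae mu, forall x, forall i, P i x}.
Proof.
move=> h.
have : {ae mu, forall x, forall i, i \in enum I -> P i x}.
  elim: (enum I) => [|i s ih]; first exact: aeW.
  apply: ae_imp2 (h i) ih => x Pi Ps j; rewrite inE => /orP[/eqP->//|]; exact: Ps.
by apply: ae_imp => x h' i; apply: h'; rewrite mem_enum.
Qed.

Lemma itv_finite (b0 b1 : bool) (a b : R) :
  (mu [set` Interval (BSide b0 a) (BSide b1 b)] < +oo)%E.
Proof.
by rewrite lebesgue_measure_itv; case: ifPn => // _; rewrite -EFinB ltry.
Qed.

Lemma ae_itv_nonempty (a b : R) P : a < b ->
  {ae mu, forall t, t \in `]a, b[ -> P t} -> exists2 t, t \in `]a, b[ & P t.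
Proof.
move=> ab [N [mN N0 PN]]; apply: contrapT => nP.
have : `]a, b[%classic `<=` N.
  by move=> t tab; apply: PN => /= h; apply: nP; exists t => //; exact: h.
move=> /(le_measure mu); rewrite !inE => /(_ (measurable_itv _) mN).
move=> h; have muab : mu `]a, b[%classic = (b - a)%:E.
  by have := lebesgue_measure_itv `]a, b[%R; rewrite /= lte_fin ab -EFinB.
have : ((b - a)%:E <= 0)%E.
  by rewrite -muab; apply: (le_trans h); rewrite le_eqVlt; apply/orP; left; apply/eqP; exact: N0.
by rewrite lee_fin subr_le0 leNgt ab.
Qed.

End ae.

(** * Primitives of integrable functions *)

Section primitive.
Variable R : realType.
Notation mu := (@lebesgue_measure R).
Implicit Types (f g : R -> R) (t T : R).

(** Indicator of the triangle s <= t. It turns a primitive into an integral over a fixed interval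
    against a bounded kernel, to which [Fubini_kernel] applies. *)
Definition leK (z : R * R) : R := ((z.2 <= z.1)%R : bool)%:R.

Lemma measurable_leK : measurable_fun setT leK.
Proof.
apply: (@measurableT_comp _ _ _ _ _ _ (fun b : bool => b%:R : R)) => //.
exact: measurable_fun_ler.
Qed.

Lemma leK_le1 z : `|leK z| <= 1.
Proof. by rewrite /leK; case: (z.2 <= z.1); rewrite ?normr1 ?normr0. Qed.

Lemma Rintegral_primE f t T : t <= T ->
  \int[mu]_(s in `[0, t]) f s = \int[mu]_(s in `[0, T]) (f s * leK (t, s)).
Proof.
move=> tT; have -> : `[0, t]%classic = `[0, T]%classic `&` `]-oo, t]%classic.
  apply/seteqP; split => s /=; rewrite !in_itv/=.
    by move=> /andP[-> st]; rewrite (le_trans st tT).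
  by move=> [/andP[-> _] ->].
rewrite Rintegral_mkcondr; apply: eq_Rintegral => s _.
by rewrite patchE/leK/= mem_setE in_itv/=; case: (s <= t); rewrite ?mulr1 ?mulr0.
Qed.

(** With the arguments of the kernel exchanged, integration runs over [t, T]. The complement [0, t[
    is half open, which the integral does not see. *)
Lemma Rintegral_primC f t T : t \in `[0, T] -> L1 `[0, T] f ->
  \int[mu]_(s in `[0, T]) (f s * leK (s, t)) =
  \int[mu]_(s in `[0, T]) f s - \int[mu]_(s in `[0, t]) f s.
Proof.
rewrite in_itv/= => /andP[t0 tT] lf.
have lf' : L1 `[0, t] f.
  by apply: L1S lf => //; apply: subset_itvl; rewrite bnd_simp.
have -> : \int[mu]_(s in `[0, t]) f s =
    \int[mu]_(s in `[0, T]) (f s * (1 - leK (s, t))).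
  rewrite -Rintegral_itv_bndo_bndc; last first.
    by apply: L1S lf' => //; exact: subset_itv_co_cc.
  have -> : `[0, t[%classic = `[0, T]%classic `&` `]-oo, t[%classic.
    apply/seteqP; split => s /=; rewrite !in_itv/=.
      by move=> /andP[-> st]; rewrite (ltW (lt_le_trans st tT)).
    by move=> [/andP[-> _] ->].
  rewrite Rintegral_mkcondr; apply: eq_Rintegral => s _.
  rewrite patchE/leK/= mem_setE in_itv/= ltNge.
  by case: (t <= s); rewrite ?subrr ?subr0 ?mulr1 ?mulr0.
have mK : measurable_fun `[0, T] (fun s => leK (s, t)).
  by apply: measurable_funTS; apply: measurableT_comp => //; exact: measurable_leK.
have lK : L1 `[0, T] (fun s => f s * leK (s, t)).
  by apply: (L1_mul_bounded (M := 1)) => // s _; exact: leK_le1.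
rewrite -RintegralB//.
  by apply: eq_Rintegral => s _; ring.
apply: (@L1_eq _ _ (fun s => f s - f s * leK (s, t))) => //; last exact: L1B.
by move=> s _; ring.
Qed.

Lemma L1_prim f T : 0 <= T -> L1 `[0, T] f ->
  measurable_fun `[0, T] (fun t => \int[mu]_(s in `[0, t]) f s).
Proof.
move=> T0 lf.
apply: (eq_measurable_fun (fun t => \int[mu]_(s in `[0, T]) (f s * leK (t, s)))).
  by move=> t; rewrite mem_setE in_itv/= => /andP[_ tT]; rewrite -Rintegral_primE.
apply: measurable_funTS; apply: measurable_Rintegral_kernel => //.
- exact: L1_measurable.
- exact: measurable_leK.
Qed.

Lemma prim_bounded f t T : t \in `[0, T] -> L1 `[0, T] f ->
  `|\int[mu]_(s in `[0, t]) f s| <= \int[mu]_(s in `[0, T]) `|f s|.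
Proof.
rewrite in_itv/= => /andP[t0 tT] lf; rewrite (Rintegral_primE _ tT) -[leRHS]mul1r.
by apply: Rintegral_kernel_bound => //; [exact: measurable_leK|exact: leK_le1].
Qed.

(** Integration by parts without derivatives: the double integral over the square is split along the
    diagonal, and each triangle gives one term. *)
Lemma prim_mul f g T : 0 <= T -> L1 `[0, T] f -> L1 `[0, T] g ->
  (\int[mu]_(s in `[0, T]) f s) * (\int[mu]_(s in `[0, T]) g s) =
  \int[mu]_(t in `[0, T]) (f t * (\int[mu]_(s in `[0, t]) g s) +
                           (\int[mu]_(s in `[0, t]) f s) * g t).
Proof.
move=> T0 lf lg.
have l1 (h k : R -> R) : L1 `[0, T] h -> L1 `[0, T] k ->
    L1 `[0, T] (fun t => h t * \int[mu]_(s in `[0, t]) k s).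
  move=> lh lk; apply: (L1_mul_bounded (M := \int[mu]_(s in `[0, T]) `|k s|)) => //.
    exact: L1_prim.
  by move=> t tT; exact: prim_bounded.
have l2 : L1 `[0, T] (fun t => (\int[mu]_(s in `[0, t]) f s) * g t).
  by apply: L1_eq (l1 _ _ lg lf) => // t _; rewrite mulrC.
rewrite RintegralD//; last exact: l1.
have -> : \int[mu]_(t in `[0, T]) (f t * \int[mu]_(s in `[0, t]) g s) =
    \int[mu]_(x in `[0, T]) (f x * \int[mu]_(y in `[0, T]) (g y * leK (x, y))).
  apply: eq_Rintegral => x; rewrite mem_setE in_itv/= => /andP[_ xT].
  by rewrite -Rintegral_primE.
rewrite (Fubini_kernel _ _ lf lg measurable_leK leK_le1)//.
have -> : \int[mu]_(y in `[0, T]) (g y * \int[mu]_(x in `[0, T]) (f x * leK (x, y))) =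
    \int[mu]_(y in `[0, T]) (g y * \int[mu]_(s in `[0, T]) f s -
                             (\int[mu]_(s in `[0, y]) f s) * g y).
  apply: eq_Rintegral => y; rewrite mem_setE => yT.
  by rewrite Rintegral_primC//; ring.
rewrite RintegralB//; last first.
  apply: (L1_mul_bounded (M := `|\int[mu]_(s in `[0, T]) f s|)) => //.
by rewrite RintegralZr// mulrC; ring.
Qed.

(** Lebesgue's differentiation theorem, applied to f extended by zero: at almost every t the
    primitive has derivative f t, while it vanishes near t. *)
Lemma prim_eq0 f T : L1 `[0, T] f ->
  (forall t, t \in `[0, T] -> \int[mu]_(s in `[0, t]) f s = 0) ->
  {ae mu, forall t, t \in `]0, T[ -> f t = 0}.
Proof.
move=> lf f0.
pose h := f \_ `[0, T].
have lh : L1 setT h by have := (@integrable_mkcond _ _ _ mu _ (EFin \o f) (measurable_itv `[0, T])).1 lf;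
   rewrite restrict_EFin.
have lh' : locally_integrable setT h by apply: open_integrable_locally => //; exact: openT.
have := @FTC1 R h (BLeft 0) _ lh'.
have lhi y : mu.-integrable [set` Interval (BLeft 0) (BRight y)] (EFin \o h).
  by apply: integrableS lh.
move=> /(_ lhi); apply: ae_imp => t ht tT.
have [t0 tT'] : 0 < t /\ t < T by move: tT; rewrite in_itv/= => /andP.
have [|_] := ht _; first by rewrite /= lte_fin.
rewrite /h patchE mem_set/=; last by rewrite in_itv/= !ltW.
move=> <-.
rewrite derive1E.
set F := (F in 'D_1 F t).
have -> : 'D_1 F t = 'D_1 (cst 0) t.
  apply: near_eq_derive; near=> x; rewrite /F.
  have x0T : x \in `[0, T].
    have : x \in `]0, T[ by near: x; exact: near_in_itvoo.
    by apply: subset_itv_oo_cc.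
  transitivity (\int[mu]_(s in `[0, x]) f s); last exact: f0.
  apply: eq_Rintegral => s; rewrite mem_setE/= in_itv/= => /andP[s0 sx].
  rewrite /h patchE mem_set//= in_itv/= s0/= (le_trans sx)//.
  by move: x0T; rewrite in_itv/= => /andP[].
by rewrite derive_cst.
Unshelve. all: by end_near. Qed.

End primitive.

(** * Absolutely continuous representatives *)

Section H1.
Variable R : realType.
Notation mu := (@lebesgue_measure R).
Implicit Types (f g h : R -> R) (t T : R).

Lemma H1_L2 T g dg : H1_rep T g dg -> L2 `[0, T] dg.
Proof. by move=> [/memL2P lg _]; apply: L2_itv_oo_cc; exact: lg. Qed.

Lemma H1_L1 T g dg : H1_rep T g dg -> L1 `[0, T] dg.
Proof. by move=> /H1_L2; apply: L2_L1 => //; exact: itv_finite. Qed.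

Lemma H1_repP T g dg : H1_rep T g dg <-> L2 `[0, T] dg /\
  forall t, t \in `[0, T] -> g t = g 0 + \int[mu]_(s in `[0, t]) dg s.
Proof.
split=> [h|[lg h]]; first by split; [exact: H1_L2 h|exact: h.2].
split => //; apply/memL2P => //.
by apply: L2S lg => //; exact: subset_itv_oo_cc.
Qed.

Lemma in_itv0 t T : t \in `[0, T] -> 0 <= t /\ t <= T.
Proof. by rewrite in_itv/= => /andP. Qed.

Lemma H1_bounded T g dg : H1_rep T g dg ->
  exists M, forall t, t \in `[0, T] -> `|g t| <= M.
Proof.
move=> hg; exists (`|g 0| + \int[mu]_(s in `[0, T]) `|dg s|) => t tT.
rewrite (hg.2 _ tT) (le_trans (ler_normD _ _))// lerD2l.
by apply: prim_bounded => //; exact: H1_L1 hg.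
Qed.

Lemma H1_measurable T g dg : H1_rep T g dg -> measurable_fun `[0, T] g.
Proof.
move=> hg; have [T0|T0] := leP 0 T; last first.
  by rewrite set_itv_ge ?bnd_simp -?ltNge//; exact: measurable_fun_set0.
apply: (eq_measurable_fun (fun t => g 0 + \int[mu]_(s in `[0, t]) dg s)).
  by move=> t; rewrite mem_setE => tT; rewrite -(hg.2 _ tT).
by apply: measurable_funD => //; apply: L1_prim => //; exact: H1_L1 hg.
Qed.

Lemma H1_L2_self T g dg : H1_rep T g dg -> L2 `[0, T] g.
Proof.
move=> hg; have [M gM] := H1_bounded hg.
apply: (L2_bounded (M := M)) => //; first exact: itv_finite.
exact: H1_measurable hg.
Qed.

Lemma H1_ae T g dg dh : {ae mu, forall t, t \in `]0, T[ -> dg t = dh t} ->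
  measurable_fun `]0, T[ dh -> H1_rep T g dg -> H1_rep T g dh.
Proof.
move=> gh mdh hg; have lh : L2 `[0, T] dh.
  apply: L2_itv_oo_cc; apply: (@L2_ae _ `]0, T[ dg) => //.
  by apply: L2S (H1_L2 hg) => //; exact: subset_itv_oo_cc.
apply/H1_repP; split => // t tT; rewrite (hg.2 _ tT); congr (_ + _).
have [t0 tT'] := in_itv0 tT.
have S : `[0, t]%classic `<=` `[0, T]%classic by apply: subset_itvl; rewrite bnd_simp.
have S' : `]0, t[%classic `<=` `]0, T[%classic by apply: subset_itvl; rewrite bnd_simp.
have S2 : `]0, t[%classic `<=` `[0, T]%classic by apply: subset_trans S; exact: subset_itv_oo_cc.
rewrite -!Rintegral_itv_oo_cc; last 2 first.
- by apply: L1S (L2_L1 _ _ lh) => //; exact: itv_finite.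
- by apply: L1S (H1_L1 hg).
apply: ae_eq_Rintegral => //.
- by apply: measurable_funS (L1_measurable (H1_L1 hg)).
- by apply: measurable_funS lh.1.
- by apply: ae_imp gh => x gh /S'; exact: gh.
Qed.

Lemma H1_cst T (c : R) : H1_rep T (fun=> c) (fun=> 0).
Proof.
apply/H1_repP; split; first exact: L20.
by move=> t tT; rewrite Rintegral_cst// mul0r addr0.
Qed.

Lemma H1D T g dg h dh : H1_rep T g dg -> H1_rep T h dh ->
  H1_rep T (fun t => g t + h t) (fun t => dg t + dh t).
Proof.
move=> hg hh; apply/H1_repP; split; first by apply: L2D => //; [exact: H1_L2 hg|exact: H1_L2 hh].
move=> t tT; have [t0 tT'] := in_itv0 tT.
have S : `[0, t]%classic `<=` `[0, T]%classic by apply: subset_itvl; rewrite bnd_simp.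
rewrite RintegralD//; last 2 first.
- exact: L1S (H1_L1 hg).
- exact: L1S (H1_L1 hh).
by rewrite (hg.2 _ tT) (hh.2 _ tT); ring.
Qed.

Lemma H1Z T (c : R) g dg : H1_rep T g dg ->
  H1_rep T (fun t => c * g t) (fun t => c * dg t).
Proof.
move=> hg; apply/H1_repP; split; first by apply: L2Z => //; exact: H1_L2 hg.
move=> t tT; have [t0 tT'] := in_itv0 tT.
have S : `[0, t]%classic `<=` `[0, T]%classic by apply: subset_itvl; rewrite bnd_simp.
rewrite RintegralZl//; last exact: L1S (H1_L1 hg).
by rewrite (hg.2 _ tT); ring.
Qed.

Lemma H1N T g dg : H1_rep T g dg -> H1_rep T (fun t => - g t) (fun t => - dg t).
Proof.
by move=> /(H1Z (-1)); under eq_fun do rewrite mulN1r;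
  under [X in H1_rep _ _ X]eq_fun do rewrite mulN1r.
Qed.

Lemma H1B T g dg h dh : H1_rep T g dg -> H1_rep T h dh ->
  H1_rep T (fun t => g t - h t) (fun t => dg t - dh t).
Proof. by move=> hg /H1N; exact: H1D. Qed.

Lemma H1_sum T I (r : seq I) (P : pred I) (G dG : I -> R -> R) :
  (forall i, H1_rep T (G i) (dG i)) ->
  H1_rep T (fun t => \sum_(i <- r | P i) G i t) (fun t => \sum_(i <- r | P i) dG i t).
Proof.
move=> hG; elim: r => [|i r ih].
  under eq_fun do rewrite big_nil; under [X in H1_rep _ _ X]eq_fun do rewrite big_nil.
  exact: H1_cst.
under eq_fun do rewrite big_cons; under [X in H1_rep _ _ X]eq_fun do rewrite big_cons.
by case: (P i) => //; exact: H1D.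
Qed.

Lemma H1M T g dg h dh : H1_rep T g dg -> H1_rep T h dh ->
  H1_rep T (fun t => g t * h t) (fun t => dg t * h t + g t * dh t).
Proof.
move=> hg hh; apply/H1_repP; split.
  have [Mg hMg] := H1_bounded hg; have [Mh hMh] := H1_bounded hh.
  apply: L2D => //.
    apply: (L2_mul_bounded (M := Mh)) => //; first exact: H1_L2 hg.
    exact: H1_measurable hh.
  apply: (@L2_eq _ _ (fun t => dh t * g t)) => //; first by move=> x _; rewrite mulrC.
  apply: (L2_mul_bounded (M := Mg)) => //; first exact: H1_L2 hh.
  exact: H1_measurable hg.
move=> t tT; have [t0 tT'] := in_itv0 tT.
have S : `[0, t]%classic `<=` `[0, T]%classic by apply: subset_itvl; rewrite bnd_simp.
have lg : L1 `[0, t] dg by exact: L1S (H1_L1 hg).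
have lh : L1 `[0, t] dh by exact: L1S (H1_L1 hh).
set G := fun t => \int[mu]_(s in `[0, t]) dg s.
set H := fun t => \int[mu]_(s in `[0, t]) dh s.
have lgH : L1 `[0, t] (fun s => dg s * H s).
  apply: (L1_mul_bounded (M := \int[mu]_(s in `[0, t]) `|dh s|)) => //.
    exact: L1_prim.
  by move=> s st; exact: prim_bounded.
have lhG : L1 `[0, t] (fun s => dh s * G s).
  apply: (L1_mul_bounded (M := \int[mu]_(s in `[0, t]) `|dg s|)) => //.
    exact: L1_prim.
  by move=> s st; exact: prim_bounded.
(* Inserting g = g 0 + G and h = h 0 + H leaves terms linear in the derivatives and the integrand of
   [prim_mul] for G H. *)
have -> : \int[mu]_(s in `[0, t]) (dg s * h s + g s * dh s) =
   \int[mu]_(s in `[0, t]) ((h 0 * dg s + g 0 * dh s) + (dg s * H s + G s * dh s)).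
  apply: eq_Rintegral => s; rewrite mem_setE => st.
  have sT : s \in `[0, T] by exact: S.
  by rewrite (hg.2 _ sT) (hh.2 _ sT) -/(G s) -/(H s); ring.
rewrite RintegralD//; last 2 first.
- by apply: L1D => //; exact: L1Z.
- apply: L1D => //; apply: L1_eq lhG => // s _; by rewrite mulrC.
rewrite -prim_mul// RintegralD//; [|exact: L1Z|exact: L1Z].
rewrite !RintegralZl//.
by rewrite (hg.2 _ tT) (hh.2 _ tT) -/(G t) -/(H t); ring.
Qed.

Lemma H1_deriv0 T g dg : H1_rep T g dg ->
  {ae mu, forall t, t \in `]0, T[ -> dg t = 0} -> forall t, t \in `[0, T] -> g t = g 0.
Proof.
move=> hg dg0 t tT.
have h0 : H1_rep T g (fun=> 0) by apply: H1_ae dg0 _ hg.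
by rewrite (h0.2 _ tT) Rintegral_cst// mul0r addr0.
Qed.

Lemma H1_unique T g dg h dh : 0 <= T -> (forall t, t \in `[0, T] -> g t = h t) ->
  H1_rep T g dg -> H1_rep T h dh -> {ae mu, forall t, t \in `]0, T[ -> dg t = dh t}.
Proof.
move=> T0 gh hg hh; have hB := H1B hg hh.
have : {ae mu, forall t, t \in `]0, T[ -> dg t - dh t = 0}.
  apply: prim_eq0; first exact: H1_L1 hB.
  move=> t tT; have := hB.2 _ tT.
  by rewrite !gh// ?subrr ?add0r// in_itv/= lexx.
by apply: ae_imp => t h' tT; apply/eqP; rewrite -subr_eq0 h'.
Qed.

(* The square of the difference has the a.e. vanishing derivative 2 d d', hence
   is constant, which avoids any appeal to continuity. *)
Lemma H1_ae_eq T g dg h dh : 0 < T ->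
  {ae mu, forall t, t \in `]0, T[ -> g t = h t} ->
  H1_rep T g dg -> H1_rep T h dh -> forall t, t \in `[0, T] -> g t = h t.
Proof.
move=> T0 gh hg hh; have hB := H1B hg hh; have hS := H1M hB hB.
have S0 : forall t, t \in `[0, T] -> (g t - h t) * (g t - h t) = (g 0 - h 0) * (g 0 - h 0).
  apply: (H1_deriv0 hS); apply: ae_imp gh => t gh tT.
  by rewrite gh// subrr mulr0 mul0r addr0.
have [t0 t0T gh0] := ae_itv_nonempty T0 gh.
have z0 : (g 0 - h 0) * (g 0 - h 0) = 0.
  by rewrite -(S0 t0) ?gh0 ?subrr ?mul0r//; exact: subset_itv_oo_cc t0T.
move=> t tT; have /eqP := S0 _ tT.
by rewrite z0 mulf_eq0 orbb subr_eq0 => /eqP.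
Qed.

Lemma H1_C1 T g dg : 0 <= T -> (forall t : R, is_derive t 1 g (dg t)) ->
  continuous dg -> H1_rep T g dg.
Proof.
move=> T0 dgE cdg; apply/H1_repP; split.
  (* A continuous derivative attains its largest modulus on [0, T], hence is bounded and square
     integrable there. *)
  have cn : {within `[0, T], continuous (fun t => `|dg t|)}.
    apply: continuous_subspaceT => x; apply: continuous_comp; first exact: cdg.
    exact: norm_continuous.
  have [c _ hc] := EVT_max T0 cn.
  apply: (L2_bounded (M := `|dg c|)) => //; first exact: itv_finite.
  by apply: measurable_funTS; exact: continuous_measurable_fun.
move=> t /in_itv0[]; rewrite le_eqVlt => /predU1P[<- _|t0 tT].
  by rewrite set_itv1 Rintegral_set1 addr0.
have cg : continuous g.
  move=> x; apply: differentiable_continuous; apply/derivable1_diffP.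
  by have [] := dgE x.
rewrite /Rintegral (continuous_FTC2 (F := g))//=.
- by rewrite addrCA subrr addr0.
- exact: continuous_subspaceT.
- split.
  + by move=> x _; have [] := dgE x.
  + exact/cvg_at_right_filter/cg.
  + exact/cvg_at_left_filter/cg.
- by move=> x _; rewrite derive1E; have [] := dgE x.
Qed.

End H1.

(** * Linear differential equations *)

Section matrix_exponential.
Variable R : realType.

Definition mexp_coeff n (M : 'M[R]_n) (i j : 'I_n) (k : nat) : R :=
  (M ^+ k) i j * (k`!%:R)^-1.

(** The exponential exp(t M), taken entry by entry so that the theory of real power series supplies
    convergence and derivatives. *)
Definition mexp n (M : 'M[R]_n) (t : R) : 'M[R]_n :=
  \matrix_(i, j) limn (pseries (mexp_coeff M i j) t).

(** The sum of the moduli of all entries plays the part of a submultiplicative norm. Such a crude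
    bound is enough, since the factorial makes the radius of convergence infinite. *)
Lemma mpow_bound n (M : 'M[R]_n) k i j :
  `|(M ^+ k) i j| <= (\sum_i \sum_l `|M i l|) ^+ k.
Proof.
elim: k i j => [|k ih] i j.
  by rewrite !expr0 mxE; case: (i == j); rewrite ?normr1 ?normr0.
rewrite exprS mxE (le_trans (ler_norm_sum _ _ _))//.
rewrite exprS; apply: (@le_trans _ _ (\sum_l `|M i l| * (\sum_i \sum_l `|M i l|) ^+ k)).
  by apply: ler_sum => l _; rewrite normrM ler_wpM2l.
rewrite -mulr_suml ler_wpM2r//.
  by apply: exprn_ge0; do 2 apply: sumr_ge0 => ? _.
rewrite [leRHS](bigD1 i)//= lerDl.
by do 2 apply: sumr_ge0 => ? _.
Qed.

Lemma is_cvg_pseries_fact (c : R^nat) (A C x : R) :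
  (forall k, `|c k| <= A * (C ^+ k * (k`!%:R)^-1)) -> cvgn (pseries c x).
Proof.
move=> cAC; apply: normed_cvg.
apply: (@series_le_cvg _ _ (fun k => `|A| * exp_coeff (`|C| * `|x|) k)) => //.
- by move=> k /=; exact: normr_ge0.
- by move=> k; rewrite /exp_coeff/= !mulr_ge0 ?invr_ge0// exprn_ge0// mulr_ge0.
- move=> k /=; rewrite normrM normrX (le_trans (ler_wpM2r _ (cAC k)))//.
  apply: (le_trans (ler_norm _)); rewrite le_eqVlt; apply/orP; left; apply/eqP.
  rewrite !normrM !normrX normr_id [`|k`!%:R^-1|]ger0_norm// /exp_coeff/= exprMn.
  ring.
- have -> : series (fun k => `|A| * exp_coeff (`|C| * `|x|) k) = fun m => `|A| * series (exp_coeff (`|C| * `|x|)) m.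
    by apply/funext => m; rewrite /series/= mulr_sumr.
  by apply: is_cvgM; [exact: is_cvg_cst|exact: is_cvg_series_exp_coeff].
Qed.

Lemma is_cvg_mexp n (M : 'M[R]_n) i j x : cvgn (pseries (mexp_coeff M i j) x).
Proof.
apply: (@is_cvg_pseries_fact _ 1 (\sum_i \sum_l `|M i l|)) => k.
rewrite mul1r normrM [X in _ * X]ger0_norm// ler_wpM2r//; exact: mpow_bound.
Qed.

Arguments is_cvg_mexp {n} M i j x.

(** On coefficients, termwise differentiation is left multiplication by M: the factor k.+1 cancels
    against the factorial and one power of M is split off. *)
Lemma diffs_mexp_coeff n (M : 'M[R]_n) i j :
  pseries_diffs (mexp_coeff M i j) = fun k => \sum_l M i l * mexp_coeff M l j k.
Proof.
apply/funext => k; rewrite /pseries_diffs /mexp_coeff factS natrM invfM.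
rewrite mulrCA mulVKf ?pnatr_eq0// exprS mxE mulr_suml.
by apply: eq_bigr => l _; rewrite mulrA.
Qed.

Lemma pseries_sumE n (a : 'I_n -> R) (c : 'I_n -> R^nat) x :
  pseries (fun k => \sum_l a l * c l k) x = fun m => \sum_l a l * pseries (c l) x m.
Proof.
apply/funext => m; rewrite /pseries /series /=.
under eq_bigr do rewrite mulr_suml.
rewrite exchange_big /=; apply: eq_bigr => l _.
by rewrite mulr_sumr; apply: eq_bigr => k _; rewrite mulrA.
Qed.

Lemma cvg_pseries_sum n (a : 'I_n -> R) (c : 'I_n -> R^nat) x :
  (forall l, cvgn (pseries (c l) x)) ->
  pseries (fun k => \sum_l a l * c l k) x m @[m --> \oo] -->
    \sum_l a l * limn (pseries (c l) x).
Proof.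
move=> cc; rewrite pseries_sumE.
apply: (@cvg_big _ _ +%R 0) => [|l _]; first exact: add_continuous.
apply: cvgM; [exact: cvg_cst|exact: cc].
Qed.

Lemma is_derive_mexp n (M : 'M[R]_n) i j (t : R) :
  is_derive t (1 : R) (fun t => mexp M t i j) ((M *m mexp M t) i j).
Proof.
have -> : (fun t => mexp M t i j) = fun t => limn (pseries (mexp_coeff M i j) t).
  by apply/funext => s; rewrite mxE.
have cd (M' : 'I_n -> R) (c : 'I_n -> R^nat) x : (forall l, cvgn (pseries (c l) x)) ->
    cvgn (pseries (fun k => \sum_l M' l * c l k) x).
  by move=> cc; apply/cvg_ex; eexists; exact: cvg_pseries_sum.
have dd : pseries_diffs (pseries_diffs (mexp_coeff M i j)) =
    fun k => \sum_l M i l * (pseries_diffs (mexp_coeff M l j)) k.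
  rewrite diffs_mexp_coeff; apply/funext => k; rewrite /pseries_diffs mulr_sumr.
  by apply: eq_bigr => l _; rewrite mulrCA.
(* Termwise differentiation at t asks that the series and its first two formal derivatives converge
   at a point beyond |t|; here |t| + 1. *)
have := @pseries_snd_diffs _ (mexp_coeff M i j) (`|t| + 1) t (is_cvg_mexp _ _ _ _).
rewrite dd diffs_mexp_coeff => /(_ (cd _ _ _ (fun l => is_cvg_mexp _ _ _ _))) h.
have : cvgn (pseries (fun k => \sum_l M i l * pseries_diffs (mexp_coeff M l j) k) (`|t| + 1)).
  apply: (cd _ _ _) => l; rewrite diffs_mexp_coeff; apply: (cd _ _ _) => l'; exact: is_cvg_mexp.
move=> /h{h}; rewrite [X in _ < X]ger0_norm ?addr_ge0// ltrDl ltr01 => /(_ isT).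
rewrite (cvg_lim _ (@cvg_pseries_sum _ (M i) _ t (fun l => is_cvg_mexp M l j t)))//.
by rewrite mxE; under [X in _ -> is_derive _ _ _ X]eq_bigr do rewrite mxE.
Qed.

Lemma mexpMC n (M : 'M[R]_n) t : M *m mexp M t = mexp M t *m M.
Proof.
apply/matrixP => i j; rewrite !mxE.
under eq_bigr do rewrite mxE; under [RHS]eq_bigr do rewrite mxE mulrC.
rewrite -[LHS](cvg_lim _ (@cvg_pseries_sum _ (M i) _ t (fun l => is_cvg_mexp M l j t)))//.
rewrite -[RHS](cvg_lim _ (@cvg_pseries_sum _ (M ^~ j) _ t (fun l => is_cvg_mexp M i l t)))//.
congr (limn (pseries _ t)); apply/funext => k; rewrite /mexp_coeff.
under eq_bigr do rewrite mulrA; under [RHS]eq_bigr do rewrite mulrA [X in X * _]mulrC.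
rewrite -!mulr_suml; congr (_ * _).
have : (M * M ^+ k) i j = (M ^+ k * M) i j by rewrite -exprS exprSr.
by rewrite !mxE.
Qed.

Lemma mexp0 n (M : 'M[R]_n) : mexp M 0 = 1%:M.
Proof.
apply/matrixP => i j; rewrite mxE; apply/cvg_lim => //.
apply: (@cvg_near_cst _ _ _ _ _); near=> k.
have k0 : (0 < k)%N by near: k; exists 1%N.
rewrite /pseries/series/= -(prednK k0) big_nat_recl//= big1 ?addr0.
  by rewrite /mexp_coeff !expr0 fact0 invr1 !mulr1.
by move=> l _; rewrite expr0n/= mulr0.
Unshelve. all: by end_near. Qed.

Lemma continuous_mexp n (M : 'M[R]_n) i j : continuous (fun t => mexp M t i j).
Proof.
move=> x; apply: differentiable_continuous; apply/derivable1_diffP.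
by have [] := is_derive_mexp M i j x.
Qed.

Lemma is_derive_mexpN n (M : 'M[R]_n) i j (t : R) :
  is_derive t (1 : R) (fun t => mexp M (- t) i j) (- (M *m mexp M (- t)) i j).
Proof.
have h := is_derive_mexp M i j (- t).
have h' : is_derive t (1 : R) (-%R : R -> R) (-1) by exact: is_deriveN.
have := @is_derive1_comp _ _ _ _ _ _ h h'.
by rewrite mulrN1.
Qed.

(** The product exp(t M) exp(- t M) has derivative zero because M commutes with exp(t M), and it is
    the identity at t = 0. *)
Lemma mexpN n (M : 'M[R]_n) t : mexp M t *m mexp M (- t) = 1%:M.
Proof.
apply/matrixP => i j.
pose F t := (mexp M t *m mexp M (- t)) i j.
have dF (s : R) : is_derive s (1 : R) F 0.
  have -> : F = \sum_l ((fun t => mexp M t i l) * (fun t => mexp M (- t) l j)).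
    by apply/funext => x; rewrite /F mxE fct_sumE.
  (* Zero is written in the shape that the product rule produces. *)
  have -> : 0 = \sum_l (mexp M s i l *: (- (M *m mexp M (- s)) l j) +
                       mexp M (- s) l j *: (M *m mexp M s) i l) :> R.
    rewrite big_split/=.
    have -> : \sum_l mexp M s i l *: - (M *m mexp M (- s)) l j =
        - (mexp M s *m (M *m mexp M (- s))) i j.
      by rewrite [in RHS]mxE -sumrN; apply: eq_bigr => l _; rewrite scalerN.
    have -> : \sum_l mexp M (- s) l j *: (M *m mexp M s) i l =
        ((M *m mexp M s) *m mexp M (- s)) i j.
      by rewrite [RHS]mxE; apply: eq_bigr => l _; rewrite /GRing.scale/= mulrC.
    by rewrite (mexpMC M s) mulmxA addNr.
  apply: is_derive_sum => l.
  apply: is_deriveM; [exact: is_derive_mexp|exact: is_derive_mexpN].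
have := @is_derive_0_is_cst _ F t 0 dF.
by rewrite /F oppr0 mexp0 mulmx1.
Qed.

End matrix_exponential.

(** * Linear systems with constant coefficients and square integrable source *)

Section linear_ode.
Variable R : realType.
Notation mu := (@lebesgue_measure R).

Lemma H1_prim (T c : R) (dg : R -> R) : L2 `[0, T] dg ->
  H1_rep T (fun t => c + \int[mu]_(s in `[0, t]) dg s) dg.
Proof.
move=> lg; apply/H1_repP; split => // t tT.
by rewrite set_itv1 Rintegral_set1 addr0.
Qed.

Lemma vH1_const n (T : R) (z : 'cV[R]_n) : vH1_rep T (fun=> z) (fun=> 0).
Proof.
move=> i; have -> : (fun t : R => (0 : 'cV[R]_n) i 0) = fun=> 0 by apply/funext => t; rewrite mxE.
exact: H1_cst.
Qed.

Lemma vH1D n (T : R) (z dz w dw : R -> 'cV[R]_n) : vH1_rep T z dz -> vH1_rep T w dw ->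
  vH1_rep T (fun t => z t + w t) (fun t => dz t + dw t).
Proof.
move=> hz hw i.
under eq_fun do rewrite mxE; under [X in H1_rep _ _ X]eq_fun do rewrite mxE.
exact: H1D.
Qed.

Lemma vH1B n (T : R) (z dz w dw : R -> 'cV[R]_n) : vH1_rep T z dz -> vH1_rep T w dw ->
  vH1_rep T (fun t => z t - w t) (fun t => dz t - dw t).
Proof.
move=> hz hw i.
under eq_fun do rewrite !mxE; under [X in H1_rep _ _ X]eq_fun do rewrite !mxE.
exact: H1B.
Qed.

Lemma vH1_mulmx n p (T : R) (A dA : R -> 'M[R]_(n, p)) (z dz : R -> 'cV[R]_p) :
  (forall i j, H1_rep T (fun t => A t i j) (fun t => dA t i j)) ->
  vH1_rep T z dz ->
  vH1_rep T (fun t => A t *m z t) (fun t => dA t *m z t + A t *m dz t).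
Proof.
move=> hA hz i; under eq_fun do rewrite mxE.
under [X in H1_rep _ _ X]eq_fun do rewrite !mxE -big_split/=.
by apply: H1_sum => j; exact: H1M.
Qed.

Lemma vH1_mexp n (T : R) (M : 'M[R]_n) i j : 0 <= T ->
  H1_rep T (fun t => mexp M t i j) (fun t => (M *m mexp M t) i j).
Proof.
move=> T0; apply: H1_C1 => // [t|x]; first exact: is_derive_mexp.
under eq_fun do rewrite mxE.
apply: (@cvg_big _ _ +%R 0) => [|l _]; first exact: add_continuous.
by apply: cvgM; [exact: cvg_cst|exact: continuous_mexp].
Qed.

Lemma continuous_mexpN n (M : 'M[R]_n) i j : continuous (fun t => mexp M (- t) i j).
Proof.
by move=> x; apply: (@continuous_comp _ _ _ -%R (fun t => mexp M t i j)); [exact: opp_continuous|exact: continuous_mexp].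
Qed.

Lemma vH1_mexpN n (T : R) (M : 'M[R]_n) i j : 0 <= T ->
  H1_rep T (fun t => mexp M (- t) i j) (fun t => (- (M *m mexp M (- t))) i j).
Proof.
move=> T0; apply: H1_C1 => // [t|x].
  by rewrite mxE; exact: is_derive_mexpN.
under eq_fun do rewrite !mxE; apply: cvgN.
apply: (@cvg_big _ _ +%R 0) => [|l _]; first exact: add_continuous.
by apply: cvgM; [exact: cvg_cst|exact: continuous_mexpN].
Qed.

Lemma H1_mem0 (T : R) : 0 <= T -> 0 \in `[0, T].
Proof. by move=> T0; rewrite in_itv/= lexx. Qed.

Lemma H1_memT (T : R) : 0 <= T -> T \in `[0, T].
Proof. by move=> T0; rewrite in_itv/= lexx andbT. Qed.

(** Variation of constants: z = exp(t M) w, where w is the primitive of exp(- t M) f with w 0 =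
    z0. *)
Lemma linear_ode_exists n (T : R) (M : 'M[R]_n) (f : R -> 'cV[R]_n) (z0 : 'cV[R]_n) :
  0 <= T -> (forall i, L2 `[0, T] (fun t => f t i 0)) ->
  exists z, vH1_rep T z (fun t => M *m z t + f t) /\ z 0 = z0.
Proof.
move=> T0 lf.
pose dw t : 'cV[R]_n := mexp M (- t) *m f t.
pose w t : 'cV[R]_n := \col_i (z0 i 0 + \int[mu]_(s in `[0, t]) dw s i 0).
have hw : vH1_rep T w dw.
  move=> i; under eq_fun do rewrite mxE.
  apply: H1_prim; rewrite /dw.
  apply: (@L2_eq _ _ (fun t => \sum_j mexp M (- t) i j * f t j 0)) => //.
    by move=> t _; rewrite mxE.
  apply: L2_sum => // j.
  apply: (@L2_eq _ _ (fun t => f t j 0 * mexp M (- t) i j)) => //.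
    by move=> t _; rewrite mulrC.
  have [K hK] := H1_bounded (vH1_mexpN M i j T0).
  apply: (L2_mul_bounded (M := K)) => //.
  exact: H1_measurable (vH1_mexpN M i j T0).
exists (fun t => mexp M t *m w t); split; last first.
  rewrite mexp0 mul1mx; apply/matrixP => i j; rewrite !mxE set_itv1 Rintegral_set1.
  by rewrite addr0 ord1.
have := vH1_mulmx (fun i j => vH1_mexp M i j T0) hw.
congr (vH1_rep T _ _); apply/funext => t.
by rewrite /dw !mulmxA mexpN mul1mx.
Qed.

(** The function exp(- t M) z t has derivative zero a.e., so it is constant and vanishes with z t0.
    The instant t0 is left free because states are prescribed at 0 and costates at T. *)
Lemma linear_ode_zero n (T : R) (M : 'M[R]_n) (z dz : R -> 'cV[R]_n) (t0 : R) :
  vH1_rep T z dz ->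
  {ae mu, forall t, t \in `]0, T[ -> dz t = M *m z t} ->
  t0 \in `[0, T] -> z t0 = 0 -> forall t, t \in `[0, T] -> z t = 0.
Proof.
move=> hz dzE t0T zt0 t tT.
have T0 : 0 <= T by have [a b] := in_itv0 tT; exact: le_trans a b.
have hy := vH1_mulmx (fun i j => vH1_mexpN M i j T0) hz.
pose y t := mexp M (- t) *m z t.
have yc s : s \in `[0, T] -> y s = y 0.
  move=> sT; apply/matrixP => i j; rewrite ord1.
  apply: (H1_deriv0 (hy i)) => //; apply: ae_imp dzE => x dzE xT.
  by rewrite dzE// mulmxA mulNmx mexpMC addNr mxE.
have y0 : y 0 = 0 by rewrite -(yc _ t0T) /y zt0 mulmx0.
by rewrite -[z t]mul1mx -(mexpN M t) -mulmxA -/(y t) (yc _ tT) y0 mulmx0.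
Qed.

End linear_ode.

(** * Linear-quadratic optimal control *)

Section linear_quadratic.
Variable R : realType.
Notation mu := (@lebesgue_measure R).

Definition dot n (u v : 'cV[R]_n) : R := \sum_i u i 0 * v i 0.

Lemma dotE n (u v : 'cV[R]_n) : dot u v = (u^T *m v) 0 0.
Proof. by rewrite mxE; apply: eq_bigr => i _; rewrite mxE. Qed.

Lemma dotC n (u v : 'cV[R]_n) : dot u v = dot v u.
Proof. by apply: eq_bigr => i _; rewrite mulrC. Qed.

Lemma dotDl n (u v w : 'cV[R]_n) : dot (u + v) w = dot u w + dot v w.
Proof. by rewrite -big_split; apply: eq_bigr => i _; rewrite mxE mulrDl. Qed.

Lemma dotDr n (u v w : 'cV[R]_n) : dot w (u + v) = dot w u + dot w v.
Proof. by rewrite !(dotC w) dotDl. Qed.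

Lemma dotZl n (c : R) (u v : 'cV[R]_n) : dot (c *: u) v = c * dot u v.
Proof. by rewrite mulr_sumr; apply: eq_bigr => i _; rewrite mxE mulrA. Qed.

Lemma dotNl n (u v : 'cV[R]_n) : dot (- u) v = - dot u v.
Proof. by rewrite -scaleN1r dotZl mulN1r. Qed.

Lemma dot_mulmx n p (A : 'M[R]_(n, p)) u v : dot u (A *m v) = dot (A^T *m u) v.
Proof. by rewrite !dotE trmx_mul trmxK mulmxA. Qed.

Lemma sqnormE n (u : 'cV[R]_n) : sqnorm u = dot u u.
Proof. by apply: eq_bigr => i _; rewrite expr2. Qed.

Lemma sqnorm_ge0 n (u : 'cV[R]_n) : 0 <= sqnorm u.
Proof. by apply: sumr_ge0 => i _; exact: sqr_ge0. Qed.

Lemma sqnorm_eq0 n (u : 'cV[R]_n) : sqnorm u = 0 -> u = 0.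
Proof.
move=> u0; apply/matrixP => i j; rewrite ord1 mxE; apply/eqP.
move/eqP: u0; rewrite psumr_eq0 => [/allP/(_ i (mem_index_enum _))|k _].
  by rewrite sqrf_eq0.
exact: sqr_ge0.
Qed.

Lemma sqnormD n (u v : 'cV[R]_n) : sqnorm (u + v) = sqnorm u + 2 * dot u v + sqnorm v.
Proof. rewrite !sqnormE dotDl !dotDr (dotC v u); ring. Qed.

Definition vL2 n (D : set R) (f : R -> 'cV[R]_n) := forall i, L2 D (fun t => f t i 0).

Lemma vmemL2P n (D : set R) (f : R -> 'cV[R]_n) : measurable D ->
  vmemL2 D f <-> vL2 D f.
Proof. by move=> mD; split=> h i; apply/memL2P => //; exact: h. Qed.

Lemma vL2_itv_oo_cc n (a b : R) (f : R -> 'cV[R]_n) : vL2 `]a, b[ f -> vL2 `[a, b] f.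
Proof. by move=> h i; exact: L2_itv_oo_cc. Qed.

Lemma vL2S n (D E : set R) (f : R -> 'cV[R]_n) : measurable D -> measurable E ->
  E `<=` D -> vL2 D f -> vL2 E f.
Proof. by move=> mD mE ED h i; exact: L2S (h i). Qed.

Lemma vL2D n (D : set R) (f g : R -> 'cV[R]_n) : measurable D -> vL2 D f -> vL2 D g ->
  vL2 D (fun t => f t + g t).
Proof.
move=> mD lf lg i; apply: (@L2_eq _ _ (fun t => f t i 0 + g t i 0)) => //.
  by move=> t _; rewrite mxE.
exact: L2D.
Qed.

Lemma vL2_mulmx n p (D : set R) (A : 'M[R]_(n, p)) (f : R -> 'cV[R]_p) : measurable D ->
  vL2 D f -> vL2 D (fun t => A *m f t).
Proof.
move=> mD lf i; apply: (@L2_eq _ _ (fun t => \sum_j A i j * f t j 0)) => //.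
  by move=> t _; rewrite mxE.
by apply: L2_sum => // j; exact: L2Z.
Qed.

Lemma vL2Z n (D : set R) (c : R) (f : R -> 'cV[R]_n) : measurable D ->
  vL2 D f -> vL2 D (fun t => c *: f t).
Proof.
move=> mD lf i; apply: (@L2_eq _ _ (fun t => c * f t i 0)) => //.
  by move=> t _; rewrite mxE.
exact: L2Z.
Qed.

Lemma vL2N n (D : set R) (f : R -> 'cV[R]_n) : measurable D ->
  vL2 D f -> vL2 D (fun t => - f t).
Proof. by move=> mD /(vL2Z (-1) mD); under eq_fun do rewrite scaleN1r. Qed.

Lemma vL2B n (D : set R) (f g : R -> 'cV[R]_n) : measurable D -> vL2 D f -> vL2 D g ->
  vL2 D (fun t => f t - g t).
Proof. by move=> mD lf /(vL2N mD); exact: vL2D. Qed.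

Lemma vL2_dot n (D : set R) (f g : R -> 'cV[R]_n) : measurable D -> vL2 D f -> vL2 D g ->
  L1 D (fun t => dot (f t) (g t)).
Proof. by move=> mD lf lg; apply: L1_sum => // i; exact: L2_L1mul. Qed.

Lemma vL2_sqnorm n (D : set R) (f : R -> 'cV[R]_n) : measurable D -> vL2 D f ->
  L1 D (fun t => sqnorm (f t)).
Proof. by move=> mD lf; apply: L1_sum => // i; exact: (lf i).2. Qed.

Lemma vH1_vL2_self n (T : R) (z dz : R -> 'cV[R]_n) : vH1_rep T z dz -> vL2 `[0, T] z.
Proof. by move=> h i; exact: H1_L2_self (h i). Qed.

Lemma vH1_ae n (T : R) (z dz dw : R -> 'cV[R]_n) :
  {ae mu, forall t, t \in `]0, T[ -> dz t = dw t} -> vL2 `]0, T[ dw ->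
  vH1_rep T z dz -> vH1_rep T z dw.
Proof.
move=> h ldw hz i; apply: H1_ae (hz i); last exact: (ldw i).1.
by apply: ae_imp h => t h tT; rewrite h.
Qed.

Lemma H1_dot n (T : R) (z dz w dw : R -> 'cV[R]_n) : vH1_rep T z dz -> vH1_rep T w dw ->
  H1_rep T (fun t => dot (z t) (w t)) (fun t => dot (dz t) (w t) + dot (z t) (dw t)).
Proof.
move=> hz hw; under [X in H1_rep _ _ X]eq_fun do rewrite /dot -big_split/=.
by apply: H1_sum => i; exact: H1M.
Qed.

Lemma Rintegral_H1 (T : R) (g dg : R -> R) : 0 <= T -> H1_rep T g dg ->
  \int[mu]_(t in `]0, T[) dg t = g T - g 0.
Proof.
move=> T0 hg; rewrite Rintegral_itv_oo_cc.
  by rewrite (hg.2 _ (H1_memT T0)) addrAC subrr add0r.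
by apply: L1S (H1_L1 hg) => //; exact: subset_itv_oo_cc.
Qed.

(** * Optimality system for x' = A x + B u *)

Section control.
Variables (n q m : nat) (T : R) (A : 'M[R]_n) (B : 'M[R]_(n, q)) (H : 'M[R]_(m, n)).
Hypothesis T_gt0 : 0 < T.
Let T0 : 0 <= T := ltW T_gt0.
Let mT : measurable (`]0, T[%classic : set R) := measurable_itv _.
Let S : (`]0, T[%classic : set R) `<=` `[0, T]%classic := @subset_itv_oo_cc _ _ _ _.

Definition lq_state (x0 : 'cV[R]_n) (u : R -> 'cV[R]_q) (x : R -> 'cV[R]_n) :=
  x 0 = x0 /\ exists dx, vH1_rep T x dx /\
    {ae mu, forall t, t \in `]0, T[ -> dx t = A *m x t + B *m u t}.

(** [r] stands for the residual of the output; the costate runs backwards from the terminal value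
    0. *)
Definition lq_costate (r : R -> 'cV[R]_m) (p : R -> 'cV[R]_n) :=
  p T = 0 /\ exists dp, vH1_rep T p dp /\
    {ae mu, forall t, t \in `]0, T[ -> dp t = - (A^T *m p t + H^T *m r t)}.

(** The derivative of p . x is B^T p . u - r . H x, the terms in A cancelling. It integrates to 0
    because p T = 0 and x 0 = 0. *)
Lemma lq_duality u x r p : vL2 `]0, T[ u -> vL2 `]0, T[ r ->
  lq_state 0 u x -> lq_costate r p ->
  \int[mu]_(t in `]0, T[) dot (B^T *m p t) (u t) =
  \int[mu]_(t in `]0, T[) dot (r t) (H *m x t).
Proof.
move=> lu lr [x0 [dx [hx dxE]]] [pT [dp [hp dpE]]].
have lx := vL2S (measurable_itv _) mT S (vH1_vL2_self hx).
have lp := vL2S (measurable_itv _) mT S (vH1_vL2_self hp).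
have lBpu : L1 `]0, T[ (fun t => dot (B^T *m p t) (u t)).
  by apply: vL2_dot => //; exact: vL2_mulmx.
have lrHx : L1 `]0, T[ (fun t => dot (r t) (H *m x t)).
  by apply: vL2_dot => //; exact: vL2_mulmx.
have hpx := H1_dot hp hx.
have := Rintegral_H1 T0 hpx.
have -> : \int[mu]_(t in `]0, T[) (dot (dp t) (x t) + dot (p t) (dx t)) =
    \int[mu]_(t in `]0, T[) (dot (B^T *m p t) (u t) - dot (r t) (H *m x t)).
  apply: ae_eq_Rintegral => //.
  - apply: measurable_funS (L1_measurable (H1_L1 hpx)) => //.
  - by apply: L1_measurable; exact: L1B.
  - apply: ae_imp2 dxE dpE => t dxE dpE tT.
    rewrite dxE// dpE// dotNl dotDl !dotDr (dot_mulmx A) (dot_mulmx B) (dot_mulmx H).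
    ring.
rewrite RintegralB// pT x0.
have -> : dot 0 (x T) = 0 by rewrite /dot big1// => i _; rewrite mxE mul0r.
have -> : dot (p 0) 0 = 0 by rewrite /dot big1// => i _; rewrite mxE mulr0.
by rewrite subr0 => /eqP; rewrite subr_eq0 => /eqP.
Qed.

Lemma lq_state_exists x0 u : vL2 `]0, T[ u -> exists x, lq_state x0 u x.
Proof.
move=> lu; have lBu : vL2 `[0, T] (fun t => B *m u t).
  by apply: vL2_mulmx => //; exact: vL2_itv_oo_cc.
have [x [hx xx0]] := linear_ode_exists A x0 T0 lBu.
exists x; split => //; eexists; split; first exact: hx.
exact: aeW.
Qed.

Lemma lq_stateB x0 y0 u v x y : lq_state x0 u x -> lq_state y0 v y ->
  lq_state (x0 - y0) (fun t => u t - v t) (fun t => x t - y t).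
Proof.
move=> [xx0 [dx [hx dxE]]] [yy0 [dy [hy dyE]]]; split; first by rewrite xx0 yy0.
eexists; split; first exact: vH1B hx hy.
apply: ae_imp2 dxE dyE => t dxE dyE tT.
by rewrite dxE// dyE// !mulmxBr opprD addrACA.
Qed.

Lemma lq_state0 u x : {ae mu, forall t, t \in `]0, T[ -> B *m u t = 0} ->
  lq_state 0 u x -> forall t, t \in `[0, T] -> x t = 0.
Proof.
move=> u0 [x0 [dx [hx dxE]]].
apply: (linear_ode_zero (M := A) hx _ (H1_mem0 T0) x0).
by apply: ae_imp2 u0 dxE => t u0 dxE tT; rewrite dxE// u0// addr0.
Qed.

Lemma lq_state_unique x0 u v x y :
  {ae mu, forall t, t \in `]0, T[ -> u t = v t} ->
  lq_state x0 u x -> lq_state x0 v y -> forall t, t \in `[0, T] -> x t = y t.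
Proof.
move=> uv hx hy t tT; apply/eqP; rewrite -subr_eq0; apply/eqP.
have := lq_stateB hx hy; rewrite subrr => h.
apply: (lq_state0 _ h tT).
by apply: ae_imp uv => s uv sT; rewrite uv// subrr mulmx0.
Qed.

Definition lq_cost (a : R) (ad : R -> 'cV[R]_m) (u : R -> 'cV[R]_q) (x : R -> 'cV[R]_n) :=
  2^-1 * sqnormL2 T (fun t => H *m x t - ad t) + a / 2 * sqnormL2 T u.

Lemma lq_cost_optimal a ad x0 u x p v y : 0 < a ->
  vL2 `]0, T[ ad -> vL2 `]0, T[ u -> vL2 `]0, T[ v ->
  lq_state x0 u x -> lq_state x0 v y -> lq_costate (fun t => H *m x t - ad t) p ->
  {ae mu, forall t, t \in `]0, T[ -> a *: u t + B^T *m p t = 0} ->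
  lq_cost a ad u x + a / 2 * sqnormL2 T (fun t => v t - u t) <= lq_cost a ad v y.
Proof.
move=> a0 lad lu lv hx hy hp stat.
have hd := lq_stateB hy hx; rewrite subrr in hd.
have lx : vL2 `]0, T[ x by case: hx => _ [dx [hx _]]; exact: vL2S (vH1_vL2_self hx).
have ly : vL2 `]0, T[ y by case: hy => _ [dy [hy _]]; exact: vL2S (vH1_vL2_self hy).
have lp : vL2 `]0, T[ p by case: hp => _ [dp [hp _]]; exact: vL2S (vH1_vL2_self hp).
have lvu : vL2 `]0, T[ (fun t => v t - u t) by exact: vL2B.
have lr : vL2 `]0, T[ (fun t => H *m x t - ad t).
  by apply: vL2B => //; exact: vL2_mulmx.
have lHd : vL2 `]0, T[ (fun t => H *m (y t - x t)).
  by apply: vL2_mulmx => //; exact: vL2B.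
have dual := lq_duality lvu lr hd hp.
have dual2 : \int[mu]_(t in `]0, T[) dot (H *m x t - ad t) (H *m (y t - x t)) =
    - a * \int[mu]_(t in `]0, T[) dot (u t) (v t - u t).
  rewrite -dual -RintegralZl//; last exact: vL2_dot.
  apply: ae_eq_Rintegral => //.
  - by apply: L1_measurable; apply: vL2_dot => //; exact: vL2_mulmx.
  - by apply: L1_measurable; apply: L1Z => //; exact: vL2_dot.
  - apply: ae_imp stat => t stat tT; have /eqP := stat tT.
    by rewrite addrC addr_eq0 => /eqP ->; rewrite dotNl dotZl mulNr.
have E1 : sqnormL2 T (fun t => H *m y t - ad t) =
    sqnormL2 T (fun t => H *m x t - ad t) +
    2 * \int[mu]_(t in `]0, T[) dot (H *m x t - ad t) (H *m (y t - x t)) +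
    sqnormL2 T (fun t => H *m (y t - x t)).
  rewrite /sqnormL2 -RintegralZl//; last exact: vL2_dot.
  rewrite -RintegralD//; [|exact: vL2_sqnorm|by apply: L1Z => //; exact: vL2_dot].
  rewrite -RintegralD//; [|by apply: L1D => //; [exact: vL2_sqnorm|apply: L1Z => //; exact: vL2_dot]|exact: vL2_sqnorm].
  apply: eq_Rintegral => t _; rewrite -sqnormD; congr sqnorm.
  by rewrite mulmxBr addrAC addrCA subrr addr0.
have E2 : sqnormL2 T v = sqnormL2 T u +
    2 * \int[mu]_(t in `]0, T[) dot (u t) (v t - u t) +
    sqnormL2 T (fun t => v t - u t).
  rewrite /sqnormL2 -RintegralZl//; last exact: vL2_dot.
  rewrite -RintegralD//; [|exact: vL2_sqnorm|by apply: L1Z => //; exact: vL2_dot].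
  rewrite -RintegralD//; [|by apply: L1D => //; [exact: vL2_sqnorm|apply: L1Z => //; exact: vL2_dot]|exact: vL2_sqnorm].
  apply: eq_Rintegral => t _; rewrite -sqnormD; congr sqnorm.
  by rewrite addrC subrK.
have nn : 0 <= sqnormL2 T (fun t => H *m (y t - x t)).
  by apply: Rintegral_ge0 => t _; exact: sqnorm_ge0.
rewrite /lq_cost E1 E2 dual2; lra.
Qed.

Lemma unitmx_inj k (M : 'M[R]_k) : (forall v : 'cV[R]_k, M *m v = 0 -> v = 0) -> M \in unitmx.
Proof.
move=> inj; rewrite -unitmx_tr -row_free_unit -kermx_eq0.
apply/rowV0P => v /sub_kermxP; rewrite -[v in v *m _]trmxK -trmx_mul => /(congr1 trmx).
by rewrite trmxK trmx0 => /inj Mv0; apply: trmx_inj; rewrite Mv0 trmx0.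
Qed.

(** Matrix of the system for the pair (x, p) once the control is eliminated by u = - a^-1 B^T p. *)
Definition hamiltonian (a : R) : 'M[R]_(n + n) :=
  block_mx A (- a^-1 *: (B *m B^T)) (- (H^T *m H)) (- A^T).

Lemma hamiltonian_split a (g : R -> 'cV[R]_m) z :
  vH1_rep T z (fun t => hamiltonian a *m z t + col_mx 0 (H^T *m g t)) ->
  lq_state (usubmx (z 0)) (fun t => - a^-1 *: (B^T *m dsubmx (z t))) (fun t => usubmx (z t)) /\
  (dsubmx (z T) = 0 ->
    lq_costate (fun t => H *m usubmx (z t) - g t) (fun t => dsubmx (z t))).
Proof.
move=> hz; set w := (fun t => _ + _) in hz.
have hu : vH1_rep T (fun t => usubmx (z t)) (fun t => usubmx (w t)).
  move=> i; have := hz (lshift n i); congr (H1_rep T _ _);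
  by apply/funext => t; rewrite [RHS]mxE.
have hd : vH1_rep T (fun t => dsubmx (z t)) (fun t => dsubmx (w t)).
  move=> i; have := hz (rshift n i); congr (H1_rep T _ _);
  by apply/funext => t; rewrite [RHS]mxE.
have wE t : w t = col_mx (A *m usubmx (z t) + B *m (- a^-1 *: (B^T *m dsubmx (z t))))
    (- (A^T *m dsubmx (z t) + H^T *m (H *m usubmx (z t) - g t))).
  rewrite /w -[in LHS](vsubmxK (z t)) /hamiltonian mul_block_col add_col_mx addr0.
  congr col_mx; first by rewrite -scalemxAl -scalemxAr mulmxA.
  by rewrite mulmxBr !mulNmx mulmxA opprD opprB addrAC addrC (addrC (- _ ) (H^T *m g t)) addrA.
split; first split=> //.
  by eexists; split; [exact: hu|apply: aeW => t tT; rewrite wE col_mxKu].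
move=> zT; split => //.
by eexists; split; [exact: hd|apply: aeW => t tT; rewrite wE col_mxKd].
Qed.

Lemma vH1_mexp_cst k (M : 'M[R]_k) (v : 'cV[R]_k) :
  vH1_rep T (fun t => mexp M t *m v) (fun t => M *m (mexp M t *m v)).
Proof.
have := vH1_mulmx (fun i j => vH1_mexp M i j T0) (vH1_const T v).
by congr (vH1_rep T _ _); apply/funext => t; rewrite mulmx0 addr0 mulmxA.
Qed.

(* For a solution of the homogeneous two-point problem, duality reads
   [- a^-1 |B^T p|^2 = |H x|^2] in L^2; hence the input vanishes, so x = 0 and
   then p = 0. *)
Lemma hamiltonian_unit a : 0 < a -> drsubmx (mexp (hamiltonian a) T) \in unitmx.
Proof.
move=> a0; apply: unitmx_inj => v Sv.
pose z t := mexp (hamiltonian a) t *m col_mx 0 v.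
have hz : vH1_rep T z (fun t => hamiltonian a *m z t + col_mx 0 (H^T *m (0 : 'cV[R]_m))).
  have := vH1_mexp_cst (hamiltonian a) (col_mx 0 v).
  by congr (vH1_rep T _ _); apply/funext => t; rewrite mulmx0 col_mx0 addr0.
have z0 : z 0 = col_mx 0 v by rewrite /z mexp0 mul1mx.
have zT : dsubmx (z T) = 0.
  by rewrite /z -[mexp _ _]submxK mul_block_col !mulmx0 !add0r col_mxKd.
have [] := hamiltonian_split hz; rewrite z0 col_mxKu => hx /(_ zT) hp.
set p := fun t => dsubmx (z t) in hx hp; set x := fun t => usubmx (z t) in hx hp.
have lp : vL2 `]0, T[ p by case: hp => _ [dp [hp _]]; exact: vL2S (vH1_vL2_self hp).
have lx : vL2 `]0, T[ x by case: hx => _ [dx [hx _]]; exact: vL2S (vH1_vL2_self hx).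
have lBp : vL2 `]0, T[ (fun t => B^T *m p t) by exact: vL2_mulmx.
have lu : vL2 `]0, T[ (fun t => - a^-1 *: (B^T *m p t)) by exact: vL2Z.
have lr : vL2 `]0, T[ (fun t => H *m x t - 0).
  by apply: vL2B => //; [exact: vL2_mulmx|move=> i; apply: (@L2_eq _ _ (fun=> 0)) => //; [move=> ? _; rewrite mxE|exact: L20]].
have := lq_duality lu lr hx hp.
under eq_Rintegral do rewrite dotC dotZl -sqnormE.
rewrite RintegralZl//; last exact: vL2_sqnorm.
move=> dual.
have Bp0 : {ae mu, forall t, t \in `]0, T[ -> sqnorm (B^T *m p t) = 0}.
  apply: Rintegral0_ae0 => //; first exact: vL2_sqnorm.
    by move=> t _; exact: sqnorm_ge0.
  have : 0 <= - a^-1 * \int[mu]_(t in `]0, T[) sqnorm (B^T *m p t).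
    rewrite dual; apply: Rintegral_ge0 => t _.
    by rewrite subr0 -sqnormE sqnorm_ge0.
  by rewrite mulNr oppr_ge0 pmulr_rle0// invr_gt0.
have x0 t : t \in `[0, T] -> x t = 0.
  apply: (lq_state0 _ hx); apply: ae_imp Bp0 => s Bp0 sT.
  by rewrite (sqnorm_eq0 (Bp0 sT)) scaler0 mulmx0.
have p0 : p 0 = 0.
  case: hp => pT [dp [hp dpE]].
  apply: (linear_ode_zero (M := - A^T) hp _ (H1_memT T0) pT (H1_mem0 T0)).
  apply: ae_imp dpE => t dpE tT; rewrite dpE// -/(x t) (x0 _ (S tT)) mulmx0 subr0 mulmx0 addr0.
  by rewrite mulNmx.
by rewrite -p0 /p z0 col_mxKd.
Qed.

(** Shooting: the solution started at (x0, 0) is corrected by the homogeneous solution started at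
    (0, v). The condition p T = 0 is a linear equation for v, whose matrix is the lower right block
    of the exponential, invertible by [hamiltonian_unit]. *)
Lemma lq_optimality_system a ad x0 : 0 < a -> vL2 `]0, T[ ad ->
  exists x p, lq_state x0 (fun t => - a^-1 *: (B^T *m p t)) x /\
              lq_costate (fun t => H *m x t - ad t) p.
Proof.
move=> a0 lad; set M := hamiltonian a.
have lf : vL2 `[0, T] (fun t => col_mx 0 (H^T *m ad t) : 'cV[R]_(n + n)).
  move=> i; rewrite -(splitK i); case: (fintype.split i) => j /=.
    apply: (@L2_eq _ _ (fun=> 0)) => //; last exact: L20.
    by move=> t _; rewrite col_mxEu mxE.
  apply: (@L2_eq _ _ (fun t => (H^T *m ad t) j 0)) => //.
    by move=> t _; rewrite col_mxEd.
  have lad' := vL2_itv_oo_cc lad.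
  exact: (vL2_mulmx H^T (measurable_itv _) lad').
have [z1 [hz1 z10]] := linear_ode_exists M (col_mx x0 0) T0 lf.
pose v := - (invmx (drsubmx (mexp M T)) *m dsubmx (z1 T)).
pose z t := z1 t + mexp M t *m col_mx 0 v.
have hz : vH1_rep T z (fun t => M *m z t + col_mx 0 (H^T *m ad t)).
  have := vH1D hz1 (vH1_mexp_cst M (col_mx 0 v)).
  by congr (vH1_rep T _ _); apply/funext => t; rewrite /z mulmxDr addrAC.
have zT : dsubmx (z T) = 0.
  rewrite /z -[mexp _ _]submxK mul_block_col !mulmx0 !add0r.
  rewrite -[z1 T]vsubmxK add_col_mx col_mxKd /v mulmxN mulmxA mulmxV ?mul1mx ?subrr//.
  exact: hamiltonian_unit.
have [] := hamiltonian_split hz => hx /(_ zT) hp.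
exists (fun t => usubmx (z t)), (fun t => dsubmx (z t)); split => //.
by move: hx; rewrite /z mexp0 mul1mx z10 add_col_mx add0r addr0 col_mxKu.
Qed.

End control.
End linear_quadratic.

(** * The coupled acoustic model as a linear-quadratic problem *)

Section resonator_model.
Variables (R : realType) (n Nc m : nat) (P : model R n Nc) (Rm : 'M[R]_(m, n)).
Notation mu := (@lebesgue_measure R).

Definition stack (a b : 'cV[R]_n) (c d : 'cV[R]_Nc) : 'cV[R]_((n + n) + (Nc + Nc)) :=
  col_mx (col_mx a b) (col_mx c d).

Lemma stack0 : stack 0 0 0 0 = 0.
Proof. by rewrite /stack !col_mx0. Qed.

Lemma stack_inj a b c d a' b' c' d' : stack a b c d = stack a' b' c' d' ->
  [/\ a = a', b = b', c = c' & d = d'].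
Proof. by move=> /eq_col_mx[/eq_col_mx[-> ->] /eq_col_mx[-> ->]]. Qed.

Lemma stack_surj (z : 'cV[R]_((n + n) + (Nc + Nc))) :
  z = stack (usubmx (usubmx z)) (dsubmx (usubmx z)) (usubmx (dsubmx z)) (dsubmx (dsubmx z)).
Proof. by rewrite /stack !vsubmxK. Qed.

Definition drift : 'M[R]_((n + n) + (Nc + Nc)) :=
  block_mx (block_mx 0 1%:M (- Lambda P) 0) (block_mx 0 0 (coupling P) 0)
           0 (block_mx 0 1%:M (- Kmx P) (- (2 *: Gamma P))).

Definition input : 'M[R]_((n + n) + (Nc + Nc), Nc) := col_mx 0 (col_mx 0 1%:M).

Definition output : 'M[R]_(m, (n + n) + (Nc + Nc)) := row_mx (row_mx Rm 0) 0.

Lemma drift_stack a b c d : drift *m stack a b c d =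
  stack b (coupling P *m c - Lambda P *m a) d (- (Kmx P *m c) - 2 *: Gamma P *m d).
Proof.
rewrite /drift /stack mul_block_col !mul_block_col mul0mx add0r add_col_mx.
by rewrite !mul0mx !mul1mx !add0r !addr0 !mulNmx (addrC (- _) (coupling _ *m _)).
Qed.

Lemma input_mul (u : 'cV[R]_Nc) : input *m u = stack 0 0 0 u.
Proof. by rewrite /input /stack !mul_col_mx !mul0mx mul1mx col_mx0. Qed.

Lemma output_stack a b c d : output *m stack a b c d = Rm *m a.
Proof. by rewrite /output /stack !mul_row_col !mul0mx !addr0. Qed.

(** Up to sign and the observation term, this is the right-hand side of the adjoint system, the
    costate (pa, pv, pe, pz) being dual to the state (a, a', eta, eta'). *)
Lemma driftT_stack a b c d : drift^T *m stack a b c d =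
  stack (- (Lambda P *m b)) a ((coupling P)^T *m b - Kmx P *m d) (c - 2 *: Gamma P *m d).
Proof.
rewrite /drift /stack !tr_block_mx mul_block_col !mul_block_col.
have -> : (- Lambda P)^T = - Lambda P by rewrite linearN/= tr_diag_mx.
have -> : (- Kmx P)^T = - Kmx P by rewrite linearN/= tr_diag_mx.
have -> : (- (2 *: Gamma P))^T = - (2 *: Gamma P) by rewrite linearN/= linearZ/= tr_diag_mx.
rewrite !trmx0 !trmx1 !mul0mx !mul1mx.
by rewrite add_col_mx !add0r !addr0 !mulNmx.
Qed.

Lemma inputT_stack a b c d : input^T *m stack a b c d = d.
Proof. by rewrite /input /stack !tr_col_mx !mul_row_col !trmx0 trmx1 !mul0mx mul1mx !add0r. Qed.

Lemma outputT_mul (r : 'cV[R]_m) : output^T *m r = stack (Rm^T *m r) 0 0 0.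
Proof. by rewrite /output /stack !tr_row_mx !mul_col_mx !trmx0 !mul0mx col_mx0. Qed.

Lemma stackD a b c d a' b' c' d' :
  stack a b c d + stack a' b' c' d' = stack (a + a') (b + b') (c + c') (d + d').
Proof. by rewrite /stack !add_col_mx. Qed.

Lemma stackN a b c d : - stack a b c d = stack (- a) (- b) (- c) (- d).
Proof. by rewrite /stack !opp_col_mx. Qed.

Lemma vH1_col_mx k l (T : R) (f df : R -> 'cV[R]_k) (g dg : R -> 'cV[R]_l) :
  vH1_rep T (fun t => col_mx (f t) (g t)) (fun t => col_mx (df t) (dg t)) <->
  vH1_rep T f df /\ vH1_rep T g dg.
Proof.
split=> [h|[hf hg] i].
  split=> i.
    have := h (lshift l i); congr (H1_rep T _ _); apply/funext => t; exact: col_mxEu.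
  have := h (rshift k i); congr (H1_rep T _ _); apply/funext => t; exact: col_mxEd.
rewrite -(splitK i); case: (fintype.split i) => j /=.
  by have := hf j; congr (H1_rep T _ _); apply/funext => t; rewrite col_mxEu.
by have := hg j; congr (H1_rep T _ _); apply/funext => t; rewrite col_mxEd.
Qed.

Lemma vH1_stack (T : R) (a da b db : R -> 'cV[R]_n) (c dc d dd : R -> 'cV[R]_Nc) :
  vH1_rep T (fun t => stack (a t) (b t) (c t) (d t))
            (fun t => stack (da t) (db t) (dc t) (dd t)) <->
  [/\ vH1_rep T a da, vH1_rep T b db, vH1_rep T c dc & vH1_rep T d dd].
Proof.
split=> [/vH1_col_mx[/vH1_col_mx[? ?] /vH1_col_mx[? ?]]//|[ha hb hc hd]].
by apply/vH1_col_mx; split; exact/vH1_col_mx.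
Qed.

Section time.
Variables (T : R) (T_gt0 : 0 < T).

Definition stack_state (x0 : state R n Nc) :=
  let: (a, da, eta, deta) := x0 in stack a da eta deta.

Lemma is_solution_lq x0 u a da eta deta : is_solution P T x0 u a da eta deta ->
  lq_state T drift input (stack_state x0) u
    (fun t => stack (a t) (da t) (eta t) (deta t)).
Proof.
move=> [<- [dda [ddeta [[ha hda] [he hde] aeq eeq]]]]; split => //.
exists (fun t => stack (da t) (dda t) (deta t) (ddeta t)); split; first exact/vH1_stack.
apply: ae_imp2 aeq eeq => t aeq eeq tT.
rewrite drift_stack input_mul stackD !addr0 -(aeq tT) -(eeq tT) addrK.
congr (stack _ _ _ _).
rewrite addrC -[RHS]addrA [X in _ = _ + X]addrA subrr add0r addrK //.
Qed.

(** In the first-order system the derivative of a agrees with the component a' only almost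
    everywhere, whereas [is_solution] wants that very component as derivative; [vH1_ae] makes the
    replacement. The same holds for eta. *)
Lemma lq_is_solution x0 u x : lq_state T drift input (stack_state x0) u x ->
  is_solution P T x0 u (fun t => usubmx (usubmx (x t))) (fun t => dsubmx (usubmx (x t)))
    (fun t => usubmx (dsubmx (x t))) (fun t => dsubmx (dsubmx (x t))).
Proof.
move=> [x00 [dx [hx dxE]]]; split.
  move: x0 x00 {dxE} => [[[a0 da0] e0] de0]; rewrite /stack_state {1}(stack_surj (x 0)).
  by move=> /stack_inj[-> -> -> ->].
have : vH1_rep T
    (fun t => stack (usubmx (usubmx (x t))) (dsubmx (usubmx (x t)))
                    (usubmx (dsubmx (x t))) (dsubmx (dsubmx (x t))))
    (fun t => stack (usubmx (usubmx (dx t))) (dsubmx (usubmx (dx t)))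
                    (usubmx (dsubmx (dx t))) (dsubmx (dsubmx (dx t)))).
  by move: hx; congr (vH1_rep T _ _); apply/funext => t; exact: stack_surj.
move=> /vH1_stack[h1 h2 h3 h4].
have S : (`]0, T[%classic : set R) `<=` `[0, T]%classic by exact: subset_itv_oo_cc.
have eqs : {ae mu, forall t, t \in `]0, T[ -> stack (usubmx (usubmx (dx t))) (dsubmx (usubmx (dx t)))
    (usubmx (dsubmx (dx t))) (dsubmx (dsubmx (dx t))) =
    drift *m stack (usubmx (usubmx (x t))) (dsubmx (usubmx (x t)))
                    (usubmx (dsubmx (x t))) (dsubmx (dsubmx (x t))) + input *m u t}.
  by apply: ae_imp dxE => t dxE tT; rewrite -!stack_surj dxE.
exists (fun t => dsubmx (usubmx (dx t))), (fun t => dsubmx (dsubmx (dx t))); split.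
- split => //; apply: vH1_ae h1; last exact: vL2S (vH1_vL2_self h2).
  by apply: ae_imp eqs => t eqs tT; have := eqs tT; rewrite drift_stack input_mul stackD !addr0 => /stack_inj[].
- split => //; apply: vH1_ae h3; last exact: vL2S (vH1_vL2_self h4).
  by apply: ae_imp eqs => t eqs tT; have := eqs tT; rewrite drift_stack input_mul stackD !addr0 => /stack_inj[].
- apply: ae_imp eqs => t eqs tT; have := eqs tT.
  by rewrite drift_stack input_mul stackD !addr0 => /stack_inj[_ -> _ _]; rewrite subrK.
- apply: ae_imp eqs => t eqs tT; have := eqs tT.
  rewrite drift_stack input_mul stackD !addr0 => /stack_inj[_ _ _ ->].
  by rewrite [X in X + _]addrAC subrK addrAC addNr add0r.
Qed.

(** The set that defines [acoustic] is nonempty, so [xget] returns an actual solution and not its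
    default value. *)
Lemma acoustic_solution x0 u : vmemL2 `]0, T[ u ->
  exists da eta deta, is_solution P T x0 u (acoustic P T x0 u) da eta deta.
Proof.
move=> /(vmemL2P _ (measurable_itv _)) lu; rewrite /acoustic.
set S := [set a | _]; suff : S (xget (fun=> 0) S) by [].
apply: xgetPex.
have [x hx] := lq_state_exists drift input T_gt0 (stack_state x0) lu.
by do 4 eexists; exact: (lq_is_solution hx).
Qed.

Lemma acoustic_lq x0 u : vmemL2 `]0, T[ u ->
  exists2 x, lq_state T drift input (stack_state x0) u x &
    forall t, output *m x t = Rm *m acoustic P T x0 u t.
Proof.
move=> /(acoustic_solution x0)[da [eta [deta /is_solution_lq hx]]].
by eexists; first exact: hx; move=> t; rewrite output_stack.
Qed.

(** Moves facts from a constructed solution to the one chosen in [acoustic], also across a change of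
    the control on a null set. *)
Lemma acoustic_unique x0 u v a da eta deta : vmemL2 `]0, T[ u ->
  {ae mu, forall t, t \in `]0, T[ -> u t = v t} ->
  is_solution P T x0 v a da eta deta ->
  forall t, t \in `[0, T] -> acoustic P T x0 u t = a t.
Proof.
move=> /(acoustic_solution x0)[db [zeta [dzeta /is_solution_lq hx]]] uv /is_solution_lq hy t tT.
by have /stack_inj[] := lq_state_unique T_gt0 uv hx hy tT.
Qed.

Lemma cost_lq ad x0 a u x : (forall t, output *m x t = Rm *m acoustic P T x0 u t) ->
  cost P T Rm ad x0 a u = lq_cost T output a ad u x.
Proof. move=> xE; rewrite /cost /lq_cost; congr (_ * _ + _).
by apply: eq_Rintegral => t _; rewrite xE. Qed.

Lemma is_adjoint_lq ad a pa pv pe pz : is_adjoint P T Rm ad a pa pv pe pz ->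
  lq_costate T drift output (fun t => Rm *m a t - ad t)
    (fun t => stack (pa t) (pv t) (pe t) (pz t)).
Proof.
move=> [[paT pvT peT pzT] [dpa [dpv [dpe [dpz [[ha hv he hz] eqs]]]]]]; split.
  by rewrite paT pvT peT pzT stack0.
exists (fun t => stack (dpa t) (dpv t) (dpe t) (dpz t)); split; first exact/vH1_stack.
apply: ae_imp eqs => t eqs tT; have [e1 e2 e3 e4] := eqs tT.
rewrite driftT_stack outputT_mul stackD stackN !addr0; congr (stack _ _ _ _).
- by rewrite -e1 addrCA addNr addr0 opprK.
- by move/eqP: e2; rewrite subr_eq0 => /eqP <-; rewrite opprK.
- by move/eqP: e3; rewrite -addrA addr_eq0 => /eqP/(congr1 -%R); rewrite !opprK => ->; rewrite opprB addrC.
- by move/eqP: e4; rewrite -addrA addr_eq0 => /eqP/(congr1 -%R); rewrite !opprK => ->; rewrite opprB addrC.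
Qed.

Lemma lq_is_adjoint ad a p :
  lq_costate T drift output (fun t => Rm *m a t - ad t) p ->
  is_adjoint P T Rm ad a (fun t => usubmx (usubmx (p t))) (fun t => dsubmx (usubmx (p t)))
    (fun t => usubmx (dsubmx (p t))) (fun t => dsubmx (dsubmx (p t))).
Proof.
move=> [pT [dp [hp dpE]]]; split.
  by rewrite pT !linear0; split.
have : vH1_rep T
    (fun t => stack (usubmx (usubmx (p t))) (dsubmx (usubmx (p t)))
                    (usubmx (dsubmx (p t))) (dsubmx (dsubmx (p t))))
    (fun t => stack (usubmx (usubmx (dp t))) (dsubmx (usubmx (dp t)))
                    (usubmx (dsubmx (dp t))) (dsubmx (dsubmx (dp t)))).
  by move: hp; congr (vH1_rep T _ _); apply/funext => t; exact: stack_surj.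
move=> /vH1_stack[h1 h2 h3 h4].
do 4 eexists; split; first by split; [exact: h1|exact: h2|exact: h3|exact: h4].
apply: ae_imp dpE => t dpE tT; have := dpE tT.
rewrite {1}(stack_surj (dp t)) {1}(stack_surj (p t)) driftT_stack outputT_mul stackD stackN !addr0.
move=> /stack_inj[-> -> -> ->]; split.
- by rewrite opprK addrAC addNr add0r.
- by rewrite opprK subrr.
- by rewrite opprK addrAC subrK subrr.
- by rewrite opprK addrAC subrK subrr.
Qed.

(** The excess term is kept in the conclusion: its sign gives minimality, and its vanishing gives
    uniqueness. *)
Lemma minimizer_of_adjoint ad x0 a u pa pv pe pz v : 0 < a -> vmemL2 `]0, T[ ad ->
  vmemL2 `]0, T[ u -> vmemL2 `]0, T[ v ->
  is_adjoint P T Rm ad (acoustic P T x0 u) pa pv pe pz ->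
  {ae mu, forall t, t \in `]0, T[ -> a *: u t + pz t = 0} ->
  cost P T Rm ad x0 a u + a / 2 * sqnormL2 T (fun t => v t - u t) <=
  cost P T Rm ad x0 a v.
Proof.
move=> a0 lad lu lv /is_adjoint_lq hp stat.
have [x hx xE] := acoustic_lq x0 lu; have [y hy yE] := acoustic_lq x0 lv.
rewrite (cost_lq _ _ xE) (cost_lq _ _ yE).
apply: (lq_cost_optimal T_gt0 a0 _ _ _ hx hy (p := fun t => stack (pa t) (pv t) (pe t) (pz t))).
- exact/vmemL2P.
- exact/vmemL2P.
- exact/vmemL2P.
- by under eq_fun do rewrite xE.
- by apply: ae_imp stat => t stat tT; rewrite inputT_stack stat.
Qed.

Lemma optimal_control_exists ad x0 a : 0 < a -> vmemL2 `]0, T[ ad ->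
  exists u pa pv pe pz, [/\ vmemL2 `]0, T[ u,
    is_adjoint P T Rm ad (acoustic P T x0 u) pa pv pe pz &
    forall t, a *: u t + pz t = 0].
Proof.
move=> a0 /(vmemL2P _ (measurable_itv _)) lad.
have [x [p [hx hp]]] := lq_optimality_system drift input output T_gt0 (stack_state x0) a0 lad.
pose u t := - a^-1 *: (input^T *m p t).
have lu : vmemL2 `]0, T[ u.
  apply/vmemL2P => //; apply: vL2Z => //; apply: vL2_mulmx => //.
  case: hp => _ [dp [hp _]]; apply: vL2S (vH1_vL2_self hp) => //.
  exact: subset_itv_oo_cc.
(* The costate was built from the output of the constructed x; on [0, T] this is the output of the
   chosen [acoustic] response, so the equation is the same. *)
have hp' : lq_costate T drift output (fun t => Rm *m acoustic P T x0 u t - ad t) p.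
  case: hp => pT [dp [hp dpE]]; split => //; exists dp; split => //.
  apply: ae_imp dpE => t dpE tT; rewrite (dpE tT).
  have tT' : t \in `[0, T] by exact: subset_itv_oo_cc tT.
  rewrite (acoustic_unique lu (aeW _ _) (lq_is_solution hx) tT')//.
  by rewrite [in LHS](stack_surj (x t)) output_stack.
exists u; do 4 eexists; split; [exact: lu|exact: lq_is_adjoint hp'|].
move=> t; rewrite /u {1}(stack_surj (p t)) inputT_stack scalerA mulrN divff ?gt_eqF//.
by rewrite scaleN1r addNr.
Qed.

Lemma sqnormL2_eq0 k (f : R -> 'cV[R]_k) : vmemL2 `]0, T[ f -> sqnormL2 T f <= 0 ->
  {ae mu, forall t, t \in `]0, T[ -> f t = 0}.
Proof.
move=> /(vmemL2P _ (measurable_itv _)) lf f0.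
have : {ae mu, forall t, t \in `]0, T[ -> sqnorm (f t) = 0}.
  apply: (@Rintegral0_ae0 _ `]0, T[ (fun t => sqnorm (f t))) => //; first exact: vL2_sqnorm.
  by move=> t _; exact: sqnorm_ge0.
by apply: ae_imp => t h tT; apply: sqnorm_eq0; exact: h.
Qed.

Lemma sqnormL2_ge0 k (f : R -> 'cV[R]_k) : 0 <= sqnormL2 T f.
Proof. by apply: Rintegral_ge0 => t _; exact: sqnorm_ge0. Qed.

(** Necessity needs no derivative of the cost: the quadratic excess forces any minimizer to coincide
    a.e. with the constructed optimum. It then inherits the adjoint state of that optimum, since the
    two responses agree. *)
Lemma optimal_control_characterization ad x0 a : 0 < a -> vmemL2 `]0, T[ ad ->
  (exists u, is_minimizer P T Rm ad x0 a u /\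
     forall v, is_minimizer P T Rm ad x0 a v ->
       {ae mu, forall t, t \in `]0, T[ -> v t = u t}) /\
  (forall u, vmemL2 `]0, T[ u ->
     (is_minimizer P T Rm ad x0 a u <->
      exists pa pv pe pz,
        is_adjoint P T Rm ad (acoustic P T x0 u) pa pv pe pz /\
        {ae mu, forall t, t \in `]0, T[ -> a *: u t + pz t = 0})).
Proof.
move=> a0 lad.
have sufficient u pa pv pe pz : vmemL2 `]0, T[ u ->
    is_adjoint P T Rm ad (acoustic P T x0 u) pa pv pe pz ->
    {ae mu, forall t, t \in `]0, T[ -> a *: u t + pz t = 0} ->
    is_minimizer P T Rm ad x0 a u.
  move=> lu hp stat; split => // v lv.
  apply: le_trans (minimizer_of_adjoint a0 lad lu lv hp stat).
  by rewrite lerDl mulr_ge0 ?sqnormL2_ge0// divr_ge0// ltW.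
have [u [pa [pv [pe [pz [lu hp stat]]]]]] := optimal_control_exists x0 a0 lad.
have stat' : {ae mu, forall t, t \in `]0, T[ -> a *: u t + pz t = 0}.
  by apply: aeW => t _; exact: stat.
have uniq v : is_minimizer P T Rm ad x0 a v -> {ae mu, forall t, t \in `]0, T[ -> v t = u t}.
  move=> [lv vmin].
  have : {ae mu, forall t, t \in `]0, T[ -> v t - u t = 0}.
    apply: sqnormL2_eq0.
      by apply/vmemL2P => //; apply: vL2B => //; exact/vmemL2P.
    have := minimizer_of_adjoint a0 lad lu lv hp stat'.
    have := vmin _ lu; rewrite -(pmulr_rle0 _ (divr_gt0 a0 (ltr0n _ 2))); lra.
  by apply: ae_imp => t h tT; apply/eqP; rewrite -subr_eq0 h.
split; first by exists u; split; [exact: sufficient hp stat'|].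
move=> v lv; split=> [vmin|[qa [qv [qe [qz [hq qstat]]]]]]; last exact: sufficient hq qstat.
have vu := uniq _ vmin.
have [da [eta [deta sol]]] := acoustic_solution x0 lu.
exists pa, pv, pe, pz; split; last first.
  by apply: ae_imp vu => t vu tT; rewrite vu.
case: hp => hT [dpa [dpv [dpe [dpz [hh eqs]]]]]; split => //.
exists dpa, dpv, dpe, dpz; split => //.
apply: ae_imp eqs => t eqs tT.
have tT' : t \in `[0, T] by exact: subset_itv_oo_cc tT.
by rewrite (acoustic_unique lv vu sol tT'); exact: eqs.
Qed.

End time.
End resonator_model.

(** * Cosine and sine transforms *)

Section poisson_kernel.
Variable R : realType.
Notation mu := (@lebesgue_measure R).
Implicit Types (e x t : R).

Lemma Rintegral_FTC2 (F f : R -> R) (a b : R) : a <= b ->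
  (forall x : R, is_derive x (1 : R) F (f x)) -> continuous f ->
  \int[mu]_(x in `[a, b]) f x = F b - F a.
Proof.
rewrite le_eqVlt => /predU1P[<- _ _|ab dF cf].
  by rewrite set_itv1 Rintegral_set1 subrr.
have cF : continuous F.
  move=> x; apply: differentiable_continuous; apply/derivable1_diffP.
  by have [] := dF x.
rewrite /Rintegral (continuous_FTC2 (F := F))//=.
- exact: continuous_subspaceT.
- split.
  + by move=> x _; have [] := dF x.
  + exact/cvg_at_right_filter/cF.
  + exact/cvg_at_left_filter/cF.
- by move=> x _; rewrite derive1E; have [] := dF x.
Qed.

Definition damping e (nu : R) : R := expR (- (e * nu)).

(** Poisson kernel of the half plane without the factor 1 / pi: its mass on the whole line is pi for
    every e > 0. *)
Definition poisson e x : R := e / (e ^+ 2 + x ^+ 2).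

Lemma damping_le1 e (nu : R) : 0 <= e -> 0 <= nu -> `|damping e nu| <= 1.
Proof.
by move=> e0 nu0; rewrite ger0_norm ?expR_ge0// expR_le1 oppr_le0 mulr_ge0.
Qed.

Lemma poisson_ge0 e x : 0 < e -> 0 <= poisson e x.
Proof. by move=> e0; apply: divr_ge0; [exact: ltW|apply: addr_ge0; exact: sqr_ge0]. Qed.

Lemma poisson_le e x : 0 < e -> `|poisson e x| <= e^-1.
Proof.
move=> e0; rewrite ger0_norm ?poisson_ge0// /poisson ler_pdivrMr; last first.
  by rewrite ltr_pwDl ?exprn_gt0 ?sqr_ge0.
by rewrite mulrDr expr2 mulKf ?gt_eqF// lerDl mulr_ge0 ?sqr_ge0// invr_ge0 ltW.
Qed.

Lemma continuous_damping e : continuous (damping e).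
Proof.
move=> x; apply: (@continuous_comp _ _ _ (fun nu => - (e * nu)) expR); last exact: continuous_expR.
by apply: cvgN; apply: cvgM; [exact: cvg_cst|exact: cvg_id].
Qed.

Lemma measurable_damping e : measurable_fun setT (damping e).
Proof. exact: (continuous_measurable_fun (@continuous_damping e)). Qed.

Lemma is_derive_lin (c x : R) : is_derive x (1 : R) (fun y => c * y) c.
Proof.
have := @is_deriveM R R (cst c) id x 1 0 1 (is_derive_cst _ _ _) (is_derive_id _ _).
by rewrite scaler0 addr0 /GRing.scale/= mulr1.
Qed.

Lemma is_derive_damping e x :
  is_derive x (1 : R) (damping e) (- e * damping e x).
Proof.
have h : is_derive x (1 : R) (fun nu => - (e * nu)) (- e).
  by have := is_derive_lin (- e) x; under eq_fun do rewrite mulNr.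
have := @is_derive1_comp _ expR (fun nu => - (e * nu)) x _ _ (is_derive_expR _) h.
by rewrite mulrC.
Qed.

Lemma cvg_damping e : 0 < e -> damping e nu @[nu --> +oo] --> 0.
Proof.
move=> e0; apply: (@cvg_comp _ _ _ (fun nu => e * nu) (fun y => expR (- y)) _ +oo%R); last exact: cvgr_expR.
exact: gt0_cvgMry.
Qed.

Lemma Rintegral_damping_tail e (a : R) : 0 < e ->
  L1 `[a, +oo[ (damping e) /\
  \int[mu]_(nu in `[a, +oo[) damping e nu = e^-1 * damping e a.
Proof.
move=> e0; pose F nu := - e^-1 * damping e nu.
have dF (x : R) : is_derive x (1 : R) F (damping e x).
  have := @is_deriveM R R (cst (- e^-1)) (damping e) x 1 0 _ (is_derive_cst _ _ _) (is_derive_damping e x).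
  by rewrite scaler0 addr0 /GRing.scale/= mulrA mulrNN mulVf ?gt_eqF// mul1r.
have cF : continuous F.
  move=> x; apply: differentiable_continuous; apply/derivable1_diffP.
  by have [] := dF x.
have E : (\int[mu]_(nu in `[a, +oo[) (damping e nu)%:E = 0%:E - (F a)%:E)%E.
  apply: ge0_continuous_FTC2y.
  - by move=> x _; exact: expR_ge0.
  - by apply: continuous_subspaceT; exact: continuous_damping.
  - rewrite -[X in _ --> X](mulr0 (- e^-1)); apply: cvgM; first exact: cvg_cst.
    exact: cvg_damping.
  - by move=> x _; have [] := dF x.
  - exact/cvg_at_right_filter/cF.
  - by move=> x _; rewrite derive1E; have [] := dF x.
split; last by rewrite /Rintegral E /F/= mulNr sub0r opprK.
apply/integrableP; split.
  by apply/measurable_EFinP; apply: measurable_funTS; exact: measurable_damping.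
under eq_integral do rewrite /= ger0_norm ?expR_ge0//.
by rewrite E -EFinB ltry.
Qed.

Lemma L1_damping e : 0 < e -> L1 `[0, +oo[ (damping e).
Proof. by move=> /(Rintegral_damping_tail 0)[]. Qed.

Lemma is_derive_cos_lin (c x : R) : is_derive x (1 : R) (fun y => cos (c * y)) (- c * sin (c * x)).
Proof.
have := is_derive1_comp (is_derive_cos (c * x)) (is_derive_lin c x).
by rewrite mulrC mulNr mulrN.
Qed.

Lemma is_derive_sin_lin (c x : R) : is_derive x (1 : R) (fun y => sin (c * y)) (c * cos (c * x)).
Proof.
have := is_derive1_comp (is_derive_sin (c * x)) (is_derive_lin c x).
by rewrite mulrC.
Qed.

Lemma continuous_cos_lin (c : R) : continuous (fun y : R => cos (c * y)).
Proof.
move=> x; apply: (@continuous_comp _ _ _ (fun y : R => c * y) cos); last exact: continuous_cos.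
by apply: cvgM; [exact: cvg_cst|exact: cvg_id].
Qed.

Lemma continuous_sin_lin (c : R) : continuous (fun y : R => sin (c * y)).
Proof.
move=> x; apply: (@continuous_comp _ _ _ (fun y : R => c * y) sin); last exact: continuous_sin.
by apply: cvgM; [exact: cvg_cst|exact: cvg_id].
Qed.

Lemma L1_damping_cos e x : 0 < e -> L1 `[0, +oo[ (fun nu => damping e nu * cos (nu * x)).
Proof.
move=> e0; apply: (L1_mul_bounded (M := 1)) => //; first exact: L1_damping.
  apply: measurable_funTS; apply: continuous_measurable_fun => y.
  by under [X in continuous_at _ X]eq_fun do rewrite mulrC; exact: continuous_cos_lin.
by move=> y _; exact: cos_max.
Qed.

(** An explicit primitive F handles [0, y]. Both F y and the tail beyond y are of order exp(- e y),
    so letting y grow leaves only - F 0. *)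
Lemma Rintegral_damping_cos e x : 0 < e ->
  \int[mu]_(nu in `[0, +oo[) (damping e nu * cos (nu * x)) = poisson e x.
Proof.
move=> e0; pose f nu := damping e nu * cos (nu * x); rewrite -/f.
have lf : L1 `[0, +oo[ f by exact: L1_damping_cos.
have d0 : e ^+ 2 + x ^+ 2 != 0 by rewrite gt_eqF// ltr_pwDl ?exprn_gt0 ?sqr_ge0.
pose G nu := x * sin (x * nu) - e * cos (x * nu).
pose F nu := (e ^+ 2 + x ^+ 2)^-1 * (damping e nu * G nu).
have dG (y : R) : is_derive y (1 : R) G (x ^+ 2 * cos (x * y) + e * x * sin (x * y)).
  have h1 := is_deriveM (is_derive_cst x y 1) (is_derive_sin_lin x y).
  have h2 := is_deriveM (is_derive_cst e y 1) (is_derive_cos_lin x y).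
  have := is_deriveB h1 h2.
  rewrite !scaler0 !addr0 /GRing.scale/=.
  by rewrite (_ : _ - _ = x ^+ 2 * cos (x * y) + e * x * sin (x * y))//; ring.
have dF (y : R) : is_derive y (1 : R) F (f y).
  have h := is_deriveM (is_derive_damping e y) (dG y).
  have := is_deriveM (is_derive_cst (e ^+ 2 + x ^+ 2)^-1 y 1) h.
  rewrite !scaler0 !addr0 /GRing.scale/= /cst.
  suff -> : (e ^+ 2 + x ^+ 2)^-1 * (damping e y * (x ^+ 2 * cos (x * y) +
      e * x * sin (x * y)) + G y * (- e * damping e y)) = f y by [].
  by rewrite /f /G (mulrC y x); field.
have cf : continuous f.
  move=> y; apply: cvgM; first exact: continuous_damping.
  have cc : continuous (fun z : R => cos (z * x)).
    by under eq_fun do rewrite mulrC; exact: continuous_cos_lin.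
  exact: cc.
have F0 : F 0 = - poisson e x.
  rewrite /F /G /damping /poisson !mulr0 sin0 cos0 oppr0 expR0; ring.
(* The second factor comes from |x sin - e cos| <= |x| + e. *)
pose K := (e ^+ 2 + x ^+ 2)^-1 * (`|x| + e).
have FK y : `|F y| <= K * damping e y.
  rewrite /F normrM ger0_norm ?invr_ge0 ?addr_ge0 ?sqr_ge0// /K -mulrA ler_wpM2l//.
    by rewrite invr_ge0 addr_ge0 ?sqr_ge0.
  rewrite normrM ger0_norm ?expR_ge0// mulrC ler_wpM2r ?expR_ge0//.
  rewrite (le_trans (ler_normB _ _))// !normrM (gtr0_norm e0) lerD//.
    by rewrite ler_piMr// sin_max.
  by rewrite ler_piMr ?cos_max// ltW.
have main (y : R) : 0 <= y -> `|\int[mu]_(nu in `[0, +oo[) f nu - poisson e x| <=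
    (e^-1 + K) * damping e y.
  move=> y0.
  have split : \int[mu]_(nu in `[0, +oo[) f nu = F y - F 0 + \int[mu]_(nu in `]y, +oo[) f nu.
    have := Rintegral_itvB lf (x := y).
    rewrite bnd_simp => /(_ y0); rewrite bnd_simp => /(_ isT) <-.
    by rewrite (Rintegral_FTC2 y0 dF cf); ring.
  have tail : `|\int[mu]_(nu in `]y, +oo[) f nu| <= e^-1 * damping e y.
    have [ld <-] := Rintegral_damping_tail y e0.
    have lf' : L1 `]y, +oo[ f by apply: L1S lf => //; apply: subset_itvr; rewrite bnd_simp.
    have ld' : L1 `]y, +oo[ (damping e) by apply: L1S ld => //; apply: subset_itvr; rewrite bnd_simp.
    apply: (le_trans (le_normr_Rintegral _ lf')) => //.
    rewrite -Rintegral_itv_obnd_cbnd//; apply: le_Rintegral => //; first exact: L1_norm.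
    move=> z _; rewrite /f normrM (ger0_norm (expR_ge0 _)) ler_piMr ?expR_ge0//.
    exact: cos_max.
  rewrite split F0 opprK addrAC addrK.
  by rewrite (le_trans (ler_normD _ _))// addrC mulrDl lerD.
apply/eqP; rewrite -subr_eq0 -normr_le0.
have c0 : (e^-1 + K) * damping e y @[y --> +oo] --> (0 : R).
  rewrite -[X in _ --> X](mulr0 (e^-1 + K)); apply: cvgM; first exact: cvg_cst.
  exact: cvg_damping.
apply: (cvgr_to_ge c0).
by near=> y; apply: main; near: y; apply: nbhs_pinfty_ge; exact: num_real.
Unshelve. all: by end_near. Qed.

Lemma is_derive_atan_poisson e t (s : R) : 0 < e ->
  is_derive s (1 : R) (fun s => atan ((s - t) / e)) (poisson e (s - t)).
Proof.
move=> e0.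
have h : is_derive s (1 : R) (fun s => (s - t) / e) e^-1.
  have h1 := is_deriveB (is_derive_id s (1 : R)) (is_derive_cst t s 1).
  have := is_deriveM h1 (is_derive_cst e^-1 s 1).
  by rewrite scaler0 add0r subr0 /GRing.scale/= mulr1.
have := @is_derive1_comp _ atan (fun s => (s - t) / e) s _ _ (is_derive1_atan _) h.
rewrite (_ : _ * _ = poisson e (s - t))// /poisson; field.
by rewrite !lt0r_neq0// ltr_pwDl ?exprn_gt0 ?sqr_ge0.
Qed.

Lemma continuous_poisson e t : 0 < e -> continuous (fun s => poisson e (s - t)).
Proof.
move=> e0 s; apply: cvgM; first exact: cvg_cst.
apply: cvgV; first by rewrite gt_eqF// ltr_pwDl ?exprn_gt0 ?sqr_ge0.
apply: cvgD; first exact: cvg_cst.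
have h : (s0 - t @[s0 --> s] --> s - t) by apply: cvgB; [exact: cvg_id|exact: cvg_cst].
by under eq_cvg do rewrite expr2; rewrite expr2; apply: cvgM; exact: h.
Qed.

Lemma Rintegral_poisson e t (a b : R) : 0 < e -> a <= b ->
  \int[mu]_(s in `[a, b]) poisson e (s - t) = atan ((b - t) / e) - atan ((a - t) / e).
Proof.
move=> e0 ab; apply: (@Rintegral_FTC2 (fun s => atan ((s - t) / e))) => //.
  by move=> x; exact: is_derive_atan_poisson.
exact: continuous_poisson.
Qed.

Lemma poissonN e x : poisson e (- x) = poisson e x.
Proof. by rewrite /poisson sqrrN. Qed.

(** This is the bound on the mass of the Poisson kernel over an interval, uniform in e. *)
Lemma atan_diff_le_pi (x y : R) : `|atan x - atan y| <= pi.
Proof.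
have := atan_gtNpi2 x; have := atan_gtNpi2 y; have := atan_ltpi2 x; have := atan_ltpi2 y.
by move=> *; rewrite ler_norml; apply/andP; split; lra.
Qed.

Lemma measurable_poisson e : measurable_fun setT (fun z : R * R => poisson e (z.1 - z.2)).
Proof.
apply: (@measurableT_comp _ _ _ _ _ _ (poisson e)); last exact: measurable_funB.
have [->|e0] := eqVneq e 0.
  by rewrite (_ : poisson 0 = cst 0)//; apply/funext => x; rewrite /poisson mul0r.
apply: continuous_measurable_fun => x; apply: cvgM; first exact: cvg_cst.
apply: cvgV; first by rewrite gt_eqF// ltr_pwDl ?exprn_even_gt0 ?sqr_ge0.
apply: cvgD; first exact: cvg_cst.
by under eq_cvg do rewrite expr2; rewrite expr2; exact: cvgM.
Qed.

End poisson_kernel.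

(** * Damped Parseval identity and Bessel's inequality *)

Section cosine_transforms.
Variable R : realType.
Notation mu := (@lebesgue_measure R).
Notation pos := (`[0%R, +oo[%classic : set R).
Implicit Types (A B D : set R) (f g : R -> R).

Definition cosK (z : R * R) : R := cos (z.1 * z.2).
Definition sinK (z : R * R) : R := sin (z.1 * z.2).

Lemma measurable_cosK : measurable_fun setT cosK.
Proof.
apply: (@measurableT_comp _ _ _ _ _ _ (@cos R)); last exact: measurable_funM.
exact: (continuous_measurable_fun (@continuous_cos R)).
Qed.

Lemma measurable_sinK : measurable_fun setT sinK.
Proof.
apply: (@measurableT_comp _ _ _ _ _ _ (@sin R)); last exact: measurable_funM.
exact: (continuous_measurable_fun (@continuous_sin R)).
Qed.

Lemma cosK_le1 z : `|cosK z| <= 1. Proof. exact: cos_max. Qed.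
Lemma sinK_le1 z : `|sinK z| <= 1. Proof. exact: sin_max. Qed.

(** Used in both directions: for [D] a time interval these are transforms, for [D] a band they are
    superpositions of waves. The kernels are symmetric. *)
Definition cosT D f (nu : R) : R := \int[mu]_(t in D) (f t * cosK (nu, t)).
Definition sinT D f (nu : R) : R := \int[mu]_(t in D) (f t * sinK (nu, t)).

Lemma measurable_cosT D f : measurable D -> measurable_fun D f ->
  measurable_fun setT (cosT D f).
Proof. by move=> mD mf; apply: measurable_Rintegral_kernel => //; exact: measurable_cosK. Qed.

Lemma measurable_sinT D f : measurable D -> measurable_fun D f ->
  measurable_fun setT (sinT D f).
Proof. by move=> mD mf; apply: measurable_Rintegral_kernel => //; exact: measurable_sinK. Qed.

Lemma cosT_bound D f nu : measurable D -> L1 D f ->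
  `|cosT D f nu| <= \int[mu]_(t in D) `|f t|.
Proof.
move=> mD lf; rewrite -[leRHS]mul1r; apply: Rintegral_kernel_bound => //.
  exact: measurable_cosK.
exact: cosK_le1.
Qed.

Lemma sinT_bound D f nu : measurable D -> L1 D f ->
  `|sinT D f nu| <= \int[mu]_(t in D) `|f t|.
Proof.
move=> mD lf; rewrite -[leRHS]mul1r; apply: Rintegral_kernel_bound => //.
  exact: measurable_sinK.
exact: sinK_le1.
Qed.

Lemma L1_cosK D f nu : measurable D -> L1 D f -> L1 D (fun t => f t * cosK (nu, t)).
Proof. by move=> mD lf; exact: L1_section measurable_cosK cosK_le1. Qed.

Lemma L1_sinK D f nu : measurable D -> L1 D f -> L1 D (fun t => f t * sinK (nu, t)).
Proof. by move=> mD lf; exact: L1_section measurable_sinK sinK_le1. Qed.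

Lemma L1_cosKr D f t : measurable D -> L1 D f -> L1 D (fun nu => f nu * cosK (nu, t)).
Proof.
move=> mD lf; apply: (L1_mul_bounded (M := 1)) => //; last by move=> x _; exact: cosK_le1.
apply: measurable_funTS; apply: measurableT_comp; first exact: measurable_cosK.
exact: measurable_fun_pair.
Qed.

Lemma L1_sinKr D f t : measurable D -> L1 D f -> L1 D (fun nu => f nu * sinK (nu, t)).
Proof.
move=> mD lf; apply: (L1_mul_bounded (M := 1)) => //; last by move=> x _; exact: sinK_le1.
apply: measurable_funTS; apply: measurableT_comp; first exact: measurable_sinK.
exact: measurable_fun_pair.
Qed.

Lemma L1_damping_mul e (F : R -> R) (M : R) : 0 < e -> measurable_fun setT F ->
  (forall nu, `|F nu| <= M) -> L1 pos (fun nu => damping e nu * F nu).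
Proof.
move=> e0 mF FM; apply: (L1_mul_bounded (M := M)) => //; first exact: L1_damping.
exact: measurable_funTS.
Qed.

(** Damping makes the frequency integral absolutely convergent, so it may be taken first. The
    addition formula cos(nu s) cos(nu t) + sin(nu s) sin(nu t) = cos(nu (s - t)) then produces the
    Poisson kernel. *)
Lemma poisson_identity e A B f g : 0 < e -> measurable A -> measurable B ->
  L1 A f -> L1 B g ->
  \int[mu]_(nu in pos) (damping e nu * (cosT A f nu * cosT B g nu + sinT A f nu * sinT B g nu)) =
  \int[mu]_(t in B) (g t * \int[mu]_(s in A) (f s * poisson e (s - t))).
Proof.
move=> e0 mA mB lf lg.
have mpos : measurable pos by exact: measurable_itv.
have mfA := L1_measurable lf; have mgB := L1_measurable lg.
have lC : L1 pos (fun nu => damping e nu * cosT A f nu).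
  by apply: (L1_damping_mul e0 (measurable_cosT mA mfA)) => nu; exact: cosT_bound.
have lS : L1 pos (fun nu => damping e nu * sinT A f nu).
  by apply: (L1_damping_mul e0 (measurable_sinT mA mfA)) => nu; exact: sinT_bound.
have -> : \int[mu]_(nu in pos) (damping e nu * (cosT A f nu * cosT B g nu + sinT A f nu * sinT B g nu)) =
    \int[mu]_(nu in pos) ((damping e nu * cosT A f nu) * cosT B g nu +
                          (damping e nu * sinT A f nu) * sinT B g nu).
  by apply: eq_Rintegral => nu _; ring.
rewrite RintegralD//; last 2 first.
- exact: (L1_Rintegral_kernel mpos mB lC lg measurable_cosK cosK_le1).
- exact: (L1_Rintegral_kernel mpos mB lS lg measurable_sinK sinK_le1).
rewrite (Fubini_kernel mpos mB lC lg measurable_cosK cosK_le1).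
rewrite (Fubini_kernel mpos mB lS lg measurable_sinK sinK_le1).
have mK1 : measurable_fun setT (fun z : R * R => cosK (z.2, z.1)).
  by apply: measurableT_comp; [exact: measurable_cosK|exact: measurable_fun_pair].
have mK2 : measurable_fun setT (fun z : R * R => sinK (z.2, z.1)).
  by apply: measurableT_comp; [exact: measurable_sinK|exact: measurable_fun_pair].
rewrite -RintegralD//; last 2 first.
- exact: (L1_Rintegral_kernel mB mpos lg lC mK1 (fun z => cosK_le1 _)).
- exact: (L1_Rintegral_kernel mB mpos lg lS mK2 (fun z => sinK_le1 _)).
apply: eq_Rintegral => t _; rewrite -mulrDr; congr (g t * _).
rewrite -RintegralD//; last 2 first.
- exact: (L1_cosKr t mpos lC).
- exact: (L1_sinKr t mpos lS).
pose K (z : R * R) := cos (z.1 * (z.2 - t)).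
have mK : measurable_fun setT K.
  apply: (@measurableT_comp _ _ _ _ _ _ (@cos R)).
    exact: (continuous_measurable_fun (@continuous_cos R)).
  by apply: measurable_funM => //; exact: measurable_funB.
have K1 z : `|K z| <= 1 by exact: cos_max.
have -> : \int[mu]_(nu in pos) (damping e nu * cosT A f nu * cosK (nu, t) +
      damping e nu * sinT A f nu * sinK (nu, t)) =
    \int[mu]_(nu in pos) (damping e nu * \int[mu]_(s in A) (f s * K (nu, s))).
  apply: eq_Rintegral => nu _.
  have -> : \int[mu]_(s in A) (f s * K (nu, s)) =
      cosT A f nu * cosK (nu, t) + sinT A f nu * sinK (nu, t).
    rewrite /cosT /sinT -!RintegralZr//; [|exact: L1_sinK|exact: L1_cosK].
    rewrite -RintegralD//; last 2 first.
    - by apply: L1Zr => //; exact: L1_cosK.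
    - by apply: L1Zr => //; exact: L1_sinK.
    apply: eq_Rintegral => s _; rewrite /K /cosK /sinK/= mulrBr cosB; ring.
  by rewrite mulrDr !mulrA.
rewrite (Fubini_kernel mpos mA (L1_damping e0) lf mK K1).
by apply: eq_Rintegral => s _; rewrite -(Rintegral_damping_cos _ e0).
Qed.

(* Schur's test: the Poisson kernel has total mass at most pi. *)
Lemma poisson_schur e (a b : R) f : 0 < e -> a <= b -> L2 `[a, b] f ->
  \int[mu]_(t in `[a, b]) (f t * \int[mu]_(s in `[a, b]) (f s * poisson e (s - t))) <=
  pi * \int[mu]_(t in `[a, b]) f t ^+ 2.
Proof.
move=> e0 ab lf; set D := `[a, b]%classic.
have mD : measurable D by exact: measurable_itv.
have Dfin : (mu D < +oo)%E by exact: itv_finite.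
have lf1 : L1 D f by exact: L2_L1.
have lf2 := lf.2.
have l1 : L1 D (fun=> 1) by exact: L1_cst.
pose K (z : R * R) := poisson e (z.2 - z.1).
pose K' (z : R * R) := poisson e (z.1 - z.2).
have KE : K = K' by apply/funext => z; rewrite /K /K' -poissonN opprB.
have mK' : measurable_fun setT K' by exact: measurable_poisson.
have mK : measurable_fun setT K by rewrite KE.
have Kle z : `|K z| <= e^-1 by exact: poisson_le.
have Kle' z : `|K' z| <= e^-1 by exact: poisson_le.
pose q t := \int[mu]_(s in D) (1 * K (t, s)).
have qpi t : q t <= pi.
  rewrite /q; under eq_Rintegral do rewrite mul1r.
  by rewrite Rintegral_poisson// (le_trans (ler_norm _))// atan_diff_le_pi.
(* Under the nonnegative kernel, f t f s <= (f t^2 + f s^2) / 2. By symmetry of the kernel the two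
   halves have the same integral, to which the mass bound applies. *)
have inner t : f t * \int[mu]_(s in D) (f s * K (t, s)) <=
    2^-1 * (f t ^+ 2 * q t) + 2^-1 * (1 * \int[mu]_(s in D) (f s ^+ 2 * K (t, s))).
  have i1 : L1 D (fun s => 1 * K (t, s)) by exact: L1_section mD l1 mK Kle.
  have if1 : L1 D (fun s => f s * K (t, s)) by exact: L1_section mD lf1 mK Kle.
  have if2 : L1 D (fun s => f s ^+ 2 * K (t, s)) by exact: L1_section mD lf2 mK Kle.
  have <- : \int[mu]_(s in D) (f t * (f s * K (t, s))) =
      f t * \int[mu]_(s in D) (f s * K (t, s)) by rewrite RintegralZl.
  have <- : \int[mu]_(s in D) (2^-1 * (f t ^+ 2 * (1 * K (t, s))) +
      2^-1 * (f s ^+ 2 * K (t, s))) =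
      2^-1 * (f t ^+ 2 * q t) + 2^-1 * (1 * \int[mu]_(s in D) (f s ^+ 2 * K (t, s))).
    rewrite RintegralD//; [|by apply: L1Z => //; exact: L1Z|exact: L1Z].
    rewrite RintegralZl//; last exact: L1Z.
    by rewrite RintegralZl// [X in _ + X]RintegralZl// mul1r.
  apply: le_Rintegral => //.
  - by apply: L1Z => //; exact: L1_section mD lf1 mK Kle.
  - apply: L1D => //.
      by apply: L1Z => //; apply: L1Z => //; exact: L1_section mD l1 mK Kle.
    by apply: L1Z => //; exact: L1_section mD lf2 mK Kle.
  - move=> s _; have K0 : 0 <= K (t, s) by exact: poisson_ge0.
    rewrite mul1r -subr_ge0.
    rewrite (_ : _ - _ = 2^-1 * (K (t, s) * (f t - f s) ^+ 2)); last by field.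
    by apply: mulr_ge0 => //; apply: mulr_ge0 => //; exact: sqr_ge0.
have lq2 : L1 D (fun t => f t ^+ 2 * q t).
  exact: (L1_Rintegral_kernel mD mD lf2 l1 mK Kle).
have l12 : L1 D (fun t => 1 * \int[mu]_(s in D) (f s ^+ 2 * K (t, s))).
  exact: (L1_Rintegral_kernel mD mD l1 lf2 mK Kle).
apply: (@le_trans _ _ (\int[mu]_(t in D) (2^-1 * (f t ^+ 2 * q t) +
    2^-1 * (1 * \int[mu]_(s in D) (f s ^+ 2 * K (t, s)))))).
  apply: le_Rintegral => //.
  - exact: (L1_Rintegral_kernel mD mD lf1 lf1 mK Kle).
  - by apply: L1D => //; exact: L1Z.
rewrite RintegralD//; [|exact: L1Z|exact: L1Z].
have E : \int[mu]_(t in D) (1 * \int[mu]_(s in D) (f s ^+ 2 * K (t, s))) =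
    \int[mu]_(t in D) (f t ^+ 2 * q t).
  have /= -> := Fubini_kernel mD mD l1 lf2 mK Kle.
  apply: eq_Rintegral => t _; congr (_ * _); rewrite /q KE.
  by apply: eq_Rintegral => s _; rewrite -KE /K /K' -poissonN opprB.
apply: (@le_trans _ _ (\int[mu]_(t in D) (f t ^+ 2 * q t))).
  pose h t := 1 * \int[mu]_(s in D) (f s ^+ 2 * K (t, s)).
  have -> : \int[mu]_(x in D) (2^-1 * (1 * \int[mu]_(s in D) (f s ^+ 2 * K (x, s)))) =
      2^-1 * \int[mu]_(x in D) h x by rewrite -RintegralZl.
  by rewrite RintegralZl// E -mulrDl (_ : 2^-1 + 2^-1 = 1) ?mul1r//; field.
rewrite -RintegralZl//; apply: le_Rintegral => //; first exact: L1Z.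
by move=> t _; rewrite mulrC ler_wpM2r// sqr_ge0.
Qed.

(** Along e = 1 / (n + 1) the damping increases to 1, so monotone convergence removes it from the
    bound; integrability of F is part of the outcome. *)
Lemma undamped_bound (F : R -> R) (M c : R) : measurable_fun setT F ->
  (forall nu, 0 <= F nu <= M) ->
  (forall e, 0 < e -> \int[mu]_(nu in pos) (damping e nu * F nu) <= c) ->
  L1 pos F /\ \int[mu]_(nu in pos) F nu <= c.
Proof.
move=> mF F0M le_c.
have mpos : measurable pos by exact: measurable_itv.
pose h n nu := (damping (n.+1%:R^-1 : R) nu * F nu)%:E.
have bound : (\int[mu]_(nu in pos) (F nu)%:E <= c%:E)%E.
  have -> : (\int[mu]_(nu in pos) (F nu)%:E = \int[mu]_(nu in pos) limn (h ^~ nu))%E.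
    apply: eq_integral => nu _; apply/esym/cvg_lim => //.
    rewrite /h; apply: cvg_EFin; first exact: nearW.
    rewrite -[X in _ --> X](mul1r (F nu)); apply: cvgM; last exact: cvg_cst.
    rewrite /damping -[X in _ --> X](expR0).
    apply: (@cvg_comp _ _ _ (fun n : nat => - (n.+1%:R^-1 * nu)) (@expR R) _ (nbhs (0 : R))); last exact: continuous_expR.
    have : - (n.+1%:R^-1 * nu) @[n --> \oo] --> (- (0 * nu) : R).
      by apply: cvgN; apply: cvgM; [exact: cvg_harmonic|exact: cvg_cst].
    by rewrite mul0r oppr0.
  have hnd nu : pos nu -> {homo h ^~ nu : i j / (i <= j)%N >-> (i <= j)%E}.
    move=> nu0 i j ij; rewrite lee_fin ler_wpM2r//; first by case/andP: (F0M nu).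
    rewrite /damping ler_expR lerN2 ler_wpM2r//.
      by move: nu0; rewrite /= in_itv/= andbT.
    by rewrite lef_pV2 ?posrE// ler_nat.
  rewrite monotone_convergence//.
  - apply: lime_le.
      apply: ereal_nondecreasing_is_cvgn => i j ij; apply: ge0_le_integral => //.
      + by move=> nu nu0; rewrite lee_fin mulr_ge0 ?expR_ge0//; case/andP: (F0M nu).
      + apply/measurable_EFinP; apply: measurable_funTS; apply: measurable_funM => //; exact: measurable_damping.
      + apply/measurable_EFinP; apply: measurable_funTS; apply: measurable_funM => //; exact: measurable_damping.
      + by move=> nu nu0; exact: hnd.
    apply: nearW => n.
    have e0 : 0 < (n.+1%:R^-1 : R) by rewrite invr_gt0.
    have lh : L1 pos (fun nu => damping n.+1%:R^-1 nu * F nu).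
      apply: (L1_damping_mul (M := M)) => // nu; have /andP[F0 FM] := F0M nu.
      by rewrite ger0_norm.
    rewrite -[leLHS]fineK ?lee_fin; first exact: le_c.
    exact: integrable_fin_num.
  - move=> n; apply/measurable_EFinP; apply: measurable_funTS; apply: measurable_funM => //; exact: measurable_damping.
  - by move=> n nu nu0; rewrite lee_fin mulr_ge0 ?expR_ge0//; case/andP: (F0M nu).
have lF : L1 pos F.
  apply/integrableP; split; first by apply/measurable_EFinP; exact: measurable_funTS.
  apply: le_lt_trans (ltry c); apply: le_trans bound.
  rewrite le_eqVlt; apply/orP; left; apply/eqP; apply: eq_integral => nu _.
  by rewrite /= ger0_norm//; case/andP: (F0M nu).
split => //; rewrite -lee_fin /Rintegral fineK//.
exact: integrable_fin_num.
Qed.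

Lemma cvg_Rintegral D (f_ : nat -> R -> R) f g : measurable D ->
  (forall n, measurable_fun D (f_ n)) -> measurable_fun D f ->
  {ae mu, forall x, D x -> f_ n x @[n --> \oo] --> f x} -> L1 D g ->
  (forall n x, D x -> `|f_ n x| <= g x) ->
  \int[mu]_(x in D) f_ n x @[n --> \oo] --> \int[mu]_(x in D) f x.
Proof.
move=> mD mf_ mf f_f lg f_g.
have mE n : measurable_fun D (EFin \o f_ n) by exact/measurable_EFinP.
have mEf : measurable_fun D (EFin \o f) by exact/measurable_EFinP.
have cE : {ae mu, forall x, D x -> (fun n => (EFin \o f_ n) x) n @[n --> \oo] --> (EFin \o f) x}.
  by apply: ae_imp f_f => x h Dx; apply: cvg_EFin; [exact: nearW|exact: h].
have dom : {ae mu, forall x n, D x -> (`|(EFin \o f_ n) x| <= (EFin \o g) x)%E}.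
  by apply: aeW => x n Dx; rewrite lee_fin f_g.
have [if_ _ h] := @dominated_convergence _ _ _ mu D mD (fun n => EFin \o f_ n) (EFin \o f) (EFin \o g) mE mEf cE lg dom.
apply: fine_cvg; rewrite fineK; first exact: h.
exact: integrable_fin_num.
Qed.

Lemma Rintegral_CauchySchwarz D f g : measurable D -> L2 D f -> L2 D g ->
  (\int[mu]_(x in D) (f x * g x)) ^+ 2 <=
  (\int[mu]_(x in D) f x ^+ 2) * (\int[mu]_(x in D) g x ^+ 2).
Proof.
move=> mD lf lg; have lfg := L2_L1mul mD lf lg.
set A := \int[mu]_(x in D) f x ^+ 2; set B := \int[mu]_(x in D) (f x * g x).
set C := \int[mu]_(x in D) g x ^+ 2.
have quad (x y : R) : 0 <= x ^+ 2 * A + 2 * x * y * B + y ^+ 2 * C.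
  have <- : \int[mu]_(s in D) (x * f s + y * g s) ^+ 2 = x ^+ 2 * A + 2 * x * y * B + y ^+ 2 * C.
    rewrite -!RintegralZl//; [|exact: lg.2|exact: lf.2].
    rewrite -RintegralD//; [|by apply: L1Z => //; exact: lf.2|exact: L1Z].
    rewrite -RintegralD//; [|by apply: L1D => //; [apply: L1Z => //; exact: lf.2|exact: L1Z]|by apply: L1Z => //; exact: lg.2].
    by apply: eq_Rintegral => s _; ring.
  by apply: Rintegral_ge0 => s _; exact: sqr_ge0.
have A0 : 0 <= A by apply: Rintegral_ge0 => s _; exact: sqr_ge0.
have C0 : 0 <= C by apply: Rintegral_ge0 => s _; exact: sqr_ge0.
(* The first choice gives A (A C - B^2) >= 0. The second settles A = 0, where it reads - (C + 2) B^2
   >= 0. *)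
have q1 := quad B (- A); have q2 := quad (C + 1) (- B).
have [A_eq0|Apos] := eqVneq A 0; last first.
  have {}Apos : 0 < A by rewrite lt_def Apos.
  rewrite -subr_ge0 -(pmulr_rge0 _ Apos); apply: le_trans q1 _.
  by rewrite le_eqVlt; apply/orP; left; apply/eqP; ring.
by rewrite A_eq0 in q2 *; nra.
Qed.

(** Bessel's inequality on the half line: [poisson_identity] with f in both places, Schur's bound
    uniformly in e, and removal of the damping. The constant pi is half the 2 pi of the full
    line. *)
Lemma L2_cosT_sinT (a b : R) f : a <= b -> L2 `[a, b] f ->
  [/\ L2 pos (cosT `[a, b] f), L2 pos (sinT `[a, b] f) &
   \int[mu]_(nu in pos) (cosT `[a, b] f nu ^+ 2) + \int[mu]_(nu in pos) (sinT `[a, b] f nu ^+ 2)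
   <= pi * \int[mu]_(t in `[a, b]) f t ^+ 2].
Proof.
move=> ab lf; set D := `[a, b]%classic.
have mD : measurable D by exact: measurable_itv.
have mpos : measurable pos by exact: measurable_itv.
have lf1 : L1 D f by apply: L2_L1 => //; exact: itv_finite.
have mC := measurable_cosT mD (L1_measurable lf1).
have mS := measurable_sinT mD (L1_measurable lf1).
set c := \int[mu]_(t in D) `|f t|.
have C2 nu : cosT D f nu ^+ 2 <= c ^+ 2.
  by rewrite -[leLHS]real_normK ?num_real// lerXn2r// ?nnegrE ?cosT_bound//; apply: Rintegral_ge0.
have S2 nu : sinT D f nu ^+ 2 <= c ^+ 2.
  by rewrite -[leLHS]real_normK ?num_real// lerXn2r// ?nnegrE ?sinT_bound//; apply: Rintegral_ge0.
have mF : measurable_fun setT (fun nu => cosT D f nu ^+ 2 + sinT D f nu ^+ 2).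
  by apply: measurable_funD; exact: measurable_funX.
have [] := @undamped_bound (fun nu => cosT D f nu ^+ 2 + sinT D f nu ^+ 2) (c ^+ 2 + c ^+ 2)
    (pi * \int[mu]_(t in D) f t ^+ 2) mF.
- by move=> nu; rewrite addr_ge0 ?sqr_ge0//= lerD.
- move=> e e0; under eq_Rintegral do rewrite !expr2.
  by rewrite (poisson_identity e0 mD mD lf1 lf1); exact: poisson_schur.
move=> lF le_pi.
have lC : L2 pos (cosT D f).
  split; first exact: measurable_funTS.
  apply: L1_le lF _ => //; first by apply: measurable_funTS; exact: measurable_funX.
  by move=> nu _; rewrite ger0_norm ?sqr_ge0// lerDl sqr_ge0.
have lS : L2 pos (sinT D f).
  split; first exact: measurable_funTS.
  apply: L1_le lF _ => //; first by apply: measurable_funTS; exact: measurable_funX.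
  by move=> nu _; rewrite ger0_norm ?sqr_ge0// lerDr sqr_ge0.
by split => //; rewrite -RintegralD//; [exact: lC.2|exact: lS.2].
Qed.

Lemma cvg_damping1 (nu : R) : damping (n.+1%:R^-1 : R) nu @[n --> \oo] --> (1 : R).
Proof.
rewrite /damping -[X in _ --> X](expR0).
apply: (@cvg_comp _ _ _ (fun n : nat => - (n.+1%:R^-1 * nu)) (@expR R) _ (nbhs (0 : R))); last exact: continuous_expR.
have : - (n.+1%:R^-1 * nu) @[n --> \oo] --> (- (0 * nu) : R).
  by apply: cvgN; apply: cvgM; [exact: cvg_harmonic|exact: cvg_cst].
by rewrite mul0r oppr0.
Qed.

Lemma cvg_atan_scaled (x : R) :
  atan (x / (n.+1%:R^-1 : R)) @[n --> \oo] --> Num.sg x * (pi / 2).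
Proof.
have pcvg (y : R) : 0 < y -> atan (y / (n.+1%:R^-1 : R)) @[n --> \oo] --> pi / 2.
  move=> y0; apply: (@cvg_comp _ _ _ (fun n : nat => y / (n.+1%:R^-1 : R)) (@atan R) _ +oo%R); last exact: cvgy_atan.
  under eq_fun do rewrite invrK.
  have h : (n.+1%:R : R) @[n --> \oo] --> +oo%R.
    by have := @cvgr_idn R; rewrite -(cvg_shiftS (fun n => n%:R : R)).
  exact: (@cvg_comp _ _ _ (fun n : nat => n.+1%:R : R) (fun x => y * x) _ _ _ h (gt0_cvgMry y0 (@cvg_id _ _))).
have [->|x0|x0] := sgrP x.
- by rewrite mul0r; under eq_cvg do rewrite mul0r atan0; exact: cvg_cst.
- by rewrite mul1r; exact: pcvg.
- have xE n : atan (x / n.+1%:R^-1) = - atan (- x / n.+1%:R^-1) by rewrite mulNr atanN opprK.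
  rewrite mulN1r; under eq_cvg do rewrite xE.
  by apply: cvgN; apply: pcvg; rewrite oppr_gt0.
Qed.

(** Parseval's identity polarized against an indicator. Both sides of the damped identity converge
    by dominated convergence: on the time side the Poisson integral of the indicator is a difference
    of arctangents, bounded by pi, which tends to pi inside [a, b] and to 0 outside. *)
Lemma transform_pairing_itv (a b c d : R) f : a <= b -> c <= a -> b <= d -> L2 `[c, d] f ->
  \int[mu]_(nu in pos) (cosT `[a, b] (fun=> 1) nu * cosT `[c, d] f nu +
                        sinT `[a, b] (fun=> 1) nu * sinT `[c, d] f nu) =
  pi * \int[mu]_(t in `[a, b]) f t.
Proof.
move=> ab ca bd lf; have cd : c <= d by exact: le_trans ca (le_trans ab bd).
have mpos : measurable pos by exact: measurable_itv.
have l1 : L2 `[a, b] (fun=> 1 : R).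
  by apply: (L2_bounded (M := 1)) => //; [exact: itv_finite|move=> x _; rewrite normr1].
have l11 : L1 `[a, b] (fun=> 1 : R) by apply: L2_L1 => //; exact: itv_finite.
have lf1 : L1 `[c, d] f by apply: L2_L1 => //; exact: itv_finite.
have [lC1 lS1 _] := L2_cosT_sinT ab l1; have [lC lS _] := L2_cosT_sinT cd lf.
set G := fun nu => _ + _.
have lG : L1 pos G by apply: L1D => //; exact: L2_L1mul.
have mG := L1_measurable lG.
have lim1 : \int[mu]_(nu in pos) (damping (n.+1%:R^-1) nu * G nu) @[n --> \oo] -->
    \int[mu]_(nu in pos) G nu.
  apply: (cvg_Rintegral (g := fun nu => `|G nu|)) => //.
  - by move=> n; apply: measurable_funM => //; apply: measurable_funTS; exact: measurable_damping.
  - apply: aeW => nu _; rewrite -[X in _ --> X](mul1r (G nu)); apply: cvgM; last exact: cvg_cst.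
    exact: cvg_damping1.
  - exact: L1_norm.
  - move=> n nu; rewrite /= in_itv/= andbT => nu0.
    by rewrite normrM ler_piMl// damping_le1.
have lim2 : \int[mu]_(nu in pos) (damping (n.+1%:R^-1) nu * G nu) @[n --> \oo] -->
    \int[mu]_(t in `[c, d]) (f t * (pi * (\1_(`[a, b]%classic : set R) t))).
  have E n : \int[mu]_(nu in pos) (damping (n.+1%:R^-1) nu * G nu) =
      \int[mu]_(t in `[c, d]) (f t * (atan ((b - t) / n.+1%:R^-1) - atan ((a - t) / n.+1%:R^-1))).
    have e0 : 0 < (n.+1%:R^-1 : R) by rewrite invr_gt0.
    rewrite (poisson_identity e0 _ _ l11 lf1)//; apply: eq_Rintegral => t _; congr (_ * _).
    by under eq_Rintegral do rewrite mul1r; rewrite Rintegral_poisson.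
  under eq_cvg do rewrite E.
  apply: (cvg_Rintegral (g := fun t => pi * `|f t|)) => //.
  - move=> n; apply: measurable_funM; first exact: L1_measurable.
    have matan (x : R) : measurable_fun `[c, d] (fun t : R => atan ((x - t) / n.+1%:R^-1)).
      apply: measurable_funTS; apply: (@measurableT_comp _ _ _ _ _ _ (@atan R)).
        by apply: continuous_measurable_fun => y; exact: continuous_atan.
      by apply: measurable_funM => //; exact: measurable_funB.
    exact: measurable_funB.
  - apply: measurable_funM; first exact: L1_measurable.
    by apply: measurable_funM => //; exact: measurable_indic.
  (* At the endpoints the limit differs from pi times the indicator, so they are set aside as a null
     set. *)
  - have ne (x : R) : {ae mu, forall t, t != x}.
      exists [set x]; split => //; first exact: lebesgue_measure_set1.
      by move=> y /= /negP; rewrite negbK => /eqP.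
    apply: ae_imp2 (ne a) (ne b) => t ta tb _.
    apply: cvgM; first exact: cvg_cst.
    suff -> : pi * \1_`[a, b] t = Num.sg (b - t) * (pi / 2) - Num.sg (a - t) * (pi / 2) :> R.
      by apply: cvgB; exact: cvg_atan_scaled.
    rewrite indicE mem_setE in_itv/=.
    have [at_|ta_|tae] := ltgtP a t; last by rewrite tae eqxx in ta.
      have [tb_|bt_|tbe] := ltgtP t b; last by rewrite tbe eqxx in tb.
        rewrite gtr0_sg ?subr_gt0// ltr0_sg ?subr_lt0//= mulr1.
        by rewrite mul1r mulN1r opprK -splitr.
      rewrite ltr0_sg ?subr_lt0// ltr0_sg ?subr_lt0//= mulr0.
      by rewrite subrr.
    rewrite gtr0_sg ?subr_gt0//; last exact: lt_le_trans ta_ ab.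
    by rewrite gtr0_sg ?subr_gt0//= subrr mulr0.
  - by apply: L1Z => //; exact: L1_norm.
  - by move=> n t _; rewrite normrM mulrC ler_wpM2r// atan_diff_le_pi.
have -> : \int[mu]_(nu in pos) G nu = \int[mu]_(t in `[c, d]) (f t * (pi * (\1_(`[a, b]%classic : set R) t))).
  exact: (cvg_unique _ lim1 lim2).
have sub : `[a, b]%classic `<=` `[c, d]%classic.
  by move=> t /=; rewrite !in_itv/= => /andP[at_ tb]; rewrite (le_trans ca at_) (le_trans tb bd).
rewrite -RintegralZl//; last by exact: L1S lf1.
have -> : `[a, b]%classic = `[c, d]%classic `&` `[a, b]%classic by rewrite setIidr.
rewrite Rintegral_mkcondr; apply: eq_Rintegral => t _.
rewrite patchE indicE setIidr//.
by case: ifPn => _; rewrite ?mulr1 ?mulr0// mulrC.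
Qed.

End cosine_transforms.

(** * Plancherel transforms as limits of truncated transforms *)

Section inversion.
Variable R : realType.
Notation mu := (@lebesgue_measure R).
Notation pos := (`[0%R, +oo[%classic : set R).
Notation box N := (`[- N%:R, N%:R]%classic : set R).

(* Lindelof: intervals with rational endpoints reduce the union to a countable
   one. *)
Lemma ess_support_ae0 (h : R -> R[i]) :
  {ae mu, forall nu, ~ ess_support h nu -> h nu = 0}.
Proof.
pose ok (qr : rat * rat) := {ae mu, forall x, x \in `]ratr qr.1, ratr qr.2[ -> h x = 0}.
pose F (qr : rat * rat) : set R := [set x | [/\ ok qr, x \in `]ratr qr.1, ratr qr.2[ & h x != 0]].
pose G n : set R := if @unpickle (rat * rat)%type n is Some qr then F qr else set0.
have nG : mu.-negligible (\bigcup_n G n).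
  apply: negligible_bigcup => n; rewrite /G.
  case: unpickle => [qr|]; last exact: negligible_set0.
  have [okqr|nok] := pselect (ok qr); last first.
    by apply: (negligibleS _ (negligible_set0 _)) => x [].
  move: okqr => [N [mN N0 sub]]; exists N; split => // x [okqr xqr hx].
  by apply: sub => /= /(_ xqr) hx0; rewrite hx0 eqxx in hx.
have [N [mN N0 sub]] := nG; exists N; split => // nu /= /not_implyP[hnu hnu0].
apply: sub; move: hnu; rewrite /ess_support => /contrapT[U [oU hU] Unu].
have /nbhs_ballP[e /= e0 eU] : nbhs nu U by apply: open_nbhs_nbhs.
have /rat_in_itvoo[q] : nu - e < nu by rewrite ltrBlDr ltrDl.
have /rat_in_itvoo[r] : nu < nu + e by rewrite ltrDl.
rewrite !in_itv/= => /andP[nur re] /andP[eq qnu].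
have qrU x : x \in `]ratr q, ratr r[ -> U x.
  rewrite in_itv/= => /andP[qx xr]; apply: eU.
  by rewrite /ball/= ltr_norml; apply/andP; split; lra.
have Fqr : F (q, r) nu.
  split => /=.
  - by apply: ae_imp hU => x hx xqr; apply: hx; exact: qrU.
  - by rewrite in_itv/= qnu nur.
  - exact/eqP.
exists (@pickle (rat * rat)%type (q, r)); first exact: I.
by rewrite /G pickleK.
Qed.

Lemma L2_setT_pos f : L2 setT f -> L2 pos f.
Proof. by apply: L2S. Qed.

Definition fcos (h : R -> R[i]) nu := complex.Re (h nu).
(** The transform is c - i s with c and s the cosine and sine transforms, hence the sign. *)
Definition fsin (h : R -> R[i]) nu := - complex.Im (h nu).

Section transform.
Variables (g : R -> R) (h : R -> R[i]).
Hypotheses (lg : L2 setT g) (gh : is_fourier g h).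
Notation c := (fcos h).
Notation s := (fsin h).
Notation C N := (cosT (box N) g).
Notation S N := (sinT (box N) g).
Let mpos : measurable pos := measurable_itv _.

Let box_le N : - N%:R <= N%:R :> R.
Proof. by rewrite lerNl (le_trans _ (ler0n _ _))// oppr_le0. Qed.

Lemma L2_box N : L2 (box N) g.
Proof. exact: L2S lg. Qed.

Lemma L2_fcos : L2 pos c.
Proof. by case: gh => /memL2P h1 _ _; apply: L2_setT_pos; exact: h1. Qed.

Lemma L2_fsin : L2 pos s.
Proof. by case: gh => _ /memL2P h1 _; apply: L2N => //; apply: L2_setT_pos; exact: h1. Qed.

(** The squared modulus in [is_fourier] is a sum of two real squares, and restricting it to nu >= 0
    only decreases the integral. *)
Lemma cvg_transform :
  \int[mu]_(nu in pos) (c nu - C N nu) ^+ 2 + \int[mu]_(nu in pos) (s nu - S N nu) ^+ 2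
    @[N --> \oo] --> (0 : R).
Proof.
have [mc ms lim] := gh.
have {}mc : measurable_fun setT c by have [] := (memL2P _ measurableT).1 mc.
have {}ms : measurable_fun setT s.
  exact: (L2N measurableT ((memL2P _ measurableT).1 ms)).1.
have lc := L2_fcos; have ls := L2_fsin.
have mpos' : measurable pos by exact: measurable_itv.
have mC N : measurable_fun setT (C N) by apply: measurable_cosT => //; exact: (L2_box N).1.
have mS N : measurable_fun setT (S N) by apply: measurable_sinT => //; exact: (L2_box N).1.
pose e N := (\int[mu]_nu ((Normc.normc (h nu - fourier_trunc g N nu) ^+ 2)%:E))%E.
have normE N nu : Normc.normc (h nu - fourier_trunc g N nu) ^+ 2 =
    (c nu - C N nu) ^+ 2 + (s nu - S N nu) ^+ 2.
  rewrite /fcos /fsin; case: (h nu) => a b /=; rewrite sqr_sqrtr ?addr_ge0 ?sqr_ge0//.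
  by rewrite /cosT /sinT /cosK /sinK/=; ring.
have le_e N : ((\int[mu]_(nu in pos) (c nu - C N nu) ^+ 2 +
    \int[mu]_(nu in pos) (s nu - S N nu) ^+ 2)%:E <= e N)%E.
  have [lC lS _] := L2_cosT_sinT (box_le N) (L2_box N).
  have l1 := L2_sqr_sub mpos lc lC; have l2 := L2_sqr_sub mpos ls lS.
  rewrite -RintegralD// /Rintegral fineK; last first.
    by apply: integrable_fin_num => //; exact: L1D.
  apply: (@le_trans _ _ (\int[mu]_(nu in pos) ((Normc.normc (h nu - fourier_trunc g N nu) ^+ 2)%:E))%E).
    by rewrite le_eqVlt; apply/orP; left; apply/eqP; apply: eq_integral => nu _; rewrite normE.
  apply: ge0_subset_integral => //.
    apply/measurable_EFinP; rewrite (_ : (fun _ => _) =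
      (fun nu => (c nu - C N nu) ^+ 2 + (s nu - S N nu) ^+ 2)); last exact/funext/normE.
    by apply: measurable_funD; apply: measurable_funX; [apply: measurable_funB mc (mC N)|apply: measurable_funB ms (mS N)].
  by move=> nu _; rewrite lee_fin sqr_ge0.
have fe := fine_cvg lim.
apply: (squeeze_cvgr (f := fun=> 0) (h := fun N => fine (e N))); last 2 first.
- exact: cvg_cst.
- exact: fe.
have := cvg_is_fine lim; apply: filterS => N fin.
apply/andP; split; last by rewrite -lee_fin fineK.
by apply: addr_ge0; apply: Rintegral_ge0 => x _; exact: sqr_ge0.
Qed.

(** Bessel's inequality for the truncations passes to the limit. In place of the triangle inequality
    in L2, the pointwise bound x^2 <= (1 + l) y^2 + (1 + 1 / l) (x - y)^2 is integrated; N goes to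
    infinity and then l to 0. *)
Lemma transform_energy :
  \int[mu]_(nu in pos) (c nu ^+ 2 + s nu ^+ 2) <= pi * \int[mu]_t g t ^+ 2.
Proof.
have lc := L2_fcos; have ls := L2_fsin.
set G := \int[mu]_t g t ^+ 2.
have G0 : 0 <= G by apply: Rintegral_ge0 => t _; exact: sqr_ge0.
set X := \int[mu]_(nu in pos) _.
pose del N := \int[mu]_(nu in pos) (c nu - C N nu) ^+ 2 + \int[mu]_(nu in pos) (s nu - S N nu) ^+ 2.
have bound (l : R) N : 0 < l -> X <= (1 + l) * (pi * G) + (1 + l^-1) * del N.
  move=> l0; have [lC lS leN] := L2_cosT_sinT (box_le N) (L2_box N).
  have l1 := L2_sqr_sub mpos lc lC; have l2 := L2_sqr_sub mpos ls lS.
  have le_pi : \int[mu]_(nu in pos) C N nu ^+ 2 + \int[mu]_(nu in pos) S N nu ^+ 2 <= pi * G.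
    apply: (le_trans leN); rewrite ler_wpM2l ?pi_ge0//.
    rewrite Rintegral_mkcond; apply: le_Rintegral => //; last 2 first.
    - exact: lg.2.
    - by move=> t _; rewrite patchE; case: ifPn => // _; exact: sqr_ge0.
    have := ((@integrable_mkcond _ _ _ mu _ (EFin \o (fun t => g t ^+ 2)) (measurable_itv `[- N%:R, N%:R])).1 (L2_box N).2).
    by rewrite restrict_EFin.
  have sq (x y : R) : x ^+ 2 <= (1 + l) * y ^+ 2 + (1 + l^-1) * (x - y) ^+ 2.
    rewrite -subr_ge0.
    have -> : (1 + l) * y ^+ 2 + (1 + l^-1) * (x - y) ^+ 2 - x ^+ 2 =
        l^-1 * ((1 + l) * y - x) ^+ 2 by field; rewrite gt_eqF.
    by rewrite mulr_ge0 ?sqr_ge0// invr_ge0 ltW.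
  apply: (@le_trans _ _ (\int[mu]_(nu in pos)
      ((1 + l) * (C N nu ^+ 2 + S N nu ^+ 2) +
       (1 + l^-1) * ((c nu - C N nu) ^+ 2 + (s nu - S N nu) ^+ 2)))).
    apply: le_Rintegral => //.
    - by apply: L1D => //; [exact: lc.2|exact: ls.2].
    - by apply: L1D => //; apply: L1Z => //; apply: L1D => //; [exact: lC.2|exact: lS.2].
    - by move=> nu _; have := sq (c nu) (C N nu); have := sq (s nu) (S N nu); lra.
  have lCS : L1 pos (fun nu => C N nu ^+ 2 + S N nu ^+ 2).
    by apply: L1D => //; [exact: lC.2|exact: lS.2].
  have ldel : L1 pos (fun nu => (c nu - C N nu) ^+ 2 + (s nu - S N nu) ^+ 2) by exact: L1D.
  rewrite RintegralD//; [|exact: L1Z|exact: L1Z].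
  rewrite !RintegralZl// /del.
  have -> : \int[mu]_(nu in pos) (C N nu ^+ 2 + S N nu ^+ 2) =
      \int[mu]_(nu in pos) C N nu ^+ 2 + \int[mu]_(nu in pos) S N nu ^+ 2.
    exact: (L1_RintegralD mpos lC.2 lS.2).
  have -> : \int[mu]_(nu in pos) ((c nu - C N nu) ^+ 2 + (s nu - S N nu) ^+ 2) =
      \int[mu]_(nu in pos) (c nu - C N nu) ^+ 2 + \int[mu]_(nu in pos) (s nu - S N nu) ^+ 2.
    exact: (L1_RintegralD mpos l1 l2).
  by rewrite lerD2r ler_wpM2l// addr_ge0// ltW.
have bound2 (l : R) : 0 < l -> X <= (1 + l) * (pi * G).
  move=> l0.
  have lim : (1 + l) * (pi * G) + (1 + l^-1) * del N @[N --> \oo] --> (1 + l) * (pi * G).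
    rewrite -[X in _ --> X]addr0; apply: cvgD; first exact: cvg_cst.
    rewrite -[X in _ --> X](mulr0 (1 + l^-1)); apply: cvgM; first exact: cvg_cst.
    exact: cvg_transform.
  by apply: (cvgr_to_ge lim); apply: nearW => N; exact: bound.
apply/ler_addgt0Pr => e e0.
have piG : 0 <= pi * G by rewrite mulr_ge0// pi_ge0.
(* Chosen so that l times pi G is at most e; the added 1 guards against G = 0. *)
have l0 : 0 < e / (pi * G + 1) by rewrite divr_gt0// ltr_wpDl.
apply: (le_trans (bound2 _ l0)); rewrite mulrDl mul1r lerD2l.
rewrite mulrAC ler_pdivrMr ?ltr_wpDl// ler_wpM2l ?(ltW e0)//.
by rewrite lerDl.
Qed.

(** A weak form of Fourier inversion: it holds for the truncation to [- N, N] once this interval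
    contains [a, b], and Cauchy-Schwarz carries it to the limit. *)
Lemma transform_pairing (a b : R) : a <= b ->
  \int[mu]_(nu in pos) (c nu * cosT `[a, b] (fun=> 1) nu + s nu * sinT `[a, b] (fun=> 1) nu) =
  pi * \int[mu]_(t in `[a, b]) g t.
Proof.
move=> ab; have lc := L2_fcos; have ls := L2_fsin.
have l1 : L2 `[a, b] (fun=> 1 : R).
  by apply: (L2_bounded (M := 1)) => //; [exact: itv_finite|move=> x _; rewrite normr1].
have [lCx lSx _] := L2_cosT_sinT ab l1.
set Cx := cosT _ _ in lCx *; set Sx := sinT _ _ in lSx *.
set X := LHS; set Y := RHS.
pose d1 N := \int[mu]_(nu in pos) (c nu - C N nu) ^+ 2.
pose d2 N := \int[mu]_(nu in pos) (s nu - S N nu) ^+ 2.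
set x := \int[mu]_(nu in pos) Cx nu ^+ 2 + \int[mu]_(nu in pos) Sx nu ^+ 2.
have nn (f : R -> R) : 0 <= \int[mu]_(nu in pos) f nu ^+ 2.
  by apply: Rintegral_ge0 => nu _; exact: sqr_ge0.
(* The condition puts [a, b] inside the box. The factor 2 comes from (I1 + I2)^2 <= 2 (I1^2 +
   I2^2). *)
have bound N : `|a| + `|b| <= N%:R -> (X - Y) ^+ 2 <= 2 * x * (d1 N + d2 N).
  move=> Nab; have [lC lS _] := L2_cosT_sinT (box_le N) (L2_box N).
  have YE : Y = \int[mu]_(nu in pos) (Cx nu * C N nu + Sx nu * S N nu).
    apply/esym; apply: transform_pairing_itv => //; last exact: L2_box.
    - by have := normr_ge0 b; have := ler_norm (- a); rewrite normrN; lra.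
    - by have := normr_ge0 a; have := ler_norm b; lra.
  have lc' := L2B mpos lc lC; have ls' := L2B mpos ls lS.
  have XY : X - Y = \int[mu]_(nu in pos) ((c nu - C N nu) * Cx nu) +
      \int[mu]_(nu in pos) ((s nu - S N nu) * Sx nu).
    have m1 := L1D mpos (L2_L1mul mpos lc lCx) (L2_L1mul mpos ls lSx).
    have m2 := L1D mpos (L2_L1mul mpos lCx lC) (L2_L1mul mpos lSx lS).
    rewrite YE /X -(L1_RintegralB mpos m1 m2).
    rewrite -(L1_RintegralD mpos (L2_L1mul mpos lc' lCx) (L2_L1mul mpos ls' lSx)).
    by apply: eq_Rintegral => nu _; ring.
  have cs1 := Rintegral_CauchySchwarz mpos lc' lCx.
  have cs2 := Rintegral_CauchySchwarz mpos ls' lSx.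
  rewrite -/(d1 N) in cs1; rewrite -/(d2 N) in cs2.
  set I1 := Rintegral _ _ _ in XY cs1; set I2 := Rintegral _ _ _ in XY cs2.
  have d10 : 0 <= d1 N by exact: nn.
  have d20 : 0 <= d2 N by exact: nn.
  have x1 := nn Cx; have x2 := nn Sx.
  apply: (@le_trans _ _ (2 * (I1 ^+ 2 + I2 ^+ 2))).
    by rewrite XY; have := sqr_ge0 (I1 - I2); nra.
  rewrite -mulrA ler_wpM2l//.
  set u := \int[mu]_(nu in pos) Cx nu ^+ 2 in x1 cs1 *.
  set v := \int[mu]_(nu in pos) Sx nu ^+ 2 in x2 cs2 *.
  rewrite /x -/u -/v; nra.
have [N0 hN0] : exists N0 : nat, forall N, (N0 <= N)%N -> `|a| + `|b| <= N%:R.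
  exists (Num.bound (`|a| + `|b|)) => N leN.
  apply: le_trans (_ : (Num.bound (`|a| + `|b|))%:R <= _); last by rewrite ler_nat.
  by rewrite ltW// archi_boundP// addr_ge0.
have lim0 : 2 * x * (d1 N + d2 N) @[N --> \oo] --> (0 : R).
  rewrite -[X in _ --> X](mulr0 (2 * x)); apply: cvgM; first exact: cvg_cst.
  exact: cvg_transform.
have : (X - Y) ^+ 2 <= 0.
  apply: (cvgr_to_ge lim0); exists N0 => // N /= /hN0; exact: bound.
by rewrite real_exprn_even_le0 ?num_real//= subr_eq0 => /eqP.
Qed.

End transform.
End inversion.

(** * Band-limited functions and the resonator *)

Section waves.
Variable R : realType.
Notation mu := (@lebesgue_measure R).
Notation pos := (`[0%R, +oo[%classic : set R).

Definition idM (p : R -> R) (nu : R) := nu * p nu.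

Definition wave (I : set R) (p q : R -> R) (t : R) := cosT I p t + sinT I q t.

Lemma bandP (I : set R) : band I -> [/\ measurable I, (mu I < +oo)%E, I `<=` pos &
  exists M : R, forall nu, I nu -> `|nu| <= M].
Proof.
move=> [cI I0].
have mI : measurable I by exact: compact_measurable.
have [M [_ hM]] := compact_bounded cI.
have IM nu : I nu -> `|nu| <= `|M| + 1 by apply: hM; rewrite (le_lt_trans (ler_norm M))// ltrDl.
split => //; last by exists (`|M| + 1).
- apply: (@le_lt_trans _ _ (mu `[- (`|M| + 1), `|M| + 1]%classic)); last exact: itv_finite.
  apply: le_measure; rewrite ?inE//.
  by move=> nu /IM; rewrite /= in_itv/= ler_norml.
- by move=> nu /I0 /= nu0; rewrite in_itv/= andbT ltW.
Qed.

Section band.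
Variables (I : set R) (bI : band I).
Let mI : measurable I. Proof. by have [] := bandP bI. Qed.
Let Ifin : (mu I < +oo)%E. Proof. by have [] := bandP bI. Qed.
Let Ipos : I `<=` pos. Proof. by have [] := bandP bI. Qed.

Lemma L2_idM p : L2 I p -> L2 I (idM p).
Proof.
move=> lp; have [_ _ _ [M IM]] := bandP bI.
apply: (@L2_eq _ _ (fun nu => p nu * nu)) => //; first by move=> nu _; rewrite mulrC.
by apply: (L2_mul_bounded (M := M)).
Qed.

Lemma L2_band_L1 p : L2 I p -> L1 I p.
Proof. by move=> lp; exact: L2_L1. Qed.

Lemma cosTD p q t : L2 I p -> L2 I q ->
  cosT I (fun nu => p nu + q nu) t = cosT I p t + cosT I q t.
Proof.
move=> /L2_band_L1 lp /L2_band_L1 lq; rewrite -L1_RintegralD//; [|exact: L1_cosK|exact: L1_cosK].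
by apply: eq_Rintegral => nu _; rewrite mulrDl.
Qed.

Lemma sinTD p q t : L2 I p -> L2 I q ->
  sinT I (fun nu => p nu + q nu) t = sinT I p t + sinT I q t.
Proof.
move=> /L2_band_L1 lp /L2_band_L1 lq; rewrite -L1_RintegralD//; [|exact: L1_sinK|exact: L1_sinK].
by apply: eq_Rintegral => nu _; rewrite mulrDl.
Qed.

Lemma cosTZ (a : R) p t : L2 I p -> cosT I (fun nu => a * p nu) t = a * cosT I p t.
Proof.
move=> /L2_band_L1 lp; rewrite -RintegralZl//; last exact: L1_cosK.
by apply: eq_Rintegral => nu _; rewrite mulrA.
Qed.

Lemma sinTZ (a : R) p t : L2 I p -> sinT I (fun nu => a * p nu) t = a * sinT I p t.
Proof.
move=> /L2_band_L1 lp; rewrite -RintegralZl//; last exact: L1_sinK.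
by apply: eq_Rintegral => nu _; rewrite mulrA.
Qed.

Lemma waveD p q p' q' t : L2 I p -> L2 I q -> L2 I p' -> L2 I q' ->
  wave I (fun nu => p nu + p' nu) (fun nu => q nu + q' nu) t = wave I p q t + wave I p' q' t.
Proof. by move=> lp lq lp' lq'; rewrite /wave cosTD// sinTD// addrACA. Qed.

Lemma waveZ (a : R) p q t : L2 I p -> L2 I q ->
  wave I (fun nu => a * p nu) (fun nu => a * q nu) t = a * wave I p q t.
Proof. by move=> lp lq; rewrite /wave cosTZ// sinTZ// mulrDr. Qed.

Lemma L2_cosT T p : L2 I p -> L2 `[0, T] (cosT I p).
Proof.
move=> lp; apply: (L2_bounded (M := \int[mu]_(nu in I) `|p nu|)) => //; first exact: itv_finite.
  by apply: measurable_funTS; apply: measurable_cosT => //; exact: lp.1.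
by move=> t _; apply: cosT_bound => //; exact: L2_band_L1.
Qed.

Lemma L2_sinT T p : L2 I p -> L2 `[0, T] (sinT I p).
Proof.
move=> lp; apply: (L2_bounded (M := \int[mu]_(nu in I) `|p nu|)) => //; first exact: itv_finite.
  by apply: measurable_funTS; apply: measurable_sinT => //; exact: lp.1.
by move=> t _; apply: sinT_bound => //; exact: L2_band_L1.
Qed.

Lemma L1_cst1 (t : R) : L1 `[0, t] (fun=> 1 : R).
Proof. by apply: L1_cst => //; exact: itv_finite. Qed.

Lemma cosK_C (x y : R) : cosK (x, y) = cosK (y, x).
Proof. by rewrite /cosK/= mulrC. Qed.

Lemma sinK_C (x y : R) : sinK (x, y) = sinK (y, x).
Proof. by rewrite /sinK/= mulrC. Qed.

(** Instead of differentiating under the integral sign, the candidate derivative is integrated in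
    time and the integrals are exchanged. Multiplication by nu preserves L2 because a band is
    bounded. *)
Lemma H1_sinT T q : L2 I q -> H1_rep T (sinT I q) (cosT I (idM q)).
Proof.
move=> lq; have lq' := L2_idM lq; apply/H1_repP; split; first exact: L2_cosT.
move=> t /in_itv0[t0 _].
have -> : sinT I q 0 = 0.
  transitivity (\int[mu]_(nu in I) (0 : R)); last by rewrite Rintegral_cst ?mul0r.
  by apply: eq_Rintegral => nu _; rewrite /sinK/= mul0r sin0 mulr0.
have -> : \int[mu]_(s in `[0, t]) cosT I (idM q) s =
    \int[mu]_(s in `[0, t]) (1 * cosT I (idM q) s).
  by apply: eq_Rintegral => s _; rewrite mul1r.
rewrite (Fubini_kernel _ mI (L1_cst1 t) (L2_band_L1 lq') (@measurable_cosK R) (@cosK_le1 R))//.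
rewrite add0r; apply: eq_Rintegral => nu _.
rewrite /idM (mulrC nu) -mulrA; congr (q nu * _).
rewrite -RintegralZl//; last exact: (L1_cosKr _ _ (L1_cst1 t)).
transitivity (sin (nu * t) - sin (nu * 0)); first by rewrite mulr0 sin0 subr0 sinK_C.
rewrite -(Rintegral_FTC2 t0 (is_derive_sin_lin nu)).
  by apply: eq_Rintegral => s _; rewrite mul1r cosK_C.
by move=> x; apply: cvgM; [exact: cvg_cst|exact: continuous_cos_lin].
Qed.

Lemma H1_cosT T p : L2 I p -> H1_rep T (cosT I p) (fun t => - sinT I (idM p) t).
Proof.
move=> lp; have lp' := L2_idM lp; apply/H1_repP; split.
  by apply: L2N => //; exact: L2_sinT.
move=> t /in_itv0[t0 _].
have lnp := L2_L1 mI Ifin (L2N mI lp').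
have -> : \int[mu]_(s in `[0, t]) - sinT I (idM p) s =
    \int[mu]_(s in `[0, t]) (1 * \int[mu]_(nu in I) (- idM p nu * sinK (s, nu))).
  apply: eq_Rintegral => s _; rewrite mul1r /sinT -mulN1r -RintegralZl//.
    by apply: eq_Rintegral => nu _; rewrite mulN1r mulNr.
  by apply: L1_sinK => //; exact: L2_band_L1.
rewrite (Fubini_kernel _ mI (L1_cst1 t) lnp (@measurable_sinK R) (@sinK_le1 R))//.
rewrite -L1_RintegralD//; last 2 first.
- by apply: L1_cosK => //; exact: L2_band_L1.
- apply: (L1_Rintegral_kernel mI _ lnp (L1_cst1 t) (K := fun z => sinK (z.2, z.1)) (M := 1)) => //.
    by apply: measurableT_comp; [exact: measurable_sinK|exact: measurable_fun_pair].
  by move=> z; exact: sinK_le1.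
apply: eq_Rintegral => nu _.
have E : - idM p nu * \int[mu]_(x in `[0, t]) (1 * sinK (x, nu)) =
    p nu * (cos (nu * t) - cos (nu * 0)).
  have -> (J : R) : - idM p nu * J = p nu * (- nu * J) by rewrite /idM; ring.
  congr (p nu * _); rewrite -RintegralZl//; last exact: (L1_sinKr _ _ (L1_cst1 t)).
  rewrite -(Rintegral_FTC2 t0 (is_derive_cos_lin nu)).
    by apply: eq_Rintegral => s _; rewrite mul1r sinK_C.
  by move=> x; apply: cvgM; [exact: cvg_cst|exact: continuous_sin_lin].
by rewrite E /cosK/= mulr0 cos0 mul0r cos0 !(mulrC t) !mulr1; ring.
Qed.

Lemma sinTN p t : L2 I p -> sinT I (fun nu => - p nu) t = - sinT I p t.
Proof.
move=> lp; rewrite -mulN1r -sinTZ//; congr (sinT I _ t).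
by apply/funext => nu; rewrite mulN1r.
Qed.

Lemma H1_wave T p q : L2 I p -> L2 I q ->
  H1_rep T (wave I p q) (wave I (idM q) (fun nu => - idM p nu)).
Proof.
move=> lp lq; have := H1D (H1_cosT T lp) (H1_sinT T lq).
congr (H1_rep T _ _); apply/funext => t.
rewrite /wave sinTN; last exact: L2_idM.
by rewrite addrC.
Qed.

Lemma weighted_AM_GM (c x y : R) : 0 < c ->
  x * y <= c / 2 * x ^+ 2 + (2 * c)^-1 * y ^+ 2.
Proof.
move=> c0; rewrite -subr_ge0 (_ : _ - _ = (2 * c)^-1 * (c * x - y) ^+ 2); last first.
  by field; rewrite gt_eqF.
by rewrite mulr_ge0 ?sqr_ge0// invr_ge0 mulr_ge0// ltW.
Qed.

(** The weight pi is the one for which Bessel's inequality turns the last term into half the energy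
    of the wave. *)
Lemma Rintegral_weighted_AM_GM P Q C S : L2 I P -> L2 I Q -> L2 I C -> L2 I S ->
  \int[mu]_(nu in I) (P nu * C nu + Q nu * S nu) <=
  pi / 2 * \int[mu]_(nu in I) (P nu ^+ 2 + Q nu ^+ 2) +
  (2 * pi)^-1 * \int[mu]_(nu in I) (C nu ^+ 2 + S nu ^+ 2).
Proof.
move=> lP lQ lC lS; have pi0 : 0 < pi :> R by exact: pi_gt0.
have lY := L1D mI lP.2 lQ.2; have lZ := L1D mI lC.2 lS.2.
rewrite -!RintegralZl// -(L1_RintegralD mI (L1Z _ mI lY) (L1Z _ mI lZ)).
apply: le_Rintegral => //.
- by apply: L1D => //; exact: L2_L1mul.
- by apply: L1D => //; exact: L1Z.
- move=> nu _.
  have sq (x y : R) : x * y <= pi / 2 * x ^+ 2 + (2 * pi)^-1 * y ^+ 2.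
    exact: weighted_AM_GM.
  have := sq (P nu) (C nu); have := sq (Q nu) (S nu); lra.
Qed.

Lemma le_Rintegral_band C S : L2 pos C -> L2 pos S ->
  \int[mu]_(nu in I) (C nu ^+ 2 + S nu ^+ 2) <=
  \int[mu]_(nu in pos) C nu ^+ 2 + \int[mu]_(nu in pos) S nu ^+ 2.
Proof.
move=> lC lS; have mpos : measurable pos by exact: measurable_itv.
have lCS := L1D mpos lC.2 lS.2.
rewrite -(L1_RintegralD mpos lC.2 lS.2).
rewrite [in X in X <= _](_ : I = pos `&` I); last by rewrite setIidr.
rewrite Rintegral_mkcondr; apply: le_Rintegral => //.
- have lposI : L1 (pos `&` I) (fun nu => C nu ^+ 2 + S nu ^+ 2).
    by rewrite setIidr//; exact: L1S lCS.
  have := (integrable_restrict mu mI mpos (EFin \o (fun nu => C nu ^+ 2 + S nu ^+ 2))).1 lposI.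
  by rewrite restrict_EFin.
- by move=> nu _; rewrite patchE; case: ifPn => // _; rewrite addr_ge0 ?sqr_ge0.
Qed.

(* Duality: the square of the wave is paired with its own transform, to which
   Bessel's inequality applies. *)
Lemma wave_energy T P Q : 0 <= T -> L2 I P -> L2 I Q ->
  \int[mu]_(t in `[0, T]) wave I P Q t ^+ 2 <= pi * \int[mu]_(nu in I) (P nu ^+ 2 + Q nu ^+ 2).
Proof.
move=> T0 lP lQ; set u := wave I P Q; set X := (X in X <= _).
have lu : L2 `[0, T] u by apply: L2D => //; [exact: L2_cosT|exact: L2_sinT].
have lu1 : L1 `[0, T] u by apply: L2_L1 => //; exact: itv_finite.
have [lCp lSp le_pi] := L2_cosT_sinT T0 lu.
have lC : L2 I (cosT `[0, T] u) by exact: L2S lCp.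
have lS : L2 I (sinT `[0, T] u) by exact: L2S lSp.
have XE : X = \int[mu]_(nu in I) (P nu * cosT `[0, T] u nu + Q nu * sinT `[0, T] u nu).
  rewrite /X.
  have -> : \int[mu]_(t in `[0, T]) u t ^+ 2 =
      \int[mu]_(t in `[0, T]) (u t * cosT I P t + u t * sinT I Q t).
    by apply: eq_Rintegral => t _; rewrite expr2 {2}/u /wave mulrDr.
  rewrite L1_RintegralD//; last 2 first.
  - by apply: L2_L1mul => //; exact: L2_cosT.
  - by apply: L2_L1mul => //; exact: L2_sinT.
  rewrite (Fubini_kernel _ mI lu1 (L2_band_L1 lP) (@measurable_cosK R) (@cosK_le1 R))//.
  rewrite (Fubini_kernel _ mI lu1 (L2_band_L1 lQ) (@measurable_sinK R) (@sinK_le1 R))//.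
  rewrite (L1_RintegralD mI (L2_L1mul mI lP lC) (L2_L1mul mI lQ lS)).
  refine (f_equal2 +%R _ _).
    apply: eq_Rintegral => nu _; congr (P nu * _).
    by apply: eq_Rintegral => t _; congr (u t * _); exact: cosK_C.
  apply: eq_Rintegral => nu _; congr (Q nu * _).
  by apply: eq_Rintegral => t _; congr (u t * _); exact: sinK_C.
set Y := \int[mu]_(nu in I) (P nu ^+ 2 + Q nu ^+ 2).
have le1 := Rintegral_weighted_AM_GM lP lQ lC lS; rewrite -XE in le1.
have le2 := le_trans (le_Rintegral_band lCp lSp) le_pi.
have pi0 : 0 < pi :> R by exact: pi_gt0.
(* The second term equals X / 2 and is absorbed on the left, which leaves X <= pi Y. *)
have : X <= pi / 2 * Y + (2 * pi)^-1 * (pi * X).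
  by apply: (le_trans le1); rewrite lerD2l ler_wpM2l// invr_ge0 mulr_ge0// ltW.
have -> : (2 * pi)^-1 * (pi * X) = 2^-1 * X by rewrite invfM -mulrA mulKf// gt_eqF.
move: X Y {XE le1 le2 le_pi} => X Y; lra.
Qed.

End band.
End waves.

(** * Band-limited functions as superpositions of waves *)

Section band_waves.
Variable R : realType.
Notation mu := (@lebesgue_measure R).
Notation pos := (`[0%R, +oo[%classic : set R).

Lemma Rintegral_ae_support (D E : set R) (f : R -> R) : measurable D -> measurable E ->
  E `<=` D -> measurable_fun D f -> {ae mu, forall x, D x -> ~ E x -> f x = 0} ->
  \int[mu]_(x in D) f x = \int[mu]_(x in E) f x.
Proof.
move=> mD mE ED mf f0; rewrite [in RHS](_ : E = D `&` E); last by rewrite setIidr.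
rewrite Rintegral_mkcondr; apply: ae_eq_Rintegral => //.
- by apply/(measurable_restrict _ mE mD); exact: measurable_funS mf.
- apply: ae_imp f0 => x fx Dx; rewrite patchE; case: ifPn => // /negP xE.
  by apply: fx => // Ex; apply: xE; rewrite inE.
Qed.

(** Off I, the half line could meet the support only in -I, which consists of negative numbers. *)
Lemma band_support0 (I : set R) (h : R -> R[i]) : band I ->
  ess_support h `<=` I `|` (-%R @` I) ->
  {ae mu, forall nu, pos nu -> ~ I nu -> h nu = 0}.
Proof.
move=> [_ I0] hI; apply: ae_imp (ess_support_ae0 h) => nu h0 /= nu0 nI.
apply: h0 => /hI[//|[x /I0/= x0 E]].
by move: nu0; rewrite -E in_itv/= andbT oppr_ge0 leNgt x0.
Qed.

(* Pairing the transform with that of the indicator of [0, t] identifies the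
   primitives of both sides. *)
Lemma band_wave (I : set R) T g gt : band I -> 0 < T -> band_extension T I g gt ->
  exists p q, [/\ L2 I p, L2 I q,
    \int[mu]_(nu in I) (p nu ^+ 2 + q nu ^+ 2) <= pi^-1 * \int[mu]_t gt t ^+ 2 &
    {ae mu, forall t, t \in `]0, T[ -> g t = wave I p q t}].
Proof.
move=> bI T0 [/memL2P lgt gtg [h gth hI]].
have {}lgt : L2 setT gt by exact: lgt.
have [mI Ifin Ipos _] := bandP bI.
have mpos : measurable pos by exact: measurable_itv.
have lc := L2_fcos gth; have ls := L2_fsin gth.
set c := fcos h in lc; set s := fsin h in ls.
have lcI : L2 I c by exact: L2S lc.
have lsI : L2 I s by exact: L2S ls.
have pi0 : 0 < pi :> R by exact: pi_gt0.
(* The factor 1 / pi is that of inversion over nu > 0: formally, g is 1 / pi times the integral of c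
   cos(nu t) + s sin(nu t). *)
exists (fun nu => pi^-1 * c nu), (fun nu => pi^-1 * s nu); split.
- exact: L2Z.
- exact: L2Z.
- have le1 := le_Rintegral_band bI lc ls.
  have le2 := transform_energy lgt gth.
  rewrite -(L1_RintegralD mpos lc.2 ls.2) in le1.
  have {le2} := le_trans le1 le2.
  have -> : \int[mu]_(nu in I) ((pi^-1 * c nu) ^+ 2 + (pi^-1 * s nu) ^+ 2) =
      pi^-1 ^+ 2 * \int[mu]_(nu in I) (c nu ^+ 2 + s nu ^+ 2).
    rewrite -RintegralZl//; last by apply: L1D => //; [exact: lcI.2|exact: lsI.2].
    by apply: eq_Rintegral => nu _; rewrite !exprMn mulrDr.
  move=> le3; rewrite -[leRHS](_ : pi^-1 ^+ 2 * (pi * \int[mu]_t gt t ^+ 2) = _).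
    by rewrite ler_wpM2l// sqr_ge0.
  by rewrite expr2 -mulrA mulKf// gt_eqF.
have lw : L2 `[0, T] (wave I c s).
  by apply: L2D => //; [exact: L2_cosT|exact: L2_sinT].
have lgt0 : L2 `[0, T] gt by exact: L2S lgt.
have key : {ae mu, forall t, t \in `]0, T[ -> wave I c s t - pi * gt t = 0}.
  have lw1 : L1 `[0, T] (wave I c s) by apply: L2_L1 => //; exact: itv_finite.
  have lg1 : L1 `[0, T] gt by apply: L2_L1 => //; exact: itv_finite.
  apply: prim_eq0; first by apply: L1B => //; exact: L1Z.
  move=> t tT; have [t0 tT'] := in_itv0 tT.
  have sub : `[0, t] `<=` `[0, T] by apply: subset_itvl; rewrite bnd_simp.
  have lw1t : L1 `[0, t] (wave I c s) by exact: L1S lw1.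
  have lg1t : L1 `[0, t] gt by exact: L1S lg1.
  rewrite (L1_RintegralB _ lw1t (L1Z _ _ lg1t))// RintegralZl//.
  rewrite -(transform_pairing lgt gth t0) -/c -/s; apply/eqP; rewrite subr_eq0; apply/eqP.
  have l1 : L2 `[0, t] (fun=> 1 : R).
    by apply: (L2_bounded (M := 1)) => //; [exact: itv_finite|move=> x _; rewrite normr1].
  have [lCx lSx _] := L2_cosT_sinT t0 l1.
  (* Off I the transform vanishes a.e. on the half line, which reduces the pairing to an integral
     over I. *)
  rewrite [RHS](@Rintegral_ae_support _ I)//; last 2 first.
  - have := L1D mpos (L2_L1mul mpos lc lCx) (L2_L1mul mpos ls lSx).
    exact: L1_measurable.
  - apply: ae_imp (band_support0 bI hI) => nu h0 posnu nI.
    by rewrite /c /s /fcos /fsin h0//= oppr0 !mul0r addr0.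
  have lct := L2_cosT bI t lcI; have lst := L2_sinT bI t lsI.
  have lct1 : L1 `[0, t] (cosT I c) by apply: L2_L1 => //; exact: itv_finite.
  have lst1 : L1 `[0, t] (sinT I s) by apply: L2_L1 => //; exact: itv_finite.
  have lCxI : L2 I (cosT `[0, t] (fun=> 1)) by exact: L2S lCx.
  have lSxI : L2 I (sinT `[0, t] (fun=> 1)) by exact: L2S lSx.
  rewrite (L1_RintegralD mI (L2_L1mul mI lcI lCxI) (L2_L1mul mI lsI lSxI)).
  rewrite (L1_RintegralD _ lct1 lst1)//.
  have -> : \int[mu]_(x in `[0, t]) cosT I c x = \int[mu]_(x in `[0, t]) (1 * cosT I c x).
    by apply: eq_Rintegral => x _; rewrite mul1r.
  have -> : \int[mu]_(x in `[0, t]) sinT I s x = \int[mu]_(x in `[0, t]) (1 * sinT I s x).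
    by apply: eq_Rintegral => x _; rewrite mul1r.
  have mt : measurable (`[0, t] : set R) by exact: measurable_itv.
  rewrite (Fubini_kernel mt mI (L1_cst1 t) (L2_band_L1 bI lcI) (@measurable_cosK R) (@cosK_le1 R)).
  rewrite (Fubini_kernel mt mI (L1_cst1 t) (L2_band_L1 bI lsI) (@measurable_sinK R) (@sinK_le1 R)).
  refine (f_equal2 +%R _ _).
    apply: eq_Rintegral => nu _; congr (c nu * _).
    by apply: eq_Rintegral => x _; rewrite cosK_C.
  apply: eq_Rintegral => nu _; congr (s nu * _).
  by apply: eq_Rintegral => x _; rewrite sinK_C.
apply: ae_imp2 gtg key => t gg k tT.
rewrite (waveZ bI)// -(gg tT); move: (k tT) => /eqP; rewrite subr_eq0 => /eqP ->.
by rewrite mulKf// gt_eqF.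
Qed.

End band_waves.

(** * The resonator input of a band-limited source and its energy *)

Section resonator.
Variable R : realType.
Notation mu := (@lebesgue_measure R).

Lemma weak_deriv_unique T (g g' dg dg' : R -> R) : 0 < T ->
  {ae mu, forall t, t \in `]0, T[ -> g t = g' t} ->
  weak_deriv T g dg -> weak_deriv T g' dg' ->
  {ae mu, forall t, t \in `]0, T[ -> dg t = dg' t}.
Proof.
move=> T0 gg' [c [h [hdg _ gh]]] [c' [h' [hdg' _ gh']]].
apply: (H1_unique (ltW T0) _ hdg hdg').
apply: H1_ae_eq T0 _ hdg hdg'; apply: ae_imp3 gg' gh gh' => t E1 E2 E3 tT.
by rewrite -E2// -E3// E1.
Qed.

Lemma weak_deriv_ae T (g g' dg : R -> R) :
  {ae mu, forall t, t \in `]0, T[ -> g t = g' t} ->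
  weak_deriv T g dg -> weak_deriv T g' dg.
Proof.
move=> gg' [c [h [hdg h0 gh]]]; exists c, h; split => //.
by apply: ae_imp2 gg' gh => t E1 E2 tT; rewrite -E1// E2.
Qed.

Lemma H1_weak_deriv T (g dg : R -> R) : H1_rep T g dg -> weak_deriv T g dg.
Proof. by move=> hg; exists (g 0), g; split => //; exact: aeW. Qed.

(** Whichever weak derivatives are exhibited, the source determines the input a.e.; it may therefore
    be computed on an explicit superposition. *)
Lemma resonator_input_unique T gam om (g g' u u' : R -> R) : 0 < T ->
  {ae mu, forall t, t \in `]0, T[ -> g t = g' t} ->
  resonator_input T gam om g u -> resonator_input T gam om g' u' ->
  {ae mu, forall t, t \in `]0, T[ -> u t = u' t}.
Proof.
move=> T0 gg' [_ [d [dd [gd ddd uE]]]] [_ [d' [dd' [gd' ddd' uE']]]].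
have E1 := weak_deriv_unique T0 gg' gd gd'.
have E2 := weak_deriv_unique T0 E1 ddd ddd'.
have E12 := ae_imp2 (fun t (a : t \in `]0, T[ -> d t = d' t)
  (b : t \in `]0, T[ -> dd t = dd' t) => conj a b) E1 E2.
have E3 := ae_imp2 (fun t (a : t \in `]0, T[ -> u t = _)
  (b : t \in `]0, T[ -> u' t = _) => conj a b) uE uE'.
apply: ae_imp3 gg' E12 E3 => t e [e1 e2] [e3 e4] tT.
by rewrite e3// e4// e// e1// e2.
Qed.

Lemma multiplier_sqr gam om nu : multiplier gam om nu ^+ 2 =
  (om ^+ 2 + gam ^+ 2 - nu ^+ 2) ^+ 2 + (2 * gam * nu) ^+ 2 :> R.
Proof. by rewrite /multiplier/= sqr_sqrtr// addr_ge0 ?sqr_ge0. Qed.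

Lemma multiplier_ge0 gam om nu : 0 <= multiplier gam om nu :> R.
Proof. exact: sqrtr_ge0. Qed.

Lemma multiplier_ubound (I : set R) gam om : band I ->
  has_ubound [set multiplier gam om nu | nu in I].
Proof.
move=> bI; have [_ _ _ [M IM]] := bandP bI.
(* The leading 1 avoids a square root, as d <= 1 + d^2 for every real d. *)
exists (1 + ((om ^+ 2 + gam ^+ 2 + M ^+ 2) ^+ 2 + (2 * gam * M) ^+ 2)).
move=> _ [nu /IM nuM <-].
have m0 := multiplier_ge0 gam om nu.
have : multiplier gam om nu ^+ 2 <= (om ^+ 2 + gam ^+ 2 + M ^+ 2) ^+ 2 + (2 * gam * M) ^+ 2.
  have nu2 : nu ^+ 2 <= M ^+ 2 by rewrite -(real_normK (num_real nu)) ler_sqr ?nnegrE// (le_trans (normr_ge0 nu)).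
  rewrite multiplier_sqr lerD//; last first.
    by rewrite !exprMn ler_wpM2l// mulr_ge0// sqr_ge0.
  rewrite -(real_normK (num_real (_ - _))) ler_sqr ?nnegrE ?normr_ge0//; last first.
    by rewrite !addr_ge0 ?sqr_ge0.
  rewrite ler_norml; have := sqr_ge0 om; have := sqr_ge0 gam; have := sqr_ge0 nu.
  by move=> *; apply/andP; split; lra.
nra.
Qed.

(** In complex form, P - i Q = (om^2 + gam^2 - nu^2 + 2 i gam nu) (p - i q), with P and Q given by
    [filterP] and [filterQ]. *)
Definition filterP gam om (p q : R -> R) nu :=
  (om ^+ 2 + gam ^+ 2 - nu ^+ 2) * p nu + 2 * gam * nu * q nu.
Definition filterQ gam om (p q : R -> R) nu :=
  (om ^+ 2 + gam ^+ 2 - nu ^+ 2) * q nu - 2 * gam * nu * p nu.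

Section wave.
Variables (I : set R) (gam om : R) (p q : R -> R).
Hypotheses (bI : band I) (lp : L2 I p) (lq : L2 I q).
Let mI : measurable I. Proof. by have [] := bandP bI. Qed.
Let k := om ^+ 2 + gam ^+ 2.

Lemma L2_filterP : L2 I (filterP gam om p q).
Proof.
have lpp := L2_idM bI (L2_idM bI lp); have lq' := L2_idM bI lq.
apply: (L2_eq (f := fun nu => (k * p nu - idM (idM p) nu) + (2 * gam) * idM q nu)) => //.
  by move=> nu _; rewrite /filterP /idM /k; ring.
by apply: L2D => //; [apply: L2B => //|]; exact: L2Z.
Qed.

Lemma L2_filterQ : L2 I (filterQ gam om p q).
Proof.
have lqq := L2_idM bI (L2_idM bI lq); have lp' := L2_idM bI lp.
apply: (L2_eq (f := fun nu => (k * q nu - idM (idM q) nu) - (2 * gam) * idM p nu)) => //.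
  by move=> nu _; rewrite /filterQ /idM /k; ring.
by apply: L2B => //; [apply: L2B => //|]; exact: L2Z.
Qed.

Lemma wave_input T : 0 < T ->
  resonator_input T gam om (wave I p q) (wave I (filterP gam om p q) (filterQ gam om p q)).
Proof.
move=> T0; have lp' := L2_idM bI lp; have lq' := L2_idM bI lq.
have lnp' := L2N mI lp'.
have lnp'' := L2_idM bI lnp'; have lnq'' := L2N mI (L2_idM bI lq').
have h1 := H1_wave bI T lp lq; have h2 := H1_wave bI T lq' lnp'.
split.
  apply/memL2P; first exact: measurable_itv.
  apply: (L2S (D := `[0, T])) => //; first exact: subset_itv_oo_cc.
  by apply: L2D => //; [apply: L2_cosT => //; exact: L2_filterP|apply: L2_sinT => //; exact: L2_filterQ].
exists (wave I (idM q) (fun nu => - idM p nu)).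
exists (wave I (idM (fun nu => - idM p nu)) (fun nu => - idM (idM q) nu)).
split; [exact: H1_weak_deriv h1|exact: H1_weak_deriv h2|].
apply: aeW => t _.
rewrite -[2 * gam * _](waveZ bI)// -[X in _ + X](waveZ bI)//.
rewrite -(waveD bI)//; [|exact: L2Z..].
rewrite -(waveD bI)//; [|by apply: L2D => //; exact: L2Z|by apply: L2D => //; exact: L2Z|exact: L2Z..].
by congr (wave I _ _ t); apply/funext => nu; rewrite /filterP /filterQ /idM; ring.
Qed.

Lemma filter_energy : \int[mu]_(nu in I) (filterP gam om p q nu ^+ 2 + filterQ gam om p q nu ^+ 2) <=
  sup [set multiplier gam om nu | nu in I] ^+ 2 * \int[mu]_(nu in I) (p nu ^+ 2 + q nu ^+ 2).
Proof.
have lpq := L1D mI lp.2 lq.2.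
rewrite -RintegralZl//; apply: le_Rintegral => //.
- by apply: L1D => //; [exact: L2_filterP.2|exact: L2_filterQ.2].
- exact: L1Z.
- move=> nu Inu.
  rewrite [leLHS](_ : _ = multiplier gam om nu ^+ 2 * (p nu ^+ 2 + q nu ^+ 2)); last first.
    by rewrite multiplier_sqr /filterP /filterQ; ring.
  rewrite ler_wpM2r ?addr_ge0 ?sqr_ge0//.
  have le : multiplier gam om nu <= sup [set multiplier gam om nu | nu in I].
    by apply: ub_le_sup; [exact: multiplier_ubound|exists nu].
  by rewrite ler_sqr ?nnegrE ?(le_trans _ le)// multiplier_ge0.
Qed.

End wave.

Lemma band_resonator (I : set R) T g gt gam om u : band I -> 0 < T ->
  band_extension T I g gt -> resonator_input T gam om g u ->
  \int[mu]_(t in `]0, T[) u t ^+ 2 <=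
  sup [set multiplier gam om nu | nu in I] ^+ 2 * \int[mu]_t gt t ^+ 2.
Proof.
move=> bI T0 /(band_wave bI T0)[p [q [lp lq le gw]]] gu.
have [mI _ _ _] := bandP bI.
have uE := resonator_input_unique T0 gw gu (wave_input gam om bI lp lq T0).
have /memL2P lu := gu.1; have {}lu : L2 `]0, T[ u by apply: lu.
have lP := L2_filterP gam om bI lp lq; have lQ := L2_filterQ gam om bI lp lq.
set P := filterP _ _ _ _ in lP uE; set Q := filterQ _ _ _ _ in lQ uE.
have lw : L2 `[0, T] (wave I P Q) by apply: L2D => //; [exact: L2_cosT|exact: L2_sinT].
have -> : \int[mu]_(t in `]0, T[) u t ^+ 2 = \int[mu]_(t in `]0, T[) wave I P Q t ^+ 2.
  apply: ae_eq_Rintegral => //; first exact: L1_measurable lu.2.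
  - apply: (measurable_funS (E := `[0, T])) => //; first exact: subset_itv_oo_cc.
    exact: L1_measurable lw.2.
  - by apply: ae_imp uE => t E tT; rewrite E.
rewrite Rintegral_itv_oo_cc; last by apply: L1S lw.2 => //; exact: subset_itv_oo_cc.
apply: le_trans (wave_energy bI (ltW T0) lP lQ) _.
have pi0 : 0 < pi :> R by exact: pi_gt0.
have := filter_energy gam om bI lp lq; rewrite -/P -/Q => le2.
have S0 := sqr_ge0 (sup [set multiplier gam om nu | nu in I]).
apply: le_trans (_ : pi * (sup [set multiplier gam om nu | nu in I] ^+ 2 *
  (pi^-1 * \int[mu]_t gt t ^+ 2)) <= _).
  rewrite ler_wpM2l ?(ltW pi0)//; apply: le_trans le2 _.
  by rewrite ler_wpM2l.
by rewrite mulrCA mulVKf// gt_eqF.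
Qed.

Lemma Lnorm2_sqr (g : R -> R) : L2 setT g ->
  fine ('N[mu]_2%:E[EFin \o g])%E ^+ 2 = \int[mu]_t g t ^+ 2.
Proof.
move=> [mg ig]; have := @poweR_Lnorm _ _ _ mu (EFin \o g) 2; rewrite pnatr_eq0 => /(_ isT).
have -> : (\int[mu]_x (`|(EFin \o g) x| `^ 2))%E = (\int[mu]_x (g x ^+ 2)%:E)%E.
  by apply: eq_integral => x _; rewrite /= powR_mulrn// real_normK ?num_real.
rewrite /Rintegral => <-.
have := Lnorm_ge0 mu 2%:E (EFin \o g).
case: ('N[mu]_2%:E[EFin \o g])%E => [r /=||]//.
  by rewrite lee_fin => r0; rewrite powR_mulrn.
(* For an infinite norm, [fine] makes both sides 0. *)
by move=> _; rewrite poweRyr ?pnatr_eq0//= expr0n.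
Qed.

(** The bound holds for every extension, but [band_norm] is an infimum of norms and not of their
    squares; square roots make the bound linear in the norm before the infimum is taken. *)
Lemma band_energy (I : set R) T g gam om u : band I -> 0 < T ->
  band_class T I g -> resonator_input T gam om g u ->
  \int[mu]_(t in `]0, T[) u t ^+ 2 <=
  sup [set multiplier gam om nu | nu in I] ^+ 2 * band_norm T I g ^+ 2.
Proof.
move=> bI T0 [_ ext] gu; set X := (X in X <= _).
set S := sup _.
have X0 : 0 <= X by apply: Rintegral_ge0 => t _; exact: sqr_ge0.
have S0 : 0 <= S.
  (* For an empty band the supremum is 0 by convention. *)
  have [I0|/set0P[nu Inu]] := eqVneq I set0; first by rewrite /S I0 image_set0 sup0.
  apply: le_trans (multiplier_ge0 gam om nu) _.
  by apply: ub_le_sup; [exact: multiplier_ubound|exists nu].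
have key gt : band_extension T I g gt -> Num.sqrt X <= S * fine ('N[mu]_2%:E[EFin \o gt])%E.
  move=> egt; have [/memL2P lgt _ _] := egt.
  have {}lgt : L2 setT gt by exact: lgt.
  have := band_resonator bI T0 egt gu; rewrite -/X -/S -Lnorm2_sqr// -exprMn.
  by move=> le; rewrite -(ler_sqr (sqrtr_ge0 _)) ?nnegrE ?sqr_sqrtr// mulr_ge0// fine_ge0// Lnorm_ge0.
suff : Num.sqrt X <= S * band_norm T I g.
  move=> le; rewrite -exprMn -[leLHS]sqr_sqrtr// ler_sqr ?nnegrE ?sqrtr_ge0//.
  by rewrite (le_trans _ le)// sqrtr_ge0.
(* Comparison with the infimum divides by S; when S = 0, a single extension already gives the
   bound. *)
have [SE|Sn] := eqVneq S 0.
  by have [gt /key] := ext; rewrite SE !mul0r.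
have {Sn} S1 : 0 < S by rewrite lt_def Sn.
rewrite mulrC -ler_pdivrMr//; apply: lb_le_inf.
  by have [gt egt] := ext; exists (fine ('N[mu]_2%:E[EFin \o gt])%E), gt.
by move=> _ [gt /key le <-]; rewrite ler_pdivrMr// mulrC.
Qed.

End resonator.

(** * Reference inputs *)

Section reference.
Variable R : realType.
Notation mu := (@lebesgue_measure R).

Lemma L1_Rintegral_sum (D : set R) I (r : seq I) (F : I -> R -> R) : measurable D ->
  (forall i, L1 D (F i)) ->
  \int[mu]_(x in D) (\sum_(i <- r) F i x) = \sum_(i <- r) \int[mu]_(x in D) F i x.
Proof.
move=> mD lF; elim: r => [|i s ih].
  rewrite big_nil -[RHS](mul0r (fine (mu D))) -Rintegral_cst//.
  by apply: eq_Rintegral => x _; rewrite big_nil.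
rewrite big_cons -ih -L1_RintegralD//; last exact: L1_sum.
by apply: eq_Rintegral => x _; rewrite big_cons.
Qed.

Lemma vweak_deriv_unique k T (g dg dg' : R -> 'cV[R]_k) : 0 < T ->
  vweak_deriv T g dg -> vweak_deriv T g dg' ->
  {ae mu, forall t, t \in `]0, T[ -> dg t = dg' t}.
Proof.
move=> T0 gd gd'.
have : {ae mu, forall t, forall i, t \in `]0, T[ -> dg t i 0 = dg' t i 0}.
  by apply: ae_forall => i; apply: weak_deriv_unique T0 _ (gd i) (gd' i); exact: aeW.
by apply: ae_imp => t E tT; apply/matrixP => i j; rewrite ord1 E.
Qed.

Lemma vweak_deriv_ae k T (g g' dg : R -> 'cV[R]_k) :
  {ae mu, forall t, t \in `]0, T[ -> g t = g' t} ->
  vweak_deriv T g dg -> vweak_deriv T g' dg.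
Proof.
by move=> gg' gd i; apply: weak_deriv_ae (gd i); apply: ae_imp gg' => t E /E ->.
Qed.

Lemma vH1_from_rep k T c (g dg : R -> 'cV[R]_k) : vH1_from T c g dg ->
  exists h, [/\ vH1_rep T h dg, h 0 = c &
    {ae mu, forall t, t \in `]0, T[ -> g t = h t}].
Proof.
move=> /choice[h hP]; exists (fun t => \col_i h i t); split.
- move=> i; have [hi _ _] := hP i; rewrite (_ : (fun t => _) = h i)//.
  by apply/funext => t; rewrite mxE.
- by apply/matrixP => i j; rewrite ord1 mxE; have [] := hP i.
- have : {ae mu, forall t, forall i, t \in `]0, T[ -> g t i 0 = h i t}.
    by apply: ae_forall => i; have [] := hP i.
  by apply: ae_imp => t E tT; apply/matrixP => i j; rewrite ord1 mxE E.
Qed.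

Lemma vH1_from_weak k T c (g dg : R -> 'cV[R]_k) : vH1_from T c g dg -> vweak_deriv T g dg.
Proof. by move=> h i; exists (c i 0); exact: h. Qed.

Section model.
Variables (n Nc : nat) (P : model R n Nc) (T : R) (Cd : 'M[R]_(Nc, n)).
Variables (I : set R) (Ia : 'I_Nc -> set R).
Variables (ar : R -> 'cV[R]_n) (etar : R -> 'cV[R]_Nc).
Hypotheses (T_gt0 : 0 < T) (ref : band_reference P T Cd I Ia ar etar).

(** [band_reference] gives [etar] no derivatives; they are supplied by its representation as a
    superposition over the band. *)
Lemma reference_input_exists : exists ur, vresonator_input P T etar ur.
Proof.
have [_ _ bands] := ref.
have : forall al, exists u, resonator_input T (decay P al) (resfreq P al) (fun t => etar t al 0) u.
  move=> al; have [bI [_ [gt /(band_wave bI T_gt0)[p [q [lp lq _ gw]]]]]] := bands al.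
  have [lu [d [dd [gd ddd uE]]]] := wave_input (decay P al) (resfreq P al) bI lp lq T_gt0.
  exists (wave (Ia al) (filterP (decay P al) (resfreq P al) p q)
    (filterQ (decay P al) (resfreq P al) p q)); split => //.
  exists d, dd; split => //.
    by apply: weak_deriv_ae gd; apply: ae_imp gw => t E /E.
  by apply: ae_imp2 gw uE => t E1 E2 tT; rewrite E2// E1.
move=> /choice[u uP]; exists (fun t => \col_al u al t) => al.
rewrite (_ : (fun t => (\col_al0 _) al 0) = u al)//.
by apply/funext => t; rewrite mxE.
Qed.

Lemma reference_input_energy ur : vresonator_input P T etar ur ->
  sqnormL2 T ur <= energy_bound P T Ia etar.
Proof.
have [_ _ bands] := ref.
move=> etaru; rewrite /sqnormL2 /sqnorm L1_Rintegral_sum//; last first.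
  by move=> al; have /memL2P lu := (etaru al).1; apply: (lu _).2.
by apply: ler_sum => al _; have [bI cI] := bands al; exact: band_energy (etaru al).
Qed.

(** [compatible] provides representatives with zero initial data, [band_reference] the derivatives
    that define the source. Uniqueness of weak derivatives identifies the two families, and C Cd = 1
    turns the definition of the source back into the acoustic equation. *)
Lemma reference_solution ur : coupling P *m Cd = 1%:M -> compatible T 0 ar etar ->
  vresonator_input P T etar ur ->
  exists a da eta deta, is_solution P T 0 ur a da eta deta /\
    {ae mu, forall t, t \in `]0, T[ -> a t = ar t}.
Proof.
move=> CCd [dar [ddar [detar [ddetar [har hdar hetar hdetar]]]]] inp.
have [_ [dar' [ddar' [war wdar etarE]]] _] := ref.
have [a [ha a0 aE]] := vH1_from_rep har; have [da [hda da0 daE]] := vH1_from_rep hdar.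
have [eta [he e0 eE]] := vH1_from_rep hetar.
have [deta [hde de0 deE]] := vH1_from_rep hdetar.
have sub : `]0, T[ `<=` `[0, T] by exact: subset_itv_oo_cc.
exists a, da, eta, deta; split; last by apply: ae_imp aE => t E /E.
split; first by rewrite a0 da0 e0 de0.
exists ddar, ddetar; split.
- split => //; apply: vH1_ae daE _ ha.
  by apply: (vL2S (D := `[0, T])) => //; exact: vH1_vL2_self hda.
- split => //; apply: vH1_ae deE _ he.
  by apply: (vL2S (D := `[0, T])) => //; exact: vH1_vL2_self hde.
- have E1 := vweak_deriv_unique T_gt0 war (vH1_from_weak har).
  have E2 := vweak_deriv_unique T_gt0 (vweak_deriv_ae E1 wdar) (vH1_from_weak hdar).
  have E3 := ae_imp2 (fun t (e : t \in `]0, T[ -> _) (f : t \in `]0, T[ -> _) => conj e f) aE eE.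
  apply: ae_imp3 E2 E3 etarE => t e2 [e3 e4] e5 tT.
  by rewrite -(e4 tT) (e5 tT) mulmxA CCd mul1mx (e2 tT) (e3 tT).
- have E : {ae mu, forall t, forall al, t \in `]0, T[ -> ur t al 0 = ddetar t al 0 +
      2 * decay P al * detar t al 0 + (resfreq P al ^+ 2 + decay P al ^+ 2) * etar t al 0}.
    apply: ae_forall => al.
    have [_ [d [dd [wd wdd uE]]]] := inp al.
    have F1 : {ae mu, forall t, t \in `]0, T[ -> d t = detar t al 0}.
      by apply: weak_deriv_unique T_gt0 _ wd (vH1_from_weak hetar al); exact: aeW.
    have F2 := weak_deriv_unique T_gt0 F1 wdd (vH1_from_weak hdetar al).
    by apply: ae_imp3 F1 F2 uE => t f1 f2 f3 tT; rewrite f3// f1// f2.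
  apply: ae_imp3 E eE deE => t e1 e2 e3 tT; apply/matrixP => al j; rewrite ord1 e1//.
  rewrite /Gamma /Kmx -e2// -e3// -scalemxAl !mul_diag_mx !mxE; ring.
Qed.

Lemma reference_value m (Rm : 'M[R]_(m, n)) (ad : R -> 'cV[R]_m) (lam : R) : 0 < lam ->
  coupling P *m Cd = 1%:M -> compatible T 0 ar etar ->
  vmemL2 `]0, T[ ad -> {ae mu, forall t, t \in `]0, T[ -> ad t = Rm *m ar t} ->
  optimal_value P T Rm ad 0 lam <= lam / 2 * energy_bound P T Ia etar.
Proof.
move=> lam0 CCd comp /(vmemL2P _ (measurable_itv _)) lad adE.
have [ur inp] := reference_input_exists.
have lur : vmemL2 `]0, T[ ur by move=> al; have [] := inp al.
have [a [da [eta [deta [sol aE]]]]] := reference_solution CCd comp inp.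
have acE := acoustic_unique T_gt0 lur (aeW _ (fun _ _ => erefl)) sol.
apply: (@le_trans _ _ (cost P T Rm ad 0 lam ur)).
  apply: ge_inf; last by exists ur.
  exists 0 => _ [v _ <-].
  by rewrite addr_ge0// mulr_ge0 ?sqnormL2_ge0// ?invr_ge0// divr_ge0// ltW.
rewrite /cost (_ : sqnormL2 T (fun t => _ - _) = 0).
  rewrite mulr0 add0r ler_wpM2l ?divr_ge0 ?(ltW lam0)//.
  exact: reference_input_energy.
have mT : measurable (`]0, T[ : set R) by exact: measurable_itv.
have lac : vL2 `]0, T[ (acoustic P T 0 ur).
  have [db [zeta [dzeta [_ [dda [ddz [[hac _] _ _ _]]]]]]] := acoustic_solution P T_gt0 0 lur.
  by apply: (vL2S (D := `[0, T])) => //; [exact: subset_itv_oo_cc|exact: vH1_vL2_self hac].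
have ld := vL2B mT (vL2_mulmx Rm mT lac) lad.
transitivity (\int[mu]_(t in `]0, T[) (0 : R)); last by rewrite Rintegral_cst// mul0r.
apply: ae_eq_Rintegral => //; first exact: L1_measurable (vL2_sqnorm mT ld).
apply: ae_imp2 aE adE => t e1 e2 tT.
rewrite acE; last exact: subset_itv_oo_cc.
rewrite e1// e2// subrr /sqnorm big1// => i _; by rewrite mxE expr0n.
Qed.

End model.
End reference.

(** * Frequency matching *)

Section matched.
Variable R : realType.
Notation mu := (@lebesgue_measure R).

Lemma Rintegral_itv_cst (c x : R) : 0 <= x -> \int[mu]_(t in `[0, x]) c = c * x.
Proof.
move=> x0; rewrite (Rintegral_FTC2 x0 (is_derive_lin c)); last by move=> y; exact: cvg_cst.
by rewrite mulr0 subr0.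
Qed.

Lemma ler_norm_sin (x : R) : 0 <= x -> `|sin x| <= x.
Proof.
move=> x0; have := Rintegral_FTC2 x0 (fun y => is_derive_sin y) (@continuous_cos R).
rewrite sin0 subr0 => <-.
have lc : L1 `[0, x] (@cos R).
  apply: (L1_bounded (M := 1)) => //; first exact: itv_finite.
  - by apply: measurable_funTS; apply: continuous_measurable_fun; exact: continuous_cos.
  - by move=> y _; exact: cos_max.
apply: le_trans (le_normr_Rintegral _ lc) _ => //.
apply: (@le_trans _ _ (\int[mu]_(t in `[0, x]) 1)); last first.
  by rewrite Rintegral_itv_cst// mul1r.
apply: le_Rintegral => //; [exact: L1_norm|exact: L1_cst1|].
by move=> y _; exact: cos_max.
Qed.

(** Strictness comes from |sin(2 y)| = 2 |sin y| |cos y|, where either |cos y| < 1 or sin y = 0. It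
    makes T - |sin(w T)| / w positive. *)
Lemma ltr_norm_sin (x : R) : 0 < x -> `|sin x| < x.
Proof.
move=> x0; pose y := x / 2.
have xE : x = y *+ 2 by rewrite /y -mulr_natr divfK// pnatr_eq0.
have y0 : 0 < y by rewrite divr_gt0.
rewrite xE sin_mulr2n normrMn normrM ltr_pMn2r//.
have sy := ler_norm_sin (ltW y0); have cy := cos_max y.
have cs := cos2Dsin2 y; rewrite -(real_normK (num_real (cos y))) in cs.
rewrite -(real_normK (num_real (sin y))) in cs.
have s0 := normr_ge0 (sin y); have c0 := normr_ge0 (cos y).
have [c1|c1] := ltP `|cos y| 1; first by rewrite (le_lt_trans (ler_wpM2l c0 sy))// gtr_pMl.
move: cs; have -> : `|cos y| = 1 by apply/eqP; rewrite eq_le cy.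
by rewrite expr1n -[RHS]addr0 => /addrI/eqP; rewrite sqrf_eq0 => /eqP ->; rewrite mulr0.
Qed.

Lemma is_derive_sinusoid (w A B x : R) :
  is_derive x (1 : R) (sinusoid w A B) (sinusoid w (w * B) (- (w * A)) x).
Proof.
apply: is_derive_eq.
rewrite /sinusoid /GRing.scale/=; ring.
Qed.

Lemma continuous_sinusoid (w A B : R) : continuous (sinusoid w A B).
Proof.
by move=> x; apply: cvgD; apply: cvgM; [exact: cvg_cst|exact: continuous_cos_lin|
  exact: cvg_cst|exact: continuous_sin_lin].
Qed.

Lemma H1_sinusoid T (w A B : R) : 0 <= T ->
  H1_rep T (sinusoid w A B) (sinusoid w (w * B) (- (w * A))).
Proof.
move=> T0; apply: H1_C1 => //; first by move=> t; exact: is_derive_sinusoid.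
exact: continuous_sinusoid.
Qed.

Lemma sinusoid_input T (g w A B : R) (u : R -> R) : 0 < T ->
  resonator_input T g w (sinusoid w A B) u ->
  {ae mu, forall t, t \in `]0, T[ ->
    u t = g ^+ 2 * sinusoid w A B t + 2 * g * sinusoid w (w * B) (- (w * A)) t}.
Proof.
move=> T0 [_ [d [dd [wd wdd uE]]]].
have h1 := H1_weak_deriv (H1_sinusoid w A B (ltW T0)).
have h2 := H1_weak_deriv (H1_sinusoid w (w * B) (- (w * A)) (ltW T0)).
have E1 := weak_deriv_unique T0 (aeW _ (fun _ _ => erefl)) wd h1.
have E2 := weak_deriv_unique T0 E1 wdd h2.
apply: ae_imp3 E1 E2 uE => t e1 e2 e3 tT.
by rewrite e3// e2// e1// /sinusoid; ring.
Qed.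

(* The exact primitive of the square of a sinusoid; its oscillating part is
   bounded by [(A ^+ 2 + B ^+ 2) * `|sin (w T)| / (2 w)]. *)
Lemma sinusoid_energy T (w A B : R) : 0 < w -> 0 <= T ->
  (A ^+ 2 + B ^+ 2) / 2 * (T - `|sin (w * T)| / w) <=
  \int[mu]_(t in `[0, T]) sinusoid w A B t ^+ 2.
Proof.
move=> w0 T0.
(* The square of the sinusoid is (A^2 + B^2) / 2 + (A^2 - B^2) / 2 cos(2 w t) + A B sin(2 w t); the
   primitive of the last two terms that vanishes at 0 has sin(w t) as a factor. *)
pose F t := (A ^+ 2 + B ^+ 2) / 2 * t +
  sin (w * t) * sinusoid w ((A ^+ 2 - B ^+ 2) / (2 * w)) (A * B / w) t.
have dF (x : R) : is_derive x (1 : R) F (sinusoid w A B x ^+ 2).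
  apply: is_derive_eq.
  rewrite /sinusoid /GRing.scale/=.
  have cs := cos2Dsin2 (w * x).
  rewrite -[X in (A ^+ 2 + B ^+ 2) / 2 * X]cs; field; exact: lt0r_neq0.
rewrite (Rintegral_FTC2 T0 dF); last first.
  by move=> x; rewrite -[X in continuous_at _ X]/(fun t => sinusoid w A B t ^+ 2) /continuous_at;
    apply: cvgM; exact: continuous_sinusoid.
rewrite /F !mulr0 sin0 mul0r !addr0 subr0 mulrBr lerD2l.
set s := sin (w * T); set b := sinusoid _ _ _ _.
apply: (@le_trans _ _ (- `|s * b|)); last by rewrite lerNl -normrN ler_norm.
rewrite lerN2 normrM mulrC.
have bw : `|b| <= (A ^+ 2 + B ^+ 2) / (2 * w).
  have -> : b = ((A ^+ 2 - B ^+ 2) * cos (w * T) + 2 * (A * B) * sin (w * T)) / (2 * w).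
    by rewrite /b /sinusoid; field; exact: lt0r_neq0.
  have w2 : 0 < 2 * w by rewrite mulr_gt0.
  rewrite normrM (gtr0_norm (x := (2 * w)^-1)) ?invr_gt0// ler_pM2r ?invr_gt0//.
  rewrite -ler_sqr ?nnegrE ?normr_ge0 ?addr_ge0 ?sqr_ge0// real_normK ?num_real//.
  have := cos2Dsin2 (w * T); move: (cos _) (sin _) => c d cd.
  (* Cauchy-Schwarz in the plane, with (A^2 - B^2)^2 + (2 A B)^2 = (A^2 + B^2)^2. *)
  rewrite -subr_ge0 (_ : _ - _ = ((A ^+ 2 - B ^+ 2) * d - 2 * (A * B) * c) ^+ 2) ?sqr_ge0//.
  have -> : (A ^+ 2 + B ^+ 2) ^+ 2 = (A ^+ 2 + B ^+ 2) ^+ 2 * (c ^+ 2 + d ^+ 2) by rewrite cd mulr1.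
  ring.
apply: (@le_trans _ _ ((A ^+ 2 + B ^+ 2) / (2 * w) * `|s|)); first by rewrite ler_wpM2r.
by rewrite le_eqVlt; apply/orP; left; apply/eqP; field; exact: lt0r_neq0.
Qed.

Lemma sinusoid_bound (w A B t : R) : sinusoid w A B t ^+ 2 <= A ^+ 2 + B ^+ 2.
Proof.
have cs := cos2Dsin2 (w * t); rewrite /sinusoid -subr_ge0.
rewrite (_ : _ - _ = (A * sin (w * t) - B * cos (w * t)) ^+ 2) ?sqr_ge0//.
by rewrite -[A ^+ 2 + B ^+ 2]mulr1 -cs; ring.
Qed.

Lemma L2_sinusoid T (w A B : R) : L2 `[0, T] (sinusoid w A B).
Proof.
apply: (L2_bounded (M := 1 + (A ^+ 2 + B ^+ 2))) => //; first exact: itv_finite.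
  by apply: measurable_funTS; apply: continuous_measurable_fun; exact: continuous_sinusoid.
move=> t _; have := sinusoid_bound w A B t; rewrite -real_normK ?num_real//.
have := normr_ge0 (sinusoid w A B t); nra.
Qed.

(** The bound is the inverse of one for 1 / f on the compact set; unlike an attained minimum, this
    also covers the empty set. *)
Lemma compact_pos_lbound (W : set R) (f : R -> R) : compact W ->
  {within W, continuous f} -> (forall x, W x -> 0 < f x) ->
  exists2 c : R, 0 < c & forall x, W x -> c <= f x.
Proof.
move=> cW cf f0.
have cg : {within W, continuous (fun x => (f x)^-1)}.
  apply/subspace_continuousP => x Wx; apply: cvgV; first by rewrite gt_eqF ?f0.
  by move/subspace_continuousP: cf; exact.
have [M [_ hM]] := compact_bounded (continuous_compact cg cW).
have M1 : 0 < `|M| + 1 by rewrite ltr_wpDl.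
exists (`|M| + 1)^-1; first by rewrite invr_gt0.
move=> x Wx; rewrite -[leRHS]invrK lef_pV2 ?posrE ?invr_gt0 ?f0//.
apply: le_trans (ler_norm _) _; apply: (hM (`|M| + 1)); last by exists x.
by rewrite (le_lt_trans (ler_norm M))// ltrDl.
Qed.

(** With b = 2 g w, the upper bound is sqrt(g^4 + b^2) - b <= g^4 / (2 b). *)
Lemma matched_multiplier (g w : R) : 0 < g -> 0 < w ->
  0 <= multiplier g w w - 2 * g * w <= g ^+ 3 / (4 * w).
Proof.
move=> g0 w0; have m0 := multiplier_ge0 g w w.
have mE : multiplier g w w ^+ 2 = g ^+ 4 + (2 * g * w) ^+ 2.
  by rewrite multiplier_sqr; ring.
have gw : 0 <= 2 * g * w by rewrite !mulr_ge0// ltW.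
have q0 : 0 <= g ^+ 3 / (4 * w) by rewrite divr_ge0 ?exprn_ge0 ?mulr_ge0 ?ltW.
rewrite subr_ge0 lerBlDr -(ler_sqr (multiplier_ge0 g w w)) ?nnegrE ?addr_ge0//.
rewrite -(ler_sqr gw) ?nnegrE// mE lerDr exprn_ge0 ?(ltW g0)//=.
rewrite sqrrD -addrA -[leLHS]add0r lerD ?sqr_ge0// lerD2r -mulr_natr.
by rewrite le_eqVlt; apply/orP; left; apply/eqP; field; exact: lt0r_neq0.
Qed.

(** The input g^2 S + 2 g S' has square at most 2 g^4 S^2 + 8 g^2 S'^2, and S'^2 <= w^2 r with r =
    A^2 + B^2. Since r c / 2 is at most the energy of S, the term 8 g^2 w^2 r T is at most 16 g^2
    w^2 T / c times that energy. *)
Lemma matched_energy T (g w A B c : R) (u : R -> R) : 0 < T -> 0 < c ->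
  c <= T - `|sin (w * T)| / w -> 0 < w ->
  resonator_input T g w (sinusoid w A B) u ->
  \int[mu]_(t in `]0, T[) u t ^+ 2 <= (2 * g ^+ 4 + 16 * g ^+ 2 * w ^+ 2 * T / c) *
  \int[mu]_(t in `]0, T[) sinusoid w A B t ^+ 2.
Proof.
move=> T0 c0 cT w0 inp; have uE := sinusoid_input T0 inp.
have /memL2P lu := inp.1; have {}lu : L2 `]0, T[ u by apply: lu.
have sub : `]0, T[ `<=` `[0, T] by exact: subset_itv_oo_cc.
have lS := L2_sinusoid T w A B; have lS' := L2_sinusoid T w (w * B) (- (w * A)).
set S := sinusoid w A B in uE lS *; set S' := sinusoid w (w * B) _ in uE lS'.
have m0T : measurable (`[0, T] : set R) by exact: measurable_itv.
have lU : L2 `[0, T] (fun t => g ^+ 2 * S t + 2 * g * S' t).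
  by apply: L2D => //; exact: L2Z.
rewrite (ae_eq_Rintegral (g := fun t => (g ^+ 2 * S t + 2 * g * S' t) ^+ 2)) //; last 3 first.
- exact: L1_measurable lu.2.
- by apply: (measurable_funS m0T sub); exact: L1_measurable lU.2.
- by apply: ae_imp uE => t E tT; rewrite E.
rewrite !Rintegral_itv_oo_cc; [|exact: L1S lS.2|exact: L1S lU.2].
set r := A ^+ 2 + B ^+ 2.
have r0 : 0 <= r by rewrite addr_ge0 ?sqr_ge0.
have en : r / 2 * c <= \int[mu]_(t in `[0, T]) S t ^+ 2.
  by apply: le_trans (sinusoid_energy A B w0 (ltW T0)); rewrite ler_wpM2l// divr_ge0.
have en' : \int[mu]_(t in `[0, T]) (8 * g ^+ 2 * (w ^+ 2 * r)) = 8 * g ^+ 2 * (w ^+ 2 * r) * T.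
  exact: Rintegral_itv_cst (ltW T0).
have l2 := L1Z (2 * g ^+ 4) m0T lS.2.
have l3 : L1 `[0, T] (fun=> 8 * g ^+ 2 * (w ^+ 2 * r)) by apply: L1_cst => //; exact: itv_finite.
apply: (@le_trans _ _ (\int[mu]_(t in `[0, T]) (2 * g ^+ 4 * S t ^+ 2 + 8 * g ^+ 2 * (w ^+ 2 * r)))).
  apply: le_Rintegral => //; [exact: lU.2|exact: L1D|].
  move=> t _; have : S' t ^+ 2 <= w ^+ 2 * r.
    apply: le_trans (sinusoid_bound _ _ _ _) _.
    by rewrite le_eqVlt; apply/orP; left; apply/eqP; rewrite /r; ring.
  move: (S t) (S' t) => a b le.
  apply: (@le_trans _ _ (2 * g ^+ 4 * a ^+ 2 + 8 * g ^+ 2 * b ^+ 2)).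
    by rewrite -subr_ge0 (_ : _ - _ = (g ^+ 2 * a - 2 * g * b) ^+ 2) ?sqr_ge0//; ring.
  by rewrite lerD2l ler_wpM2l// mulr_ge0// sqr_ge0.
rewrite (L1_RintegralD m0T l2 l3) RintegralZl//; last exact: lS.2.
rewrite en' [leRHS]mulrDl lerD2l.
have k0 : 0 <= 16 * g ^+ 2 * w ^+ 2 * T / c.
  by rewrite divr_ge0 ?(ltW c0)// mulr_ge0 ?(ltW T0)// mulr_ge0 ?sqr_ge0// mulr_ge0// sqr_ge0.
apply: le_trans (ler_wpM2l k0 en).
by rewrite le_eqVlt; apply/orP; left; apply/eqP; field; exact: lt0r_neq0.
Qed.

(** The frequency varies with e, so all constants have to be uniform on W. Compactness yields a
    lower bound w and an upper bound M for the frequency, and a lower bound c for the energy factor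
    T - |sin(x T)| / x. *)
Lemma matched_frequency (g o : R -> R) (W : set R) T : 0 < T -> band W ->
  (forall e, 0 < e -> 0 < g e) -> (forall e, 0 < e -> 0 < o e) ->
  (\forall e \near 0^'+, W (o e)) -> g e @[e --> 0^'+] --> 0 ->
  (fun e => multiplier (g e) (o e) (o e) - 2 * g e * o e) =O_ (0^'+) (fun e => g e ^+ 3) /\
  (g =O_ (0^'+) (fun e => e) ->
   (fun e => multiplier (g e) (o e) (o e) ^+ 2) =O_ (0^'+) (fun e => e ^+ 2) /\
   exists M : R, \forall e \near 0^'+, forall (A B : R) (u : R -> R),
     resonator_input T (g e) (o e) (sinusoid (o e) A B) u ->
     \int[mu]_(t in `]0, T[) (u t ^+ 2) <=
       M * e ^+ 2 * \int[mu]_(t in `]0, T[) (sinusoid (o e) A B t ^+ 2)).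
Proof.
move=> T0 [cW W0] g0 o0 Wo glim.
have [w w0 wW] : exists2 c : R, 0 < c & forall x, W x -> c <= x.
  by apply: (compact_pos_lbound (f := id)) => //; apply: continuous_subspaceT => x; exact: cvg_id.
have [M WM] : exists M : R, forall x, W x -> x <= M.
  have [_ _ _ [M hM]] := bandP (conj cW W0).
  by exists M => x /hM; exact: le_trans (ler_norm x).
have [c c0 cT] : exists2 c : R, 0 < c & forall x, W x -> c <= T - `|sin (x * T)| / x.
  apply: compact_pos_lbound => //.
    apply/subspace_continuousP => x Wx; apply: cvgB; first exact: cvg_cst.
    apply: cvgM; last by apply: cvgV; [rewrite gt_eqF//; exact: W0|exact: cvg_within].
    apply: cvg_norm; apply: continuous_cvg; first exact: continuous_sin.
    by apply: cvgM; [exact: cvg_within|exact: cvg_cst].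
  move=> x /W0/= x0; rewrite subr_gt0 ltr_pdivrMr// mulrC [ltRHS]mulrC.
  by rewrite [T * x]mulrC ltr_norm_sin// mulr_gt0.
split.
  apply/eqO_exP; exists (4 * w)^-1; first by rewrite invr_gt0 mulr_gt0.
  near=> e.
  have e0 : 0 < e by near: e; exact: nbhs_right_gt.
  have /wW wo : W (o e) by near: e.
  have /andP[m0 m1] := matched_multiplier (g0 _ e0) (o0 _ e0).
  rewrite (ger0_norm m0) gtr0_norm ?exprn_gt0 ?g0//.
  apply: le_trans m1 _; rewrite mulrC ler_wpM2r ?exprn_ge0 ?(ltW (g0 _ e0))//.
  by rewrite lef_pV2 ?posrE ?mulr_gt0 ?o0// ler_wpM2l.
move=> /eqO_exP[K K0 gK].
(* The bound g e <= 1 is recorded so that g^4 can be absorbed into g^2. *)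
have bounds : \forall e \near 0^'+, [/\ 0 < e, W (o e), g e <= K * e & g e <= 1].
  near=> e.
  have e0 : 0 < e by near: e; exact: nbhs_right_gt.
  have Woe : W (o e) by near: e.
  split => //.
    have : `|g e| <= K * `|e| by near: e.
    by rewrite (gtr0_norm e0) (gtr0_norm (g0 _ e0)).
  near: e; move/cvgrPdist_le : glim => /(_ 1 ltr01); apply: filterS => e.
  by rewrite sub0r normrN => /(le_trans (ler_norm _)).
have sq (e : R) : 0 < e -> g e <= K * e -> g e <= 1 -> g e ^+ 2 <= K ^+ 2 * e ^+ 2 /\
    g e ^+ 4 <= K ^+ 2 * e ^+ 2.
  move=> /g0 ge0 gKe g1.
  have le2 : g e ^+ 2 <= K ^+ 2 * e ^+ 2.
    by rewrite -exprMn ler_sqr ?nnegrE ?(ltW ge0)// (le_trans (ltW ge0)).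
  split => //; apply: le_trans le2.
  by rewrite (exprM _ 2 2) -[leRHS]mulr1 expr2 ler_wpM2l ?sqr_ge0// exprn_ile1// ltW.
split.
  (* The squared multiplier is g^4 + 4 o^2 g^2, where g^2 and g^4 are at most K^2 e^2 and o is at
     most M. *)
  apply/eqO_exP; exists (K ^+ 2 * (1 + 4 * M ^+ 2)).
    by rewrite mulr_gt0 ?exprn_gt0// ltr_pwDl// mulr_ge0// sqr_ge0.
  apply: filterS bounds => e [e0 /WM oM gK' g1].
  rewrite !ger0_norm ?sqr_ge0// multiplier_sqr.
  have [le2 le4] := sq _ e0 gK' g1.
  have o2 : o e ^+ 2 <= M ^+ 2.
    by rewrite ler_sqr ?nnegrE ?(ltW (o0 _ e0))// (le_trans _ oM)// ltW// o0.
  apply: (@le_trans _ _ (g e ^+ 4 + 4 * o e ^+ 2 * g e ^+ 2)).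
    by rewrite le_eqVlt; apply/orP; left; apply/eqP; ring.
  rewrite mulrDr mulr1 mulrDl lerD//.
  rewrite [leRHS](_ : _ = 4 * M ^+ 2 * (K ^+ 2 * e ^+ 2)); last by ring.
  by apply: ler_pM (le2); [rewrite mulr_ge0// sqr_ge0|exact: sqr_ge0|rewrite ler_wpM2l].
exists (K ^+ 2 * (2 + 16 * M ^+ 2 * T / c)).
apply: filterS bounds => e [e0 We gK' g1] A B u inp; have oM := WM _ We; have co := cT _ We.
apply: le_trans (matched_energy T0 c0 co (o0 _ e0) inp) _.
apply: ler_wpM2r; first by apply: Rintegral_ge0 => t _; exact: sqr_ge0.
have [le2 le4] := sq _ e0 gK' g1.
have o2 : o e ^+ 2 <= M ^+ 2.
  by rewrite ler_sqr ?nnegrE ?(ltW (o0 _ e0))// (le_trans _ oM)// ltW// o0.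
rewrite [leRHS](_ : _ = 2 * (K ^+ 2 * e ^+ 2) + 16 * (K ^+ 2 * e ^+ 2) * M ^+ 2 * T / c); last by ring.
rewrite lerD ?ler_wpM2l// ler_wpM2r ?invr_ge0 ?(ltW c0)// ler_wpM2r ?(ltW T0)//.
apply: ler_pM o2; [by rewrite mulr_ge0// sqr_ge0|exact: sqr_ge0|by rewrite ler_wpM2l].
Unshelve. all: by end_near.
Qed.

End matched.

Unset Implicit Arguments.

Theorem theorem1p1 (R : realType) (n Nc m : nat)
    (n_gt0 : (0 < n)%N) (Nc_gt0 : (0 < Nc)%N) (m_gt0 : (0 < m)%N)
    (omega : 'I_n -> R) (omega_gt0 : forall k, 0 < omega k)
    (C : R -> 'M[R]_(n, Nc)) (gam om : R -> 'I_Nc -> R)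
    (gam_gt0 : forall (eps : R) (al : 'I_Nc), 0 < eps -> 0 < gam eps al)
    (om_gt0 : forall (eps : R) (al : 'I_Nc), 0 < eps -> 0 < om eps al)
    (T : R) (T_gt0 : 0 < T)
    (Rm : 'M[R]_(m, n)) (ad : R -> 'cV[R]_m) (ad_L2 : vmemL2 `]0, T[ ad)
    (x0 : state R n Nc) :
  let P eps := Model omega (C eps) (gam eps) (om eps) in
  [/\
      forall eps mu : R, 0 < eps -> 0 < mu ->
        (exists u, is_minimizer (P eps) T Rm ad x0 mu u /\
           forall v, is_minimizer (P eps) T Rm ad x0 mu v ->
             {ae leb R, forall t, t \in `]0, T[ -> v t = u t}) /\
        (forall u, vmemL2 `]0, T[ u ->
           (is_minimizer (P eps) T Rm ad x0 mu u <->
            exists pa pv pe pz,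
              is_adjoint (P eps) T Rm ad (acoustic (P eps) T x0 u)
                pa pv pe pz /\
              {ae leb R, forall t, t \in `]0, T[ -> mu *: u t + pz t = 0})),
      forall (eps : R) Cd I Ia ar etar, 0 < eps ->
        \rank (C eps) = n -> C eps *m Cd = 1%:M ->
        band_reference (P eps) T Cd I Ia ar etar ->
        (exists ur, vresonator_input (P eps) T etar ur) /\
        (forall ur, vresonator_input (P eps) T etar ur ->
           sqnormL2 T ur <= energy_bound (P eps) T Ia etar),
      forall (eps mu : R) Cd I Ia ar etar, 0 < eps -> 0 < mu ->
        \rank (C eps) = n -> C eps *m Cd = 1%:M ->
        band_reference (P eps) T Cd I Ia ar etar ->
        x0 = 0 -> compatible T x0 ar etar ->
        {ae leb R, forall t, t \in `]0, T[ -> ad t = Rm *m ar t} ->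
        optimal_value (P eps) T Rm ad x0 mu <=
          mu / 2 * energy_bound (P eps) T Ia etar &
      forall (W : set R) (al : 'I_Nc), band W ->
        (\forall eps \near 0^'+, W (om eps al)) ->
        gam eps al @[eps --> 0^'+] --> 0 ->
        (fun eps => multiplier (gam eps al) (om eps al) (om eps al)
                    - 2 * gam eps al * om eps al)
          =O_ (0^'+) (fun eps => gam eps al ^+ 3) /\
        ((fun eps => gam eps al) =O_ (0^'+) (fun eps => eps) ->
         (fun eps => multiplier (gam eps al) (om eps al) (om eps al) ^+ 2)
           =O_ (0^'+) (fun eps => eps ^+ 2) /\
         exists M : R, \forall eps \near 0^'+, forall (A B : R) (u : R -> R),
           resonator_input T (gam eps al) (om eps al)
             (sinusoid (om eps al) A B) u ->
           \int[leb R]_(t in `]0, T[) (u t ^+ 2) <=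
             M * eps ^+ 2 *
             \int[leb R]_(t in `]0, T[) (sinusoid (om eps al) A B t ^+ 2))].
Proof.
move=> P; split.
- by move=> eps lam _ lam0; exact: optimal_control_characterization.
- move=> eps Cd I Ia ar etar _ _ _ ref; split; first exact: (reference_input_exists T_gt0 ref).
  by move=> ur; exact: (reference_input_energy T_gt0 ref).
- move=> eps lam Cd I Ia ar etar _ lam0 _ CCd ref -> comp adE.
  exact: (reference_value T_gt0 ref lam0 CCd comp ad_L2 adE).
- move=> W al bW Wom glim; apply: (matched_frequency T_gt0 bW) Wom glim => e e0.
    exact: gam_gt0.
  exact: om_gt0.
Qed.
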